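(* Let $\Omega_0$ be a nonempty open subset of $\mathbb{R}^d$, let $A$ be a $d\times d$ integer matrix that is invertible (i.e. $\det A\neq 0$), and let $\mathcal{R}$ be a complete set of representatives $\bmod A\mathbb{Z}^d$. Assume in addition that $\Omega_0$ packs with the lattice $A\mathbb{Z}^d$, and define $$\Omega:=\Omega_0+A\mathbb{Z}^d,\qquad \mu:=\frac{|\det A|}{|\Omega_0|}\,\mathrm{Leb}_{(A^T)^{-1}[-\frac12,\frac12]^d+\mathbb{Z}^d}.$$ The following statements are equivalent: (i) $\Omega$ tiles $\mathbb{R}^d$ with $\mathcal{R}$. (ii) $\Omega_0$ tiles $\mathbb{R}^d$ with the lattice $\mathbb{Z}^d$ (and hence $|\Omega_0|=1$). (iii) $\Omega$ is spectral with pair measure $\mu$. (iv) The Fourier transform $f\mapsto\hat f$, from $L^1(\Omega)\cap L^2(\Omega)$ into $L^2(\mu)$, extends to an isometry from $L^2(\Omega)$ into $L^2(\mu)$.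
   Context: $|E|$ is the Lebesgue measure of a measurable set $E\subseteq\mathbb{R}^d$, and $\mathrm{Leb}_E$ is the restriction of Lebesgue measure to $E$. The Fourier transform is $\hat f(t)=\int_{\mathbb{R}^d}f(x)e^{-2\pi i t\cdot x}\,dx$; functions on a subset $\Omega$ are extended by $0$ to $\mathbb{R}^d$. A *complete set of representatives* $\bmod A\mathbb{Z}^d$ is a set $\mathcal{R}\subseteq\mathbb{Z}^d$ such that for every $k\in\mathbb{Z}^d$ there is a unique $r\in\mathcal{R}$ with $k-r\in A\mathbb{Z}^d$. A measurable set $\Omega$ *tiles* $\mathbb{R}^d$ with a set $\mathcal{T}\subset\mathbb{R}^d$ if the translates $\Omega+t$, $t\in\mathcal{T}$, form a partition of $\mathbb{R}^d$ up to Lebesgue measure zero. It *packs* with $\mathcal{T}$ if these translates are mutually disjoint up to measure zero (their union need not be $\mathbb{R}^d$). For a measurable set $\Omega\subseteq\mathbb{R}^d$ (possibly of infinite measure) and a positive Radon measure $\mu$ on $\mathbb{R}^d$, $\Omega$ is *spectral with pair measure* $\mu$ if: (1) for each $f\in L^1(\Omega)\cap L^2(\Omega)$ the continuous function $\hat f$ satisfies $\int|\hat f|^2\,d\mu<\infty$; and (2) the map $f\mapsto\hat f$ from $L^1(\Omega)\cap L^2(\Omega)\subset L^2(\Omega)$ into $L^2(\mu)$ is isometric and has dense range. *)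

(* Defs.v *)
From HB Require Import structures.
From mathcomp Require Import all_boot all_order all_algebra.
From mathcomp Require Import complex.
From mathcomp Require Import all_classical all_reals all_analysis.
From mathcomp Require Import measurable_realfun.

Set Implicit Arguments.
Unset Strict Implicit.
Unset Printing Implicit Defensive.

Import Order.TTheory GRing.Theory Num.Theory.
Import numFieldNormedType.Exports.

Local Open Scope classical_set_scope.
Local Open Scope ring_scope.

(** R^d is the space ['cV[R]_d] of column vectors, with its Borel sigma-algebra. *)

Definition borel_cV_display : measure_display.
Proof. exact: default_measure_display. Qed.

Section borel_cV.
Context (R : realType) (d : nat).
Implicit Types U : set 'cV[R]_d.

Definition borel_cV : set (set 'cV[R]_d) := <<s [set U | open U] >>.

Let borel_cV0 : borel_cV set0. Proof. exact: sigma_algebra0. Qed.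

Let borel_cVC A : borel_cV A -> borel_cV (~` A).
Proof. by move=> mA; rewrite -setTD; exact: sigma_algebraCD. Qed.

Let borel_cV_bigcup (F : (set 'cV[R]_d)^nat) :
  (forall i, borel_cV (F i)) -> borel_cV (\bigcup_i F i).
Proof. exact: sigma_algebra_bigcup. Qed.

HB.instance Definition _ := @isMeasurable.Build borel_cV_display 'cV[R]_d
  borel_cV borel_cV0 borel_cVC borel_cV_bigcup.

Lemma open_measurable_cV U : open U -> measurable U.
Proof. exact: sub_sigma_algebra. Qed.

Lemma measurable_coord_cV (i : 'I_d) (j : 'I_1) :
  measurable_fun setT (fun x : 'cV[R]_d => x i j).
Proof.
apply: (measurability _ (RGenOpens.measurableE R)) => _ [_ [a [b ->]] <-].
rewrite setTI; apply: open_measurable_cV.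
have /continuousP := @coord_continuous R d 1 i j; apply.
exact: interval_open.
Qed.

Definition rat_box (ab : 'cV[rat]_d * 'cV[rat]_d) : set 'cV[R]_d :=
  [set x | forall i, ratr (ab.1 i 0) < x i 0 < ratr (ab.2 i 0)].

Lemma measurable_rat_box ab : measurable (rat_box ab).
Proof.
have -> : rat_box ab = \bigcap_(i in [set: 'I_d])
    ((fun x : 'cV[R]_d => x i 0) @^-1` `]ratr (ab.1 i 0), ratr (ab.2 i 0)[).
  by apply/seteqP; split => x /= h i; have := h i; rewrite /= in_itv; exact.
apply: fin_bigcap_measurable => // i _.
by rewrite -[X in measurable X]setTI; exact: measurable_coord_cV.
Qed.

Lemma open_bigcup_rat_box U : open U ->
  U = \bigcup_(ab in [set ab | rat_box ab `<=` U]) rat_box ab.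
Proof.
move=> oU; apply/seteqP; split => [x Ux|x [ab /= abU /abU]//].
have [P xP PU] : nbhs x U by apply: open_nbhs_nbhs.
have /choice[e he] (i : 'I_d) : exists e : R, 0 < e /\ ball (x i 0) e `<=` P i 0.
  by have /nbhs_ballP[e e0 eP] := xP i 0; exists e.
have /choice[a ha] (i : 'I_d) : exists a : rat, x i 0 - e i < ratr a < x i 0.
  have [e0 _] := he i.
  have [q] := @rat_in_itvoo R (x i 0 - e i) (x i 0) ltac:(by rewrite ltrBlDr ltrDl).
  by rewrite in_itv => q_; exists q.
have /choice[b hb] (i : 'I_d) : exists b : rat, x i 0 < ratr b < x i 0 + e i.
  have [e0 _] := he i.
  have [q] := @rat_in_itvoo R (x i 0) (x i 0 + e i) ltac:(by rewrite ltrDl).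
  by rewrite in_itv => q_; exists q.
exists (\col_i a i, \col_i b i).
  move=> y hy; apply: PU => i j; rewrite ord1.
  have [_] := he i; apply; rewrite /ball /= ltr_distlC.
  have := hy i; rewrite !mxE => /andP[ay yb].
  have /andP[+ _] := ha i; have /andP[_ +] := hb i => h1 h2.
  by rewrite (lt_trans h2)//= (lt_trans yb).
move=> i /=; rewrite !mxE; apply/andP; split.
  by have /andP[] := ha i.
by have /andP[] := hb i.
Qed.

Lemma measurable_fun_cV d' (T : measurableType d') (f : T -> 'cV[R]_d) :
  (forall i, measurable_fun setT (fun t => f t i 0)) -> measurable_fun setT f.
Proof.
move=> mf; apply: (measurability [set U : set 'cV[R]_d | open U]) => //.
move=> _ [U oU <-]; rewrite setTI (open_bigcup_rat_box oU) preimage_bigcup.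
have -> : \bigcup_(ab in [set ab | rat_box ab `<=` U]) f @^-1` rat_box ab =
    \bigcup_ab (if `[< rat_box ab `<=` U >] then f @^-1` rat_box ab else set0).
  apply/seteqP; split => t.
    by move=> [ab abU ft]; exists ab => //; case: asboolP.
  by move=> [ab _]; case: asboolP => // abU ft; exists ab.
apply: countable_bigcupT_measurable => // ab; case: ifPn => // _.
have -> : f @^-1` rat_box ab = \bigcap_(i in [set: 'I_d])
    ((fun t => f t i 0) @^-1` `]ratr (ab.1 i 0), ratr (ab.2 i 0)[).
  by apply/seteqP; split => t /= h i; have := h i; rewrite /= in_itv; exact.
apply: fin_bigcap_measurable => // i _.
by rewrite -[X in measurable X]setTI; exact: mf.
Qed.

End borel_cV.

Section lebesgue_cV.
Context (R : realType).

Definition cons_cV d (p : (measurableTypeR R * 'cV[R]_d)%type) : 'cV[R]_d.+1 :=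
  col_mx (p.1 : R)%:M p.2.

Lemma cons_cV0 d p : @cons_cV d p ord0 0 = p.1.
Proof.
transitivity ((p.1 : R)%:M (0 : 'I_1) (0 : 'I_1)); last by rewrite mxE eqxx.
rewrite -(@col_mxEu R 1 d 1 _ p.2).
by congr (_ _ _); exact/val_inj.
Qed.

Lemma cons_cVS d p (i : 'I_d) : @cons_cV d p (lift ord0 i) 0 = p.2 i 0.
Proof.
have <- := @col_mxEd R 1 d 1 (p.1 : R)%:M p.2 i 0.
by congr (_ _ _); exact/val_inj.
Qed.

Lemma measurable_cons_cV d : measurable_fun setT (@cons_cV d).
Proof.
apply: measurable_fun_cV => i; case: (unliftP ord0 i) => [j ->|->].
  rewrite (_ : (fun _ => _) = (fun p : _ * 'cV[R]_d => p.2 j 0)).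
    exact: (measurableT_comp (measurable_coord_cV j 0) measurable_snd).
  by apply/funext => p; rewrite cons_cVS.
rewrite (_ : (fun _ => _) = fst); first exact: measurable_fst.
by apply/funext => p; rewrite cons_cV0.
Qed.

Definition uncons_cV d (x : 'cV[R]_d.+1) : measurableTypeR R * 'cV[R]_d :=
  (x ord0 0, \col_i x (lift ord0 i) 0).

Lemma cons_cVK d : cancel (@cons_cV d) (@uncons_cV d).
Proof.
move=> [a v]; rewrite /uncons_cV cons_cV0; congr pair.
by apply/matrixP => i j; rewrite mxE cons_cVS ord1.
Qed.

Lemma uncons_cVK d : cancel (@uncons_cV d) (@cons_cV d).
Proof.
move=> x; apply/matrixP => i j; rewrite ord1.
by case: (unliftP ord0 i) => [k ->|->]; rewrite ?cons_cVS ?cons_cV0 ?mxE.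
Qed.

Lemma measurable_uncons_cV d : measurable_fun setT (@uncons_cV d).
Proof.
apply/measurable_fun_pairP; split.
  exact: measurable_coord_cV.
apply: measurable_fun_cV => i.
rewrite (_ : (fun _ => _) = (fun x : 'cV[R]_d.+1 => x (lift ord0 i) 0)).
  exact: measurable_coord_cV.
by apply/funext => x; rewrite /= mxE.
Qed.

Section step.
Context d (m : {sigma_finite_measure set 'cV[R]_d -> \bar R}).

Definition lebesgue_cVS : set 'cV[R]_d.+1 -> \bar R :=
  pushforward (@lebesgue_measure R \x m)%E (@cons_cV d).

Let lebesgue_cVS0 : lebesgue_cVS set0 = 0%E.
Proof. by rewrite /lebesgue_cVS /pushforward preimage_set0 measure0. Qed.

Let lebesgue_cVS_ge0 A : (0 <= lebesgue_cVS A)%E.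
Proof. by rewrite /lebesgue_cVS /pushforward measure_ge0. Qed.

Let lebesgue_cVS_sigma_additive : semi_sigma_additive lebesgue_cVS.
Proof.
move=> F mF tF mUF; rewrite /lebesgue_cVS /pushforward preimage_bigcup.
apply: measure_semi_sigma_additive.
- by move=> n; rewrite -[X in measurable X]setTI; exact: measurable_cons_cV.
- apply/trivIsetP => /= i j _ _ ij; rewrite -preimage_setI.
  by move/trivIsetP : tF => /(_ _ _ _ _ ij) ->//; rewrite preimage_set0.
- rewrite -preimage_bigcup -[X in measurable X]setTI.
  exact: measurable_cons_cV.
Qed.

HB.instance Definition _ := isMeasure.Build _ _ _ lebesgue_cVS
  lebesgue_cVS0 lebesgue_cVS_ge0 lebesgue_cVS_sigma_additive.

Let lebesgue_cVS_sigma_finite : sigma_finite setT lebesgue_cVS.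
Proof.
have /sigma_finiteP[F [FT ndF Foo]] := sigma_finiteT (@lebesgue_measure R).
have /sigma_finiteP[G [GT ndG Goo]] := sigma_finiteT m.
exists (fun n => @uncons_cV d @^-1` (F n `*` G n)).
  rewrite -preimage_bigcup; apply/esym/seteqP; split => // x _.
  have [i _ Fi] : (\bigcup_i F i) (uncons_cV x).1 by rewrite -FT.
  have [j _ Gj] : (\bigcup_j G j) (uncons_cV x).2 by rewrite -GT.
  exists (maxn i j) => //; split.
  - by move: Fi; exact/subsetPset/ndF/leq_maxl.
  - by move: Gj; exact/subsetPset/ndG/leq_maxr.
move=> n; have [mFn Fnoo] := Foo n; have [mGn Gnoo] := Goo n; split.
  rewrite -[X in measurable X]setTI; apply: measurable_uncons_cV => //.
  exact: measurableX.
rewrite /lebesgue_cVS /pushforward -comp_preimage.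
rewrite (_ : _ \o _ = id); last by apply/funext => p /=; rewrite cons_cVK.
by rewrite preimage_id product_measure1E// lte_mul_pinfty// ge0_fin_numE.
Qed.

HB.instance Definition _ := @Measure_isSigmaFinite.Build _ _ _
  lebesgue_cVS lebesgue_cVS_sigma_finite.

End step.
End lebesgue_cV.

(** Lebesgue measure on R^d, as the d-fold product of the one on R. *)
Fixpoint lebesgue_cV (R : realType) (d : nat) :
    {sigma_finite_measure set 'cV[R]_d -> \bar R} :=
  match d with
  | 0 => dirac (0 : 'cV[R]_0)
  | d'.+1 => lebesgue_cVS (lebesgue_cV R d')
  end.

Lemma lebesgue_cV_box (R : realType) d (a b : 'cV[R]_d) :
  (forall i, a i 0 <= b i 0) ->
  lebesgue_cV R d [set x | forall i, a i 0 <= x i 0 <= b i 0] =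
  (\prod_i (b i 0 - a i 0))%:E.
Proof.
elim: d => [|d IHd] in a b * => ab.
  by rewrite big_ord0 /= diracE mem_set// => -[].
pose a' : 'cV[R]_d := \col_i a (lift ord0 i) 0.
pose b' : 'cV[R]_d := \col_i b (lift ord0 i) 0.
have ab' i : a' i 0 <= b' i 0 by rewrite !mxE.
rewrite /= /lebesgue_cVS /pushforward.
have -> : @cons_cV R d @^-1` [set x | forall i, a i 0 <= x i 0 <= b i 0] =
    `[a ord0 0, b ord0 0]%classic `*`
    [set x : 'cV[R]_d | forall i, a' i 0 <= x i 0 <= b' i 0].
  apply/seteqP; split => [p h|p [h0 h] i].
    split => [|i]; last by have := h (lift ord0 i); rewrite cons_cVS !mxE.
    by have := h ord0; rewrite cons_cV0 /= in_itv.
  case: (unliftP ord0 i) => [j ->|->].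
    by rewrite cons_cVS; have := h j; rewrite !mxE.
  by rewrite cons_cV0; move: h0; rewrite /= in_itv.
rewrite product_measure1E; last 2 first.
- exact: measurable_itv.
- have -> : [set x : 'cV[R]_d | forall i, a' i 0 <= x i 0 <= b' i 0] =
      \bigcap_(i in [set: 'I_d]) ((fun x => x i 0) @^-1` `[a' i 0, b' i 0]).
    by apply/seteqP; split => x /= h i; have := h i; rewrite /= in_itv; exact.
  apply: fin_bigcap_measurable => // i _.
  by rewrite -[X in measurable X]setTI; exact: measurable_coord_cV.
rewrite IHd// big_ord_recl EFinM; congr (_ * _)%E.
  apply: etrans (lebesgue_measure_itv _) _; rewrite /= lte_fin.
  case: ltP => [//|ba]; apply/esym/eqP; rewrite eqe subr_eq0.
  by rewrite eq_le ba ab.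
by congr EFin; apply: eq_bigr => i _; rewrite !mxE.
Qed.

Section lattices.
Context (R : realType) (d : nat).
Implicit Types (A : 'M[int]_d) (Omega T : set 'cV[R]_d).

Definition int_mx m n (A : 'M[int]_(m, n)) : 'M[R]_(m, n) := map_mx intr A.

Definition Zlattice : set 'cV[R]_d := range (@int_mx d 1).

Definition lattice A : set 'cV[R]_d := [set int_mx A *m k | k in Zlattice].

Definition complete_representatives A (reps : set 'cV[int]_d) :=
  forall k : 'cV[int]_d,
    exists! r, reps r /\ exists m : 'cV[int]_d, k - r = A *m m.

Definition translate Omega (t : 'cV[R]_d) : set 'cV[R]_d :=
  [set x + t | x in Omega].

Definition packs Omega T :=
  measurable Omega /\
  forall s t, T s -> T t -> s <> t ->
    (lebesgue_cV R d).-negligible (translate Omega s `&` translate Omega t).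

Definition tiles Omega T :=
  packs Omega T /\
  (lebesgue_cV R d).-negligible (~` \bigcup_(t in T) translate Omega t).

End lattices.
Arguments Zlattice {R d}.
Arguments lattice R {d} A.

Section complex_valued.
Context d (T : measurableType d) (R : realType).
Implicit Types (mu : {measure set T -> \bar R}) (f : T -> R[i]).

Definition cmeasurable f :=
  measurable_fun setT (fun x => complex.Re (f x)) /\
  measurable_fun setT (fun x => complex.Im (f x)).

Definition cintegral mu f : R[i] :=
  ((\int[mu]_x complex.Re (f x))%R +i* (\int[mu]_x complex.Im (f x))%R)%C.

Definition cmod (z : R[i]) : R := ComplexField.Normc.normc z.

Definition in_L1 mu f :=
  cmeasurable f /\ (\int[mu]_x (cmod (f x))%:E < +oo)%E.

Definition in_L2 mu f :=
  cmeasurable f /\ (\int[mu]_x (cmod (f x) ^+ 2)%:E < +oo)%E.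

Definition L2norm mu f : \bar R := Lnorm mu 2%:E (fun x => (cmod (f x))%:E).

End complex_valued.

Section fourier.
Context (R : realType) (d : nat).
Implicit Types (Omega : set 'cV[R]_d) (f g : 'cV[R]_d -> R[i]).
Implicit Types mu : {measure set 'cV[R]_d -> \bar R}.

Definition dotprod (x y : 'cV[R]_d) : R := \sum_i x i 0 * y i 0.

Definition expi (theta : R) : R[i] := (cos theta +i* sin theta)%C.

Definition fourier f (t : 'cV[R]_d) : R[i] :=
  cintegral (lebesgue_cV R d) (fun x => f x * expi (- (2 * pi * dotprod t x))).

(** Functions on Omega are represented by their extensions by 0 to R^d, and
    elements of an L^2 space by everywhere defined representatives. *)
Definition supported Omega f := forall x, ~ Omega x -> f x = 0.

Definition L2_on Omega : set ('cV[R]_d -> R[i]) :=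
  [set f | supported Omega f /\ in_L2 (lebesgue_cV R d) f].

Definition L1L2_on Omega : set ('cV[R]_d -> R[i]) :=
  [set f | [/\ supported Omega f, in_L1 (lebesgue_cV R d) f
              & in_L2 (lebesgue_cV R d) f]].

(** Isometry for the L^2 distances; on representatives, it implies that
    [F f] depends, up to equality mu-almost everywhere, only on the class of
    [f]. *)
Definition isometric_on (D : set ('cV[R]_d -> R[i])) mu
    (F : ('cV[R]_d -> R[i]) -> 'cV[R]_d -> R[i]) :=
  forall f g, D f -> D g ->
    L2norm mu (F f \- F g) = L2norm (lebesgue_cV R d) (f \- g).

(** On R^d, the positive Radon measures are the Borel measures that are finite
    on compact sets. *)
Definition radon mu :=
  forall K : set 'cV[R]_d, compact K -> (mu K < +oo)%E.

Definition spectral_with Omega mu :=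
  [/\ measurable Omega,
      radon mu,
      (forall f, L1L2_on Omega f ->
        (\int[mu]_t (cmod (fourier f t) ^+ 2)%:E < +oo)%E),
      isometric_on (L1L2_on Omega) mu fourier
    & forall g, in_L2 mu g -> forall eps : R, 0 < eps ->
        exists2 f, L1L2_on Omega f & (L2norm mu (fourier f \- g)%R < eps%:E)%E].

Definition ae_linear_on (D : set ('cV[R]_d -> R[i])) mu
    (F : ('cV[R]_d -> R[i]) -> 'cV[R]_d -> R[i]) :=
  forall (c : R[i]) f g, D f -> D g ->
    {ae mu, forall t, F (fun x => c * f x + g x) t = c * F f t + F g t}.

Definition fourier_extends_isometrically Omega mu :=
  exists F : ('cV[R]_d -> R[i]) -> 'cV[R]_d -> R[i],
    [/\ (forall f, L2_on Omega f -> in_L2 mu (F f)),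
        ae_linear_on (L2_on Omega) mu F,
        isometric_on (L2_on Omega) mu F
      & forall f, L1L2_on Omega f -> {ae mu, forall t, F f t = fourier f t}].

End fourier.

Section pair_measure.
Context (R : realType) (d : nat).
Context (Omega0 : set 'cV[R]_d) (A : 'M[int]_d).

Definition unit_cube : set 'cV[R]_d :=
  [set x | forall i, - 2^-1 <= x i 0 <= 2^-1].

Definition dual_support : set 'cV[R]_d :=
  [set x + k | x in [set invmx (int_mx R A)^T *m y | y in unit_cube]
             & k in Zlattice].

Context (detA : \det A != 0).

Lemma measurable_dual_support : measurable dual_support.
Proof.
have Au : (int_mx R A)^T \in unitmx.
  by rewrite unitmx_tr unitmxE /int_mx det_map_mx unitfE intr_eq0.
have -> : dual_support = \bigcup_(k : 'cV[int]_d) \bigcap_(i in [set: 'I_d])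
    ((fun x : 'cV[R]_d => \sum_j (int_mx R A)^T i j * (x j 0 - int_mx R k j 0))
      @^-1` `[- 2^-1, 2^-1]).
  have E (y : 'cV[R]_d) k i : \sum_j (int_mx R A)^T i j * (y j 0 - int_mx R k j 0)
      = ((int_mx R A)^T *m (y - int_mx R k)) i 0.
    by rewrite [RHS]mxE; apply: eq_bigr => j _; rewrite !mxE.
  apply/seteqP; split => x.
    move=> [_ [y cy <-] [_ [k _ <-] <-]]; exists k => // i _ /=.
    by rewrite E addrK mulKVmx// in_itv; exact: cy.
  move=> [k _ kx]; exists (x - int_mx R k); last first.
    by exists (int_mx R k); [exists k|rewrite subrK].
  exists ((int_mx R A)^T *m (x - int_mx R k)); last by rewrite mulKmx.
  by move=> i; have := kx i I; rewrite /= E in_itv.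
apply: countable_bigcupT_measurable => // k.
apply: fin_bigcap_measurable => // i _.
rewrite -[X in measurable X]setTI.
suff : measurable_fun setT (fun x : 'cV[R]_d =>
  \sum_j (int_mx R A)^T i j * (x j 0 - int_mx R k j 0)) by exact.
apply: measurable_sum => j; apply: measurable_funM => //.
apply: measurable_funB => //; exact: measurable_coord_cV.
Qed.

Lemma density_ge0 :
  0 <= `|(\det A)%:~R : R| / fine (lebesgue_cV R d Omega0).
Proof. by rewrite divr_ge0// fine_ge0. Qed.

Definition pair_measure : {measure set 'cV[R]_d -> \bar R} :=
  mscale (NngNum density_ge0)
    (mrestr (lebesgue_cV R d) measurable_dual_support).

End pair_measure.

(* Main.v *)
Require Import Defs.
From HB Require Import structures.
From mathcomp Require Import all_boot all_order all_algebra.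
From mathcomp Require Import complex.
From mathcomp Require Import all_classical all_reals all_analysis.
From mathcomp Require Import measurable_realfun.
From mathcomp Require Import ring lra.

(** Write e(s) for exp(2 pi i s), Lambda for the lattice A Z^d, Lambda' for its
    dual lattice, D for the half-open version of the cell of Lambda' in the
    definition of mu, and S for D + Z^d, so that mu has density
    |det A| / |Omega0| on S. The volume of D is 1 / |det A|
    ([measure_fundom_invmx]).

    The equivalence of (i) and (ii) is a matter of cosets: every k in Z^d is
    r + A l for a unique representative r, so the translates of Omega0 by Z^d
    are the translates of Omega by the representatives, cut into pieces that
    are almost disjoint because Omega0 packs with Lambda
    ([tiles_lattice_cosets], [tiles_cosets_lattice]).

    The analytic heart is a Plancherel identity ([plancherel]). Let T be a
    fundamental domain of a lattice G, let L be a sublattice of G, and let S0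
    be a fundamental domain of the dual lattice of L which packs with the dual
    lattice G' of G. For f supported in T + L, the integral of |f^|^2 over
    S0 + G' is |T| |S0| times the integral of |f|^2. Indeed f is a sum of
    pieces h_l (x - l) with h_l supported in T. At frequency t the translation
    by l only multiplies the transform of h_l by the phase e(- t l), which does
    not change when t moves along G'; so Parseval's identity on T computes the
    sum of |f^|^2 over t + G' as |T| times the energy of the sum of the
    e(- t l) h_l. As functions of t the phases are characters, orthogonal on
    S0, and integrating over S0 separates the pieces.

    Parseval's identity ([parseval_bm]) rests on the completeness of the
    characters. The trigonometric polynomials form an algebra, and iterating
    u -> (3 u - u^3) / 2 turns the real or imaginary part of a character, minus
    a constant, into its sign. So the indicators of arcs in each torus
    coordinate are limits of trigonometric polynomials. The sets with this property form a
    sigma-algebra, which therefore contains all periodic Borel sets; and on a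
    set that packs with the lattice every Borel set is the trace of a periodic
    one.

    (ii) implies (iii): up to null sets Omega0 is a fundamental domain T of Z^d,
    and |Omega0| = 1. The Plancherel identity for G = Z^d and S0 = D is the
    isometry property ([fourier_isometry]). The same identity for G = Lambda' and
    its sublattice Z^d, where D and T exchange their roles, says that the inverse
    transform is isometric from L^2(S) to L^2(Omega), which gives density of
    the range ([fourier_dense]).

    (iii) implies (iv) by the completeness of L^2 ([L2_complete],
    [fourier_extends]).

    (iv) implies (ii): evaluate the isometry on f = 1_E + z 1_(E + p) for a small
    box E in Omega0 ([isometry_two_exp]). For z = 0 it gives |Omega0| = 1; in
    general, if E + p lies in Omega, it forces the integral of e(- t p) over D
    to vanish. If Omega0 met Omega0 + m for some m in Z^d outside Lambda, every p
    in m + Lambda would be allowed, and all Fourier coefficients of e(- t m) on the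
    fundamental domain D of Lambda' would vanish, against Parseval's identity
    ([exp_integral_neq0]). So Omega0 packs with Z^d, and a packing by a set of
    volume 1 is a tiling ([packs_tiles]). *)

Set Implicit Arguments.
Unset Strict Implicit.
Unset Printing Implicit Defensive.

Import Order.TTheory GRing.Theory Num.Theory.
Import numFieldNormedType.Exports.

Local Open Scope classical_set_scope.
Local Open Scope ring_scope.

(** * Complex numbers and complex-valued integrals *)

Section complex_algebra.
Context (R : realType).
Implicit Types z w : R[i].

Lemma Re_add z w : complex.Re (z + w) = complex.Re z + complex.Re w.
Proof. by case: z w => [a b] [c e]. Qed.

Lemma Im_add z w : complex.Im (z + w) = complex.Im z + complex.Im w.
Proof. by case: z w => [a b] [c e]. Qed.

Lemma Re_opp z : complex.Re (- z) = - complex.Re z.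
Proof. by case: z. Qed.

Lemma Im_opp z : complex.Im (- z) = - complex.Im z.
Proof. by case: z. Qed.

Lemma Re_mul z w : complex.Re (z * w) =
  complex.Re z * complex.Re w - complex.Im z * complex.Im w.
Proof. by case: z w => [a b] [c e]. Qed.

Lemma Im_mul z w : complex.Im (z * w) =
  complex.Re z * complex.Im w + complex.Im z * complex.Re w.
Proof. by case: z w => [a b] [c e]. Qed.

Lemma Re_conj z : complex.Re (conjc z) = complex.Re z.
Proof. by case: z. Qed.

Lemma Im_conj z : complex.Im (conjc z) = - complex.Im z.
Proof. by case: z. Qed.

Definition ReIm_simp := (Re_add, Im_add, Re_opp, Im_opp, Re_mul, Im_mul,
  Re_conj, Im_conj).

Lemma complex_ext z w : complex.Re z = complex.Re w ->
  complex.Im z = complex.Im w -> z = w.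
Proof. by case: z w => [a b] [c e] /= -> ->. Qed.

Lemma cmod2E z : cmod z ^+ 2 = complex.Re z ^+ 2 + complex.Im z ^+ 2.
Proof.
by case: z => a b; rewrite /cmod /= sqr_sqrtr// addr_ge0// sqr_ge0.
Qed.

Lemma cmodE z : cmod z = Num.sqrt (complex.Re z ^+ 2 + complex.Im z ^+ 2).
Proof. by case: z. Qed.

Lemma cmod_ge0 z : 0 <= cmod z.
Proof. by rewrite cmodE sqrtr_ge0. Qed.

Lemma cmodM z w : cmod (z * w) = cmod z * cmod w.
Proof. exact: ComplexField.Normc.normcM. Qed.

Lemma cmodD z w : cmod (z + w) <= cmod z + cmod w.
Proof. exact: le_normcD. Qed.

Lemma cmodN z : cmod (- z) = cmod z.
Proof. by rewrite !cmodE !ReIm_simp !sqrrN. Qed.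

Lemma cmod_conj z : cmod (conjc z) = cmod z.
Proof. by rewrite !cmodE !ReIm_simp !sqrrN. Qed.

Lemma cmod0 : cmod (0 : R[i]) = 0.
Proof. exact: ComplexField.Normc.normc0. Qed.

Lemma cmod1 : cmod (1 : R[i]) = 1.
Proof. exact: ComplexField.Normc.normc1. Qed.

Lemma cmod_real (x : R) : cmod (x%:C)%C = `|x|.
Proof. by rewrite cmodE /= expr0n addr0 sqrtr_sqr. Qed.

Lemma Re_le_cmod z : `|complex.Re z| <= cmod z.
Proof. by rewrite cmodE -sqrtr_sqr ler_wsqrtr// lerDl sqr_ge0. Qed.

Lemma Im_le_cmod z : `|complex.Im z| <= cmod z.
Proof. by rewrite cmodE -sqrtr_sqr ler_wsqrtr// lerDr sqr_ge0. Qed.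

Lemma cmod_le_ReIm z : cmod z <= `|complex.Re z| + `|complex.Im z|.
Proof.
rewrite -(@ler_pXn2r _ 2)// ?nnegrE ?cmod_ge0 ?addr_ge0// cmod2E sqrrD.
by rewrite !real_normK ?num_real// lerD// lerDl mulrn_wge0// mulr_ge0.
Qed.

Lemma cmod_eq0 z : cmod z = 0 -> z = 0.
Proof. exact: ComplexField.Normc.eq0_normc. Qed.

Lemma cmod2D z w : cmod (z + w) ^+ 2 <= 2 * cmod z ^+ 2 + 2 * cmod w ^+ 2.
Proof.
rewrite !cmod2E !ReIm_simp.
set a := complex.Re z; set b := complex.Im z.
set c := complex.Re w; set e := complex.Im w.
by have := sqr_ge0 (a - c); have := sqr_ge0 (b - e); nra.
Qed.

Lemma cmod2_sub z w : cmod (z - w) ^+ 2 =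
  cmod z ^+ 2 - 2 * complex.Re (z * conjc w) + cmod w ^+ 2.
Proof. by rewrite !cmod2E !ReIm_simp; ring. Qed.

Lemma mul_conj z : z * conjc z = ((cmod z ^+ 2)%:C)%C.
Proof. by apply: complex_ext; rewrite cmod2E !ReIm_simp/=; ring. Qed.

Lemma conjM z w : conjc (z * w) = conjc z * conjc w.
Proof. by apply: complex_ext; rewrite !ReIm_simp; ring. Qed.

Lemma conj_conj z : conjc (conjc z) = z.
Proof. exact: conjcK. Qed.

Lemma expiD (a b : R) : expi (a + b) = expi a * expi b.
Proof.
apply: complex_ext; rewrite !ReIm_simp /= ?cosD ?sinD//; ring.
Qed.

Lemma expi0 : expi (0 : R) = 1.
Proof. by rewrite /expi cos0 sin0. Qed.

Lemma expiN (a : R) : expi (- a) = conjc (expi a).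
Proof. by rewrite /expi cosN sinN. Qed.

Lemma cmod_expi (a : R) : cmod (expi a) = 1.
Proof. by rewrite cmodE /= cos2Dsin2 sqrtr1. Qed.

Lemma expi_nat n : expi (2 * pi * n%:R : R) = 1.
Proof.
elim: n => [|n ih]; first by rewrite mulr0 expi0.
rewrite -(natr1 n) mulrDr mulr1 expiD ih mul1r /expi mulr_natl.
by rewrite cos2pi sin2pi.
Qed.

Lemma expi_int (n : int) : expi (2 * pi * n%:~R : R) = 1.
Proof.
case: n => n; first exact: expi_nat.
by rewrite NegzE mulrNz mulrN expiN expi_nat; apply: complex_ext => //=; rewrite oppr0.
Qed.

End complex_algebra.

Section complex_integral.
Context d (T : measurableType d) (R : realType).
Implicit Types (mu : {measure set T -> \bar R}) (f g : T -> R[i]).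

Lemma cmeasurable_cst (c : R[i]) : cmeasurable (fun _ : T => c).
Proof. by split; exact: measurable_cst. Qed.

Lemma cmeasurableD f g : cmeasurable f -> cmeasurable g ->
  cmeasurable (fun x => f x + g x).
Proof.
move=> [f1 f2] [g1 g2]; split.
  by under eq_fun do rewrite Re_add; exact: measurable_funD.
by under eq_fun do rewrite Im_add; exact: measurable_funD.
Qed.

Lemma cmeasurableN f : cmeasurable f -> cmeasurable (fun x => - f x).
Proof.
move=> [f1 f2]; split.
  by under eq_fun do rewrite Re_opp; exact: measurable_funN.
by under eq_fun do rewrite Im_opp; exact: measurable_funN.
Qed.

Lemma cmeasurableB f g : cmeasurable f -> cmeasurable g ->
  cmeasurable (fun x => f x - g x).
Proof. by move=> mf mg; apply: cmeasurableD => //; exact: cmeasurableN. Qed.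

Lemma cmeasurableM f g : cmeasurable f -> cmeasurable g ->
  cmeasurable (fun x => f x * g x).
Proof.
move=> [f1 f2] [g1 g2]; split.
  under eq_fun do rewrite Re_mul.
  by apply: measurable_funB; exact: measurable_funM.
under eq_fun do rewrite Im_mul.
by apply: measurable_funD; exact: measurable_funM.
Qed.

Lemma cmeasurable_conj f : cmeasurable f -> cmeasurable (fun x => conjc (f x)).
Proof.
move=> [f1 f2]; split.
  by under eq_fun do rewrite Re_conj; exact: f1.
by under eq_fun do rewrite Im_conj; exact: measurable_funN.
Qed.

Lemma cmeasurable_real (u : T -> R) : measurable_fun setT u ->
  cmeasurable (fun x => ((u x)%:C)%C).
Proof. by move=> mu_; split => //=; exact: measurable_cst. Qed.

Lemma cmeasurable_expi (u : T -> R) : measurable_fun setT u ->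
  cmeasurable (fun x => expi (u x)).
Proof.
move=> mu_; split => /=.
  by apply: measurableT_comp => //; apply: continuous_measurable_fun; exact: continuous_cos.
by apply: measurableT_comp => //; apply: continuous_measurable_fun; exact: continuous_sin.
Qed.

Lemma cmeasurable_sum (I : Type) (s : seq I) (h : I -> T -> R[i]) :
  (forall i, cmeasurable (h i)) -> cmeasurable (fun x => \sum_(i <- s) h i x).
Proof.
move=> mh; elim: s => [|i s ih].
  by under eq_fun do rewrite big_nil; exact: cmeasurable_cst.
by under eq_fun do rewrite big_cons; exact: cmeasurableD.
Qed.

Lemma cmeasurable_indic (A : set T) : measurable A ->
  cmeasurable (fun x => ((\1_A x : R)%:C)%C).
Proof. by move=> mA; apply: cmeasurable_real; exact: measurable_indic. Qed.

Lemma measurable_cmod2 f : cmeasurable f ->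
  measurable_fun setT (fun x => cmod (f x) ^+ 2).
Proof.
move=> [f1 f2]; under eq_fun do rewrite cmod2E.
by apply: measurable_funD; exact: measurable_funX.
Qed.

Lemma measurable_cmod f : cmeasurable f ->
  measurable_fun setT (fun x => cmod (f x)).
Proof.
move=> mf; under eq_fun do rewrite cmodE -cmod2E.
apply: (@measurableT_comp _ _ _ _ _ _ (@Num.sqrt R)); last exact: measurable_cmod2.
by apply: continuous_measurable_fun => x; exact: sqrt_continuous.
Qed.

Lemma emeasurable_cmod2 f : cmeasurable f ->
  measurable_fun setT (fun x => (cmod (f x) ^+ 2)%:E).
Proof. by move=> /measurable_cmod2/measurable_EFinP. Qed.

Lemma emeasurable_cmod f : cmeasurable f ->
  measurable_fun setT (fun x => (cmod (f x))%:E).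
Proof. by move=> /measurable_cmod/measurable_EFinP. Qed.

Lemma in_L1_Re mu f : in_L1 mu f ->
  mu.-integrable setT (EFin \o (fun x => complex.Re (f x))).
Proof.
move=> [mf foo]; apply/integrableP; split.
  by apply/measurable_EFinP; exact: mf.1.
apply: le_lt_trans foo; apply: ge0_le_integral => //=.
- by apply/measurable_EFinP; apply: measurableT_comp => //; exact: mf.1.
- exact: emeasurable_cmod.
- by move=> x _; rewrite lee_fin Re_le_cmod.
Qed.

Lemma in_L1_Im mu f : in_L1 mu f ->
  mu.-integrable setT (EFin \o (fun x => complex.Im (f x))).
Proof.
move=> [mf foo]; apply/integrableP; split.
  by apply/measurable_EFinP; exact: mf.2.
apply: le_lt_trans foo; apply: ge0_le_integral => //=.
- by apply/measurable_EFinP; apply: measurableT_comp => //; exact: mf.2.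
- exact: emeasurable_cmod.
- by move=> x _; rewrite lee_fin Im_le_cmod.
Qed.

Lemma in_L1_le mu f g : cmeasurable f -> in_L1 mu g ->
  (forall x, cmod (f x) <= cmod (g x)) -> in_L1 mu f.
Proof.
move=> mf [mg goo] fg; split => //; apply: le_lt_trans goo.
apply: ge0_le_integral => //=.
- by move=> x _; rewrite lee_fin cmod_ge0.
- exact: emeasurable_cmod.
- exact: emeasurable_cmod.
- by move=> x _; rewrite lee_fin.
Qed.

Lemma in_L1D mu f g : in_L1 mu f -> in_L1 mu g -> in_L1 mu (fun x => f x + g x).
Proof.
move=> [mf foo] [mg goo]; split; first exact: cmeasurableD.
apply: (@le_lt_trans _ _ (\int[mu]_x ((cmod (f x))%:E + (cmod (g x))%:E))%E).
  apply: ge0_le_integral => //=.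
  - by move=> x _; rewrite lee_fin cmod_ge0.
  - by apply: emeasurable_cmod; exact: cmeasurableD.
  - by apply: emeasurable_funD; exact: emeasurable_cmod.
  - by move=> x _; rewrite -EFinD lee_fin cmodD.
rewrite ge0_integralD//.
- by rewrite lte_add_pinfty.
- by move=> x _; rewrite lee_fin cmod_ge0.
- exact: emeasurable_cmod.
- by move=> x _; rewrite lee_fin cmod_ge0.
- exact: emeasurable_cmod.
Qed.

Lemma in_L1M_bounded mu f g (M : R) : cmeasurable g -> in_L1 mu f ->
  (forall x, cmod (g x) <= M) -> in_L1 mu (fun x => g x * f x).
Proof.
move=> mg [mf foo] gM; split; first exact: cmeasurableM.
apply: (@le_lt_trans _ _ (\int[mu]_x (`|M|%:E * (cmod (f x))%:E))%E).
  apply: ge0_le_integral => //=.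
  - by move=> x _; rewrite lee_fin cmod_ge0.
  - by apply: emeasurable_cmod; exact: cmeasurableM.
  - by apply: measurable_funeM; exact: emeasurable_cmod.
  - move=> x _; rewrite lee_fin cmodM ler_wpM2r ?cmod_ge0//.
    by rewrite (le_trans (gM x))// ler_norm.
rewrite ge0_integralZl_EFin//.
- by rewrite lte_mul_pinfty// lee_fin.
- by move=> x _; rewrite lee_fin cmod_ge0.
- exact: emeasurable_cmod.
Qed.

Lemma in_L1Z mu f c : in_L1 mu f -> in_L1 mu (fun x => c * f x).
Proof.
by move=> ?; apply: (@in_L1M_bounded _ _ (fun=> c) (cmod c)) => //; exact: cmeasurable_cst.
Qed.

Lemma in_L1N mu f : in_L1 mu f -> in_L1 mu (fun x => - f x).
Proof.
move=> f1; rewrite (_ : (fun x => - f x) = (fun x => -1 * f x)); first exact: in_L1Z.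
by apply/funext => x; rewrite mulN1r.
Qed.

Lemma in_L1B mu f g : in_L1 mu f -> in_L1 mu g -> in_L1 mu (fun x => f x - g x).
Proof. by move=> f1 g1; apply: in_L1D => //; exact: in_L1N. Qed.

Lemma in_L1_conj mu f : in_L1 mu f -> in_L1 mu (fun x => conjc (f x)).
Proof.
move=> [mf foo]; split; first exact: cmeasurable_conj.
by under eq_integral do rewrite cmod_conj.
Qed.

Lemma in_L1_0 mu : in_L1 mu (fun=> 0).
Proof.
split; first exact: cmeasurable_cst.
by under eq_integral do rewrite cmod0; rewrite integral0.
Qed.

Lemma in_L1_sum mu (I : Type) (s : seq I) (h : I -> T -> R[i]) :
  (forall i, in_L1 mu (h i)) -> in_L1 mu (fun x => \sum_(i <- s) h i x).
Proof.
move=> mh; elim: s => [|i s ih].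
  by under eq_fun do rewrite big_nil; exact: in_L1_0.
by under eq_fun do rewrite big_cons; exact: in_L1D.
Qed.

Lemma cintegralD mu f g : in_L1 mu f -> in_L1 mu g ->
  cintegral mu (fun x => f x + g x) = cintegral mu f + cintegral mu g.
Proof.
move=> f1 g1; apply: complex_ext; rewrite ReIm_simp /=.
  under eq_Rintegral do rewrite Re_add.
  by rewrite RintegralD//; [exact: in_L1_Re|exact: in_L1_Re].
under eq_Rintegral do rewrite Im_add.
by rewrite RintegralD//; [exact: in_L1_Im|exact: in_L1_Im].
Qed.

Lemma cintegralZ mu f c : in_L1 mu f ->
  cintegral mu (fun x => c * f x) = c * cintegral mu f.
Proof.
move=> f1; have fr := in_L1_Re f1; have fi := in_L1_Im f1.
have Zint r (u : T -> R) : mu.-integrable setT (EFin \o u) ->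
    mu.-integrable setT (EFin \o (fun x => r * u x)).
  by move=> /(integrableZl measurableT r); apply: eq_integrable => //.
apply: complex_ext; rewrite ReIm_simp /=.
  under eq_Rintegral do rewrite Re_mul.
  by rewrite RintegralB ?RintegralZl//; exact: Zint.
under eq_Rintegral do rewrite Im_mul.
by rewrite RintegralD ?RintegralZl//; exact: Zint.
Qed.

Lemma cintegralN mu f : in_L1 mu f ->
  cintegral mu (fun x => - f x) = - cintegral mu f.
Proof.
move=> f1; rewrite -mulN1r -cintegralZ//; congr cintegral.
by apply/funext => x; rewrite mulN1r.
Qed.

Lemma cintegralB mu f g : in_L1 mu f -> in_L1 mu g ->
  cintegral mu (fun x => f x - g x) = cintegral mu f - cintegral mu g.
Proof. by move=> f1 g1; rewrite cintegralD ?cintegralN//; exact: in_L1N. Qed.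

Lemma cintegral0 mu : cintegral mu (fun=> 0) = 0.
Proof.
by apply: complex_ext; rewrite /= /Rintegral integral0.
Qed.

Lemma cintegral_sum mu (I : Type) (s : seq I) (h : I -> T -> R[i]) :
  (forall i, in_L1 mu (h i)) ->
  cintegral mu (fun x => \sum_(i <- s) h i x) = \sum_(i <- s) cintegral mu (h i).
Proof.
move=> mh; elim: s => [|i s ih].
  by rewrite big_nil; under eq_fun do rewrite big_nil; exact: cintegral0.
rewrite big_cons -ih -cintegralD//; last exact: in_L1_sum.
by under eq_fun do rewrite big_cons.
Qed.

Lemma cintegral_conj mu f : in_L1 mu f ->
  cintegral mu (fun x => conjc (f x)) = conjc (cintegral mu f).
Proof.
move=> f1; apply: complex_ext; rewrite ReIm_simp /=.
  by under eq_Rintegral do rewrite Re_conj.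
under eq_Rintegral do rewrite Im_conj -mulN1r.
by rewrite RintegralZl ?mulN1r//; exact: in_L1_Im.
Qed.

(** Rotating the integral onto the real axis reduces the bound to the real case. *)
Lemma cmod_cintegral mu f : in_L1 mu f ->
  ((cmod (cintegral mu f))%:E <= \int[mu]_x (cmod (f x))%:E)%E.
Proof.
move=> f1; set z := cintegral mu f; set I := (\int[mu]_x _)%E.
have I0 : (0 <= I)%E by apply: integral_ge0 => x _; rewrite lee_fin cmod_ge0.
have Ifin : I \is a fin_num by rewrite ge0_fin_numE//; exact: f1.2.
have [z0|z0] := eqVneq (cmod z) 0; first by rewrite z0.
have zp : 0 < cmod z by rewrite lt_neqAle eq_sym z0 cmod_ge0.
rewrite -(fineK Ifin) lee_fin -(ler_pM2l zp) -expr2.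
have -> : cmod z ^+ 2 = complex.Re (cintegral mu (fun x => conjc z * f x)).
  by rewrite cintegralZ// mulrC mul_conj.
have zf1 : in_L1 mu (fun x => conjc z * f x) by exact: in_L1Z.
apply: (@le_trans _ _ (\int[mu]_x (cmod z * cmod (f x)))%R).
  apply: le_Rintegral => //; first exact: in_L1_Re.
    apply/integrableP; split.
      by apply/measurable_EFinP/measurable_funM => //; apply: measurable_cmod; exact: f1.1.
    rewrite (eq_integral (fun x => (cmod (conjc z * f x))%:E)); first exact: zf1.2.
    by move=> x _; rewrite cmodM cmod_conj /= ger0_norm// mulr_ge0 ?cmod_ge0.
  move=> x _; rewrite -(cmod_conj z) -cmodM.
  exact: le_trans (ler_norm _) (Re_le_cmod _).
rewrite RintegralZl//; apply/integrableP; split.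
  by apply: emeasurable_cmod; exact: f1.1.
rewrite (eq_integral (fun x => (cmod (f x))%:E)); first exact: f1.2.
by move=> x _; rewrite /= ger0_norm// cmod_ge0.
Qed.

Lemma cintegral_eq0_le mu f : in_L1 mu f ->
  (\int[mu]_x (cmod (f x))%:E = 0%:E)%E -> cintegral mu f = 0.
Proof.
move=> f1 f0; apply: cmod_eq0; apply/eqP; rewrite eq_le cmod_ge0 andbT.
by rewrite -lee_fin -f0 cmod_cintegral.
Qed.

Lemma ae_eq_cintegral mu f g : in_L1 mu f -> in_L1 mu g ->
  {ae mu, forall x, f x = g x} -> cintegral mu f = cintegral mu g.
Proof.
move=> f1 g1 fg; apply/eqP; rewrite -subr_eq0; apply/eqP.
rewrite -cintegralB//; apply: cintegral_eq0_le; first exact: in_L1B.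
have mfg := cmeasurableB f1.1 g1.1.
rewrite (ge0_ae_eq_integral (g := cst 0%E)) ?integral0//.
- exact: emeasurable_cmod.
- by move=> x _; rewrite lee_fin cmod_ge0.
- by apply: filterS fg => x fgx _ /=; rewrite fgx subrr cmod0.
Qed.

End complex_integral.

(** * Countable sums and integrals of nonnegative functions *)

Section countable_sum.
Context (R : realType) (K : countType).
Implicit Types a b : K -> \bar R.
Local Open Scope ereal_scope.

(** A sum over a countable index type, as a series over the codes of the
    indices. Sums over lattices are written this way; for nonnegative terms
    the order of summation is immaterial. *)
Definition csum a : \bar R :=
  \sum_(0 <= n <oo) (if pickle_inv n is Some k then a k else 0).

Lemma csum_ge0 a : (forall k, 0 <= a k) -> 0 <= csum a.
Proof. by move=> a0; apply: nneseries_ge0 => n _ _; case: pickle_inv. Qed.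

Lemma eq_csum a b : a =1 b -> csum a = csum b.
Proof. by move=> /funext ->. Qed.

Lemma csumZl (c : R) a : (forall k, 0 <= a k) ->
  csum (fun k => c%:E * a k) = c%:E * csum a.
Proof.
move=> a0; rewrite /csum -nneseriesZl; last by move=> n _; case: pickle_inv.
by apply: eq_eseriesr => n _; case: pickle_inv => //; rewrite mule0.
Qed.

Lemma csum_single k0 a : (forall k, 0 <= a k) ->
  (forall k, k <> k0 -> a k = 0) -> csum a = a k0.
Proof.
move=> a0 ak0; rewrite /csum (@nneseriesD1 _ _ (pickle k0))//; last first.
  by move=> n _; case: pickle_inv.
rewrite pickleK_inv eseries0 ?adde0// => n _ /= nk0.
case E: (pickle_inv n) => [k|//]; apply: ak0 => kk0; move: nk0.
by have := @pickle_invK K n; rewrite E /= => <-; rewrite kk0 eqxx.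
Qed.

Lemma csum0 : csum (fun=> 0) = 0.
Proof. by rewrite /csum eseries0// => n _ _; case: pickle_inv. Qed.

(** Every partial sum of the series is a sum over finitely many distinct
    indices. *)
Lemma csum_fin_sup a M : (forall k, 0 <= a k) ->
  (forall s : seq K, uniq s -> \sum_(k <- s) a k <= M) -> csum a <= M.
Proof.
move=> a0 aM; apply: lime_le.
  by apply: is_cvg_nneseries => n _ _; case: pickle_inv.
near=> N.
have -> : \sum_(0 <= n < N) (if pickle_inv n is Some k then a k else 0) =
    \sum_(k <- pmap (@pickle_inv K) (iota 0 N)) a k.
  rewrite /index_iota subn0; elim: (iota 0 N) => [|n s ih].
    by rewrite !big_nil.
  by rewrite big_cons ih /=; case: pickle_inv => [k|] /=; rewrite ?big_cons ?add0e.
apply: aM; apply: (pmap_uniq (@pickle_invK K)); exact: iota_uniq.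
Unshelve. all: by end_near. Qed.

Lemma csum_ge_fin a (s : seq K) : (forall k, 0 <= a k) -> uniq s ->
  \sum_(k <- s) a k <= csum a.
Proof.
move=> a0 us; pose N := (\max_(k <- s) (pickle k).+1)%N.
have sN k : k \in s -> (pickle k < N)%N.
  by move=> ks; rewrite /N (big_rem k)//= leq_max leqnn.
have g0 n : 0 <= (if pickle_inv n is Some k then a k else 0).
  by case: pickle_inv.
apply: le_trans (nneseries_lim_ge (P := predT) (m := 0) N _); last by [].
have -> : \sum_(k <- s) a k = \sum_(n <- map pickle s)
    (if pickle_inv n is Some k then a k else 0).
  by rewrite big_map; apply: eq_bigr => k _; rewrite pickleK_inv.
rewrite [leRHS](bigID (fun n => n \in map pickle s)) /=.
rewrite -[leLHS]adde0; apply: leeD; last by apply: sume_ge0.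
rewrite -[leRHS]big_filter le_eqVlt; apply/orP; left; apply/eqP/perm_big.
apply: uniq_perm.
- by rewrite map_inj_uniq//; exact: (pcan_inj pickleK).
- by rewrite filter_uniq// iota_uniq.
move=> n; rewrite mem_filter mem_index_iota /=.
by apply/mapP/andP => [[k ks ->]|[/mapP]//]; rewrite sN// map_f.
Qed.

Lemma csum_ge a k : (forall k, 0 <= a k) -> a k <= csum a.
Proof.
by move=> a0; have := @csum_ge_fin a [:: k] a0 isT; rewrite big_seq1.
Qed.

Lemma ge0_csumZl (c : \bar R) a : 0 <= c -> (forall k, 0 <= a k) ->
  csum (fun k => c * a k) = c * csum a.
Proof.
case: c => [r| |//] r0 a0; first exact: csumZl.
case: (pselect (exists k, 0 < a k)) => [[k ak]|na].
  rewrite gt0_mulye; last exact: lt_le_trans ak (@csum_ge a k a0).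
  have := @csum_ge (fun k => +oo * a k) k (fun l => mule_ge0 r0 (a0 l)).
  by rewrite gt0_mulye// leye_eq => /eqP.
have {}a0 k : a k = 0.
  apply/eqP; apply: contrapT => /negP ak; apply: na; exists k.
  by rewrite lt_neqAle eq_sym a0 andbT.
rewrite (eq_csum a0) csum0 mule0 -[RHS]csum0.
by apply: eq_csum => k; rewrite a0 mule0.
Qed.

End countable_sum.

Section integrals.
Context d (T : measurableType d) (R : realType) (K : countType).
Implicit Types (mu : {measure set T -> \bar R}).
Local Open Scope ereal_scope.

Lemma measurable_csum (f : K -> T -> \bar R) :
  (forall k, measurable_fun setT (f k)) -> (forall k x, 0 <= f k x) ->
  measurable_fun setT (fun x => csum (fun k => f k x)).
Proof.
move=> mf f0; apply: (ge0_emeasurable_sum (P := xpredT)) => [n x _ _|n _].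
  by case: pickle_inv.
by case: pickle_inv => [k|]//.
Qed.

Lemma integral_csum mu (f : K -> T -> \bar R) :
  (forall k, measurable_fun setT (f k)) -> (forall k x, 0 <= f k x) ->
  \int[mu]_x csum (fun k => f k x) = csum (fun k => \int[mu]_x f k x).
Proof.
move=> mf f0; rewrite /csum integral_nneseries//.
- apply: eq_eseriesr => n _; case: pickle_inv => [k//|].
  by rewrite integral0.
- by move=> n; case: pickle_inv.
- by move=> n x _; case: pickle_inv.
Qed.

Lemma integral_image d' (T' : measurableType d')
    (mu : {measure set T -> \bar R}) (nu : {measure set T' -> \bar R})
    (phi : T -> T') (mphi : measurable_fun setT phi) (f : T' -> \bar R) :
  (forall A, measurable A -> nu A = mu (phi @^-1` A)) ->
  measurable_fun setT f -> (forall x, 0 <= f x) ->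
  \int[nu]_x f x = \int[mu]_x f (phi x).
Proof.
move=> numu mf f0; transitivity (\int[pushforward mu phi]_x f x).
  by apply: eq_measure_integral => A mA _; exact: numu.
by rewrite ge0_integral_pushforward.
Qed.

Lemma integral_mrestr mu (D : set T) (mD : measurable D) (f : T -> \bar R) :
  measurable_fun setT f -> (forall x, 0 <= f x) ->
  \int[mrestr mu mD]_x f x = \int[mu]_(x in D) f x.
Proof.
move=> mf f0; rewrite -(setUv D) ge0_integral_setU//.
- rewrite [X in _ + X](_ : _ = 0).
    rewrite adde0; apply: eq_measure_integral => A mA AD.
    by rewrite [LHS](_ : _ = mu (A `&` D))// setIidl.
  apply: null_set_integral => //; first exact: measurableC.
    exact: measurable_funTS.
  by rewrite [LHS](_ : _ = mu (~` D `&` D))// setICl measure0.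
- exact: measurableC.
- by rewrite setUv.
- exact/disj_setPCl.
Qed.

(** The indicator under the integral sign is what allows sums over tiles to be
    evaluated pointwise. *)
Lemma integral_indicM mu (D : set T) (f : T -> \bar R) : measurable D ->
  \int[mu]_(x in D) f x = \int[mu]_x (f x * (\1_D x)%:E).
Proof.
move=> mD; rewrite integral_mkcond; apply: eq_integral => x _.
rewrite patchE indicE; case: (x \in D); last by rewrite mule0.
by rewrite mule1.
Qed.

Lemma measurable_indicM (D : set T) (f : T -> \bar R) : measurable D ->
  measurable_fun setT f -> measurable_fun setT (fun x => f x * (\1_D x)%:E).
Proof.
by move=> mD mf; apply: emeasurable_funM => //; apply/measurable_EFinP/measurable_indic.
Qed.

End integrals.

(** * Translation invariance of Lebesgue measure *)

Section lebesgue_translation.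
Context (R : realType).
Local Open Scope ereal_scope.

Lemma lebesgue_measure_translate (a : R) (f : R -> \bar R) :
  measurable_fun setT f -> (forall x, 0 <= f x) ->
  \int[@lebesgue_measure R]_x f (x + a)%R = \int[@lebesgue_measure R]_x f x.
Proof.
move=> mf f0.
pose phi : measurableTypeR R -> measurableTypeR R := fun x => (x + a)%R.
have mphi : measurable_fun setT phi by exact: measurable_funD.
rewrite [RHS](integral_image (mu := @lebesgue_measure R) mphi)// => A mA.
apply: (lebesgue_measure_unique (mu := pushforward (@lebesgue_measure R) phi)) mA => _ [[b c]] _ <-.
transitivity (lebesgue_measure (phi @^-1` `]b, c]%classic)); last by [].
have -> : phi @^-1` `]b, c]%classic = `](b - a)%R, (c - a)%R]%classic.
  by apply/seteqP; split => x /=; rewrite /phi !in_itv/= ltrBlDr lerBrDr.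
by rewrite !lebesgue_measure_itv/= !lte_fin ltrD2r; case: ifP => // _; rewrite -!EFinB; congr EFin; ring.
Qed.

Lemma integral_lebesgue_cVS d (f : 'cV[R]_d.+1 -> \bar R) :
  measurable_fun setT f -> (forall x, 0 <= f x) ->
  \int[lebesgue_cV R d.+1]_x f x =
  \int[@lebesgue_measure R]_a \int[lebesgue_cV R d]_x f (cons_cV (a, x)).
Proof.
move=> mf f0.
have mfc : measurable_fun setT (f \o @cons_cV R d).
  exact: measurableT_comp (@measurable_cons_cV R d).
rewrite (@integral_image _ _ _ _ _ (@lebesgue_measure R \x lebesgue_cV R d)
  _ _ (@measurable_cons_cV R d))//.
exact: (fubini_tonelli1 _ mfc (fun=> f0 _)).
Qed.

Lemma measurable_translate d (v : 'cV[R]_d) :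
  measurable_fun setT (fun x : 'cV[R]_d => (x + v)%R).
Proof.
apply: measurable_fun_cV => i; under eq_fun do rewrite mxE.
by apply: measurable_funD => //; exact: measurable_coord_cV.
Qed.

(** By induction on the dimension, from the one-dimensional case and Tonelli's
    theorem. *)
Lemma lebesgue_cV_translate d (v : 'cV[R]_d) (f : 'cV[R]_d -> \bar R) :
  measurable_fun setT f -> (forall x, 0 <= f x) ->
  \int[lebesgue_cV R d]_x f (x + v)%R = \int[lebesgue_cV R d]_x f x.
Proof.
elim: d v f => [|d ih] v f mf f0.
  by apply: eq_integral => x _; congr f; apply/matrixP => -[].
have mfv : measurable_fun setT (fun x : 'cV[R]_d.+1 => f (x + v)%R).
  by apply: measurableT_comp => //; exact: measurable_translate.
rewrite (integral_lebesgue_cVS mfv (fun=> f0 _)) (integral_lebesgue_cVS mf f0).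
pose v' : 'cV[R]_d := \col_i v (lift ord0 i) 0%R.
pose h (a : R) := \int[lebesgue_cV R d]_x f (cons_cV (a, x)).
have mfc : measurable_fun setT (f \o @cons_cV R d).
  exact: measurableT_comp (@measurable_cons_cV R d).
rewrite -(@lebesgue_measure_translate (v ord0 0%R) h); last 2 first.
- have := @measurable_fun_fubini_tonelli_F _ _ _ _ R (lebesgue_cV R d)
    (f \o @cons_cV R d) mfc (fun=> f0 _).
  exact.
- by move=> a; apply: integral_ge0.
apply: eq_integral => a _; rewrite /h -[RHS](ih v').
  apply: eq_integral => x _; congr f; apply/matrixP => i j; rewrite ord1 mxE.
  case: (unliftP ord0 i) => [k ->|->]; first by rewrite !cons_cVS !mxE.
  by rewrite !cons_cV0.
  apply: (measurableT_comp mfc (g := fun x => ((a + v ord0 0)%R, x))).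
  exact: pair1_measurable.
by move=> x; exact: f0.
Qed.

End lebesgue_translation.

(** * Lattices, fundamental domains and characters *)

Section lattice_algebra.
Context (R : realType) (d : nat).
Implicit Types (G M : 'M[R]_d) (x y : 'cV[R]_d) (k l : 'cV[int]_d).

(** Lattices are given by a matrix G whose columns form a basis; [lat G k] is
    the lattice vector with integral coordinates k. *)
Definition lat G k : 'cV[R]_d := G *m int_mx R k.

Lemma int_mxD k l : int_mx R (k + l) = int_mx R k + int_mx R l.
Proof. by apply/matrixP => i j; rewrite !mxE intrD. Qed.

Lemma int_mxN k : int_mx R (- k) = - int_mx R k.
Proof. by apply/matrixP => i j; rewrite !mxE intrN. Qed.

Lemma int_mx0 : int_mx R (0 : 'cV[int]_d) = 0.
Proof. by apply/matrixP => i j; rewrite !mxE. Qed.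

Lemma int_mxM (A : 'M[int]_d) k : int_mx R (A *m k) = int_mx R A *m int_mx R k.
Proof. exact: map_mxM. Qed.

Lemma int_mx_inj : injective (@int_mx R d 1).
Proof.
move=> k l /matrixP kl; apply/matrixP => i j.
by have := kl i j; rewrite !mxE => /eqP; rewrite eqr_int => /eqP.
Qed.

Lemma latD G k l : lat G (k + l) = lat G k + lat G l.
Proof. by rewrite /lat int_mxD mulmxDr. Qed.

Lemma latN G k : lat G (- k) = - lat G k.
Proof. by rewrite /lat int_mxN mulmxN. Qed.

Lemma latB G k l : lat G (k - l) = lat G k - lat G l.
Proof. by rewrite latD latN. Qed.

Lemma lat0 G : lat G 0 = 0.
Proof. by rewrite /lat int_mx0 mulmx0. Qed.

Lemma lat_inj G : G \in unitmx -> injective (lat G).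
Proof.
move=> uG k l /(congr1 (mulmx (invmx G))).
by rewrite !mulKmx// => /int_mx_inj.
Qed.

Lemma lat1 k : lat 1%:M k = int_mx R k.
Proof. by rewrite /lat mul1mx. Qed.

Lemma latM G (N : 'M[int]_d) k : lat (G *m int_mx R N) k = lat G (N *m k).
Proof. by rewrite /lat -mulmxA int_mxM. Qed.

Lemma dotprodC x y : dotprod x y = dotprod y x.
Proof. by apply: eq_bigr => i _; rewrite mulrC. Qed.

Lemma dotprodDr x y z : dotprod x (y + z) = dotprod x y + dotprod x z.
Proof. by rewrite -big_split; apply: eq_bigr => i _ /=; rewrite mxE mulrDr. Qed.

Lemma dotprodNr x y : dotprod x (- y) = - dotprod x y.
Proof. by rewrite -sumrN; apply: eq_bigr => i _ /=; rewrite mxE mulrN. Qed.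

Lemma dotprodDl x y z : dotprod (x + y) z = dotprod x z + dotprod y z.
Proof. by rewrite !(dotprodC _ z) dotprodDr. Qed.

Lemma dotprodNl x y : dotprod (- x) y = - dotprod x y.
Proof. by rewrite dotprodC dotprodNr dotprodC. Qed.

Lemma dotprod0l y : dotprod 0 y = 0.
Proof. by rewrite /dotprod big1// => i _; rewrite mxE mul0r. Qed.

Lemma dotprodE x y : dotprod x y = (x^T *m y) 0 0.
Proof. by rewrite mxE; apply: eq_bigr => i _; rewrite mxE. Qed.

Lemma dotprod_mulmx M x y : dotprod x (M *m y) = dotprod (M^T *m x) y.
Proof. by rewrite !dotprodE trmx_mul trmxK mulmxA. Qed.

Lemma dotprod_int k l : exists n : int,
  dotprod (int_mx R k) (int_mx R l) = n%:~R.
Proof.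
exists (\sum_i k i 0 * l i 0); rewrite /dotprod (raddf_sum (intmul (1 : R))).
by apply: eq_bigr => i _; rewrite !mxE -intrM.
Qed.

Lemma measurable_mulmx M : measurable_fun setT (fun x => M *m x).
Proof.
apply: measurable_fun_cV => i; under eq_fun do rewrite mxE.
apply: measurable_sum => j; apply: measurable_funM => //.
exact: measurable_coord_cV.
Qed.

Lemma measurable_dotprod x : measurable_fun setT (fun y => dotprod x y).
Proof.
apply: measurable_sum => j; apply: measurable_funM => //.
exact: measurable_coord_cV.
Qed.

(** The lattice of [dual G] is the dual lattice: it consists of the t whose
    inner products with all vectors of the lattice of G are integers. *)
Definition dual G : 'M[R]_d := (invmx G)^T.

Lemma dualK G : dual (dual G) = G.
Proof. by rewrite /dual -trmx_inv invmxK trmxK. Qed.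

Lemma dual_unit G : (dual G \in unitmx) = (G \in unitmx).
Proof. by rewrite /dual unitmx_tr unitmx_inv. Qed.

(** The characters of R^d that are trivial on the lattice [lat G]. *)
Definition chi G k x : R[i] := expi (2 * pi * dotprod (lat (dual G) k) x).

Lemma chiE G k x : chi G k x = expi (2 * pi * dotprod (int_mx R k) (invmx G *m x)).
Proof. by rewrite /chi dotprod_mulmx. Qed.

Lemma chi_cadd G k x y : chi G k (x + y) = chi G k x * chi G k y.
Proof. by rewrite /chi dotprodDr mulrDr expiD. Qed.

Lemma chi_add G k l x : chi G (k + l) x = chi G k x * chi G l x.
Proof. by rewrite /chi latD dotprodDl mulrDr expiD. Qed.

Lemma chi_opp G k x : chi G (- k) x = conjc (chi G k x).
Proof. by rewrite /chi latN dotprodNl mulrN expiN. Qed.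

Lemma chi0 G x : chi G 0 x = 1.
Proof. by rewrite /chi lat0 dotprod0l mulr0 expi0. Qed.

Lemma chi_lat G k l : G \in unitmx -> chi G k (lat G l) = 1.
Proof.
move=> uG; rewrite chiE mulKmx//; have [n ->] := dotprod_int k l.
exact: expi_int.
Qed.

Lemma chi_periodic G k l x : G \in unitmx -> chi G k (x + lat G l) = chi G k x.
Proof. by move=> uG; rewrite chi_cadd chi_lat// mulr1. Qed.

Lemma cmod_chi G k x : cmod (chi G k x) = 1.
Proof. exact: cmod_expi. Qed.

Lemma cmeasurable_chi G k : cmeasurable (chi G k).
Proof.
apply: cmeasurable_expi; apply: measurable_funM => //.
exact: measurable_dotprod.
Qed.

End lattice_algebra.

Section fundamental_domains.
Context (R : realType) (d : nat).
Implicit Types (G M : 'M[R]_d) (x y : 'cV[R]_d) (k l : 'cV[int]_d).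
Implicit Types (T Q : set 'cV[R]_d).
Local Notation leb := (lebesgue_cV R d).

(** Exact forms of packing and tiling by a lattice, with no exceptional null
    set. They make cutting and moving pieces a pointwise matter; null sets are
    dealt with once, in [packing_refine] and [tiles_fundom]. *)
Definition exact_packing G T := measurable T /\
  forall x k l, T (x - lat G k) -> T (x - lat G l) -> k = l.

Definition periodization G T := [set x | exists k, T (x - lat G k)].

Definition fundom G T := exact_packing G T /\ forall x, periodization G T x.

Lemma measurable_preimage_translate T x : measurable T ->
  measurable [set y | T (y + x)].
Proof.
move=> mT; have := @measurable_translate R d x measurableT T mT.
by rewrite setTI.
Qed.

Lemma measurable_periodization G T : measurable T ->
  measurable (periodization G T).
Proof.
move=> mT; rewrite (_ : periodization G T = \bigcup_k [set x | T (x - lat G k)]).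
  by apply: countable_bigcupT_measurable => // k; exact: measurable_preimage_translate.
by apply/seteqP; split => [x [k Tk]|x [k _ Tk]]; exists k.
Qed.

Local Open Scope ereal_scope.

Lemma csum_indicN G T x : exact_packing G T ->
  csum (fun k => (\1_T (x - lat G k)%R)%:E) = (\1_(periodization G T) x)%:E :> \bar R.
Proof.
move=> [mT pT]; case: (pselect (periodization G T x)) => [[k0 Tk0]|nT].
  rewrite (csum_single (k0 := k0)).
  - by rewrite !indicE !mem_set//; exists k0.
  - by move=> k; rewrite lee_fin.
  - move=> k kk0; rewrite indicE memNset// => Tk; apply: kk0; exact: pT Tk Tk0.
rewrite indicE memNset// -[RHS](@csum0 R 'cV[int]_d).
apply: eq_csum => k; rewrite indicE memNset// => Tk; apply: nT; by exists k.
Qed.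

Lemma csum_indicD G T x : exact_packing G T ->
  csum (fun k => (\1_T (x + lat G k)%R)%:E) = (\1_(periodization G T) x)%:E :> \bar R.
Proof.
move=> [mT pT]; case: (pselect (periodization G T x)) => [[k0 Tk0]|nT].
  rewrite (csum_single (k0 := (- k0)%R)).
  - by rewrite !indicE latN !mem_set//; exists k0.
  - by move=> k; rewrite lee_fin.
  - move=> k kk0; rewrite indicE memNset// => Tk; apply: kk0.
    by rewrite -(@pT x (- k)%R k0) ?opprK// latN opprK.
rewrite indicE memNset// -[RHS](@csum0 R 'cV[int]_d).
apply: eq_csum => k; rewrite indicE memNset// => Tk; apply: nT.
by exists (- k)%R; rewrite latN opprK.
Qed.

Lemma measurable_fun_translate d' (T' : measurableType d') (f : 'cV[R]_d -> T') x :
  measurable_fun setT f -> measurable_fun setT (fun y => f (y + x)%R).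
Proof. by move=> mf; apply: measurableT_comp => //; exact: measurable_translate. Qed.

Lemma measurable_indic_translate T x : measurable T ->
  measurable_fun setT (fun y => (\1_T (y + x)%R : R)%:E).
Proof.
move=> mT; apply/measurable_EFinP.
have := @measurable_fun_translate _ _ (\1_T : _ -> R) x; apply.
exact: measurable_indic.
Qed.

(** A periodic set can be cut along the translates of a packing set, and every
    piece moved back by a lattice vector. *)
Lemma integral_periodization G T (f : 'cV[R]_d -> \bar R) : exact_packing G T ->
  measurable_fun setT f -> (forall x, 0 <= f x) ->
  \int[leb]_x (f x * (\1_(periodization G T) x)%:E) =
  csum (fun k => \int[leb]_x (f (x + lat G k)%R * (\1_T x)%:E)).
Proof.
move=> pT mf f0; have mT := pT.1.
transitivity (\int[leb]_x csum (fun k => f x * (\1_T (x - lat G k)%R)%:E)).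
  apply: eq_integral => x _; rewrite -(csum_indicN x pT) -ge0_csumZl//.
rewrite integral_csum; last 2 first.
- move=> k; apply: emeasurable_funM; first exact: mf.
  exact: measurable_indic_translate.
- by move=> k x; apply: mule_ge0; [exact: f0|rewrite lee_fin].
apply: eq_csum => k; rewrite -[LHS](lebesgue_cV_translate (lat G k)).
- by apply: eq_integral => x _; rewrite addrK.
- apply: emeasurable_funM; first exact: mf.
  exact: measurable_indic_translate.
- by move=> x; apply: mule_ge0; [exact: f0|rewrite lee_fin].
Qed.

Lemma fundom_indic G T x : fundom G T -> \1_(periodization G T) x = 1%R :> R.
Proof. by move=> [_ pT]; rewrite indicE mem_set. Qed.

Lemma integral_fundom G T (f : 'cV[R]_d -> \bar R) : fundom G T ->
  measurable_fun setT f -> (forall x, 0 <= f x) ->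
  \int[leb]_x f x =
  csum (fun k => \int[leb]_x (f (x + lat G k)%R * (\1_T x)%:E)).
Proof.
move=> fT mf f0; rewrite -integral_periodization//; last exact: fT.1.
by apply: eq_integral => x _; rewrite fundom_indic// mule1.
Qed.

(** The pieces of T in the translates of Q can be moved into Q by lattice
    vectors, where they are disjoint and fill the trace of the periodization
    of T; a periodic integrand does not see the moves. *)
Lemma integral_packing_fundom G T Q (f : 'cV[R]_d -> \bar R) :
  exact_packing G T -> fundom G Q ->
  measurable_fun setT f -> (forall x, 0 <= f x) ->
  (forall x k, f (x + lat G k)%R = f x) ->
  \int[leb]_x (f x * (\1_T x)%:E) =
  \int[leb]_x (f x * (\1_(periodization G T) x)%:E * (\1_Q x)%:E).
Proof.
move=> pT fQ mf f0 fper; have mT := pT.1; have mQ := fQ.1.1.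
rewrite (integral_fundom fQ)//; last 2 first.
- exact: measurable_indicM.
- by move=> x; rewrite mule_ge0// lee_fin.
rewrite -integral_csum; last 2 first.
- move=> k; apply: emeasurable_funM; last first.
    by apply/measurable_EFinP; exact: measurable_indic.
  apply: emeasurable_funM; first exact: measurable_fun_translate.
  exact: measurable_indic_translate.
- move=> k x; apply: mule_ge0; last by rewrite lee_fin.
  by apply: mule_ge0; [exact: f0|rewrite lee_fin].
apply: eq_integral => x _; rewrite -(csum_indicD x pT).
rewrite -ge0_csumZl; [|exact: f0|by move=> k; rewrite lee_fin].
rewrite [RHS]muleC -ge0_csumZl; last 2 first.
- by rewrite lee_fin.
- by move=> k; apply: mule_ge0; [exact: f0|rewrite lee_fin].
by apply: eq_csum => k; rewrite muleC fper.
Qed.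

Lemma integral_fundom_fundom G T Q (f : 'cV[R]_d -> \bar R) :
  fundom G T -> fundom G Q ->
  measurable_fun setT f -> (forall x, 0 <= f x) ->
  (forall x k, f (x + lat G k)%R = f x) ->
  \int[leb]_x (f x * (\1_T x)%:E) = \int[leb]_x (f x * (\1_Q x)%:E).
Proof.
move=> fT fQ mf f0 fper; rewrite (integral_packing_fundom fT.1 fQ)//.
by apply: eq_integral => x _; rewrite fundom_indic// mule1.
Qed.

Lemma measure_indic T : measurable T -> leb T = \int[leb]_x (\1_T x)%:E.
Proof. by move=> mT; rewrite integral_indic// setIT. Qed.

Lemma measure_fundom G T Q : fundom G T -> fundom G Q -> leb T = leb Q.
Proof.
move=> fT fQ; have mT := fT.1.1; have mQ := fQ.1.1.
rewrite !measure_indic//.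
have := @integral_fundom_fundom G T Q (cst 1) fT fQ.
by under eq_integral do rewrite mul1e; under [in RHS]eq_integral do rewrite mul1e; apply.
Qed.

Lemma fundom_translate G T v : fundom G T -> fundom G [set x | T (x - v)%R].
Proof.
move=> [[mT pT] cT]; split; first split.
- exact: measurable_preimage_translate.
- move=> x k l; rewrite /= (addrAC x _ (- v)%R) (addrAC x _ (- v)%R).
  exact: pT.
- by move=> x; have [k Tk] := cT (x - v)%R; exists k; rewrite /= (addrAC x).
Qed.

Lemma translate_indic T v y : (\1_T y : R) = \1_([set x | T (x - v)%R]) (y + v)%R.
Proof. by rewrite !indicE; congr (nat_of_bool _)%:R; apply/idP/idP; rewrite !inE /= addrK. Qed.

Lemma integral_fundom_shift G T v (f : 'cV[R]_d -> \bar R) : fundom G T ->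
  measurable_fun setT f -> (forall x, 0 <= f x) ->
  (forall x k, f (x + lat G k)%R = f x) ->
  \int[leb]_(x in T) f (x + v)%R = \int[leb]_(x in T) f x.
Proof.
move=> fT mf f0 fper; have mT := fT.1.1; have fTv := fundom_translate v fT.
have mTv := fTv.1.1.
rewrite [LHS]integral_indicM// [RHS]integral_indicM//.
rewrite [RHS](integral_fundom_fundom fT fTv)//.
rewrite -[RHS](lebesgue_cV_translate v); last 2 first.
- exact: measurable_indicM.
- by move=> x; apply: mule_ge0; [exact: f0|rewrite lee_fin].
by apply: eq_integral => x _; rewrite -translate_indic.
Qed.

Lemma integral_bounded_lty d' (X : measurableType d')
    (nu : {measure set X -> \bar R}) (M : R) (h : X -> R) :
  nu setT < +oo -> measurable_fun setT h -> (forall x : X, `|h x| <= M)%R ->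
  nu.-integrable setT (EFin \o h).
Proof.
move=> nuoo mh hM; apply: measurable_bounded_integrable => //.
exists M; split; first exact: num_real.
by move=> N MN x _ /=; rewrite (le_trans (hM x))// ltW.
Qed.

(** Translating a fundamental domain gives another one, so the integral of h
    equals its opposite. The argument is run on the nonnegative functions
    1 + h and 1 - h, to which the transfer between fundamental domains
    applies. *)
Lemma Rintegral_fundom_antiperiodic G T (fT : fundom G T) (mT : measurable T)
    v (h : 'cV[R]_d -> R) :
  leb T < +oo -> measurable_fun setT h -> (forall x, `|h x| <= 1)%R ->
  (forall x k, h (x + lat G k) = h x)%R -> (forall x, h (x + v) = - h x)%R ->
  (\int[mrestr leb mT]_x h x)%R = 0%R.
Proof.
move=> Too mh h1 hper hv; pose nu := mrestr leb mT.
have nuoo : nu setT < +oo by rewrite /nu /mrestr setTI.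
have hi := integral_bounded_lty nuoo mh h1.
have ci : nu.-integrable setT (EFin \o (fun=> 1%R)).
  by apply: (integral_bounded_lty (M := 1%R)) => // x; rewrite normr1.
have E : (\int[nu]_x (1 + h x) = \int[nu]_x (1 - h x))%R.
  rewrite /Rintegral; congr fine.
  have m1 : measurable_fun setT (fun x => (1 + h x)%:E).
    by apply/measurable_EFinP/measurable_funD.
  have p1 x : 0 <= (1 + h x)%:E.
    by rewrite lee_fin; have := h1 x; rewrite ler_norml => /andP[]; lra.
  rewrite !integral_mrestr//.
  - rewrite -[LHS](integral_fundom_shift v fT)//.
      by apply: eq_integral => x _; rewrite hv.
    by move=> x k; rewrite hper.
  - by apply/measurable_EFinP/measurable_funB.
  - by move=> x; rewrite lee_fin; have := h1 x; rewrite ler_norml => /andP[]; lra.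
move: E; rewrite RintegralD// RintegralB// => E.
by set I := (X in X = _); move: E; rewrite -/nu -/I; lra.
Qed.

(** A nontrivial character changes sign under a suitable half period. *)
Lemma cintegral_chi G T (fT : fundom G T) (mT : measurable T) k :
  G \in unitmx -> leb T < +oo -> k <> 0%R ->
  cintegral (mrestr leb mT) (chi G k) = 0%R.
Proof.
move=> uG Too k0.
have [j kj] : exists j, k j 0%R != 0%R.
  apply: contrapT => nk; apply: k0; apply/matrixP => i j; rewrite ord1 mxE.
  by apply/eqP; apply: contrapT => /negP ki; apply: nk; exists i.
(* G w is half a period of the character in the direction j. *)
pose w : 'cV[R]_d := \col_i (if i == j then (2 * (k j 0)%:~R)^-1 else 0)%R.
have chiw x : chi G k (x + G *m w)%R = (- chi G k x)%R.
  rewrite chi_cadd [chi G k (G *m w)]chiE mulKmx//.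
  have -> : dotprod (int_mx R k) w = 2^-1%R.
    rewrite /dotprod (bigD1 j)//= big1 ?addr0; last first.
      by move=> i ij; rewrite [w _ _]mxE (negPf ij) mulr0.
    have kj' : ((k j 0)%:~R != 0 :> R)%R by rewrite intr_eq0.
    by rewrite !mxE eqxx; field.
  rewrite (_ : 2 * pi / 2 = pi)%R; last by field.
  rewrite /expi cospi sinpi.
  by apply: complex_ext; rewrite !ReIm_simp /=; ring.
apply: complex_ext => /=.
  apply: (@Rintegral_fundom_antiperiodic G T fT mT (G *m w)%R
    (fun x => complex.Re (chi G k x))) => //.
  - exact: (cmeasurable_chi G k).1.
  - by move=> x; rewrite (le_trans (Re_le_cmod _))// cmod_chi.
  - by move=> x l; rewrite chi_periodic.
  - by move=> x; rewrite chiw Re_opp.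
apply: (@Rintegral_fundom_antiperiodic G T fT mT (G *m w)%R
    (fun x => complex.Im (chi G k x))) => //.
- exact: (cmeasurable_chi G k).2.
- by move=> x; rewrite (le_trans (Im_le_cmod _))// cmod_chi.
- by move=> x l; rewrite chi_periodic.
- by move=> x; rewrite chiw Im_opp.
Qed.

End fundamental_domains.

(** * Completeness of the characters *)

Lemma ecvg_lt_near (R : realType) (u : nat -> \bar R) (l a : \bar R) :
  u @ \oo --> l -> (l < a)%E -> \forall n \near \oo, (u n < a)%E.
Proof. by move=> ul la; exact: (ul _ (open_ereal_lt' la)). Qed.

Section bounded_functions.
Context d (X : measurableType d) (R : realType).
Implicit Types (nu : {measure set X -> \bar R}) (f g : X -> R[i]).

Definition bounded_cmeasurable f :=
  cmeasurable f /\ exists M : R, forall x, cmod (f x) <= M.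

Local Notation bm := bounded_cmeasurable.

Lemma bmD f g : bm f -> bm g -> bm (fun x => f x + g x).
Proof.
move=> [mf [M fM]] [mg [N gN]]; split; first exact: cmeasurableD.
by exists (M + N) => x; rewrite (le_trans (cmodD _ _))// lerD.
Qed.

Lemma bmM f g : bm f -> bm g -> bm (fun x => f x * g x).
Proof.
move=> [mf [M fM]] [mg [N gN]]; split; first exact: cmeasurableM.
by exists (M * N) => x; rewrite cmodM ler_pM ?cmod_ge0.
Qed.

Lemma bm_cst c : bm (fun=> c).
Proof. by split; [exact: cmeasurable_cst|exists (cmod c)]. Qed.

Lemma bmZ c f : bm f -> bm (fun x => c * f x).
Proof. by move=> bf; apply: bmM => //; exact: bm_cst. Qed.

Lemma bmB f g : bm f -> bm g -> bm (fun x => f x - g x).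
Proof.
move=> bf bg; rewrite (_ : (fun x => _) = (fun x => f x + -1 * g x)).
  by apply: bmD => //; exact: bmZ.
by apply/funext => x; rewrite mulN1r.
Qed.

Lemma bm_conj f : bm f -> bm (fun x => conjc (f x)).
Proof.
move=> [mf [M fM]]; split; first exact: cmeasurable_conj.
by exists M => x; rewrite cmod_conj.
Qed.

Lemma bm_sum (I : Type) (s : seq I) (h : I -> X -> R[i]) :
  (forall i, bm (h i)) -> bm (fun x => \sum_(i <- s) h i x).
Proof.
move=> mh; elim: s => [|i s ih].
  by under eq_fun do rewrite big_nil; exact: bm_cst.
by under eq_fun do rewrite big_cons; exact: bmD.
Qed.

Lemma bm_indic (A : set X) : measurable A -> bm (fun x => ((\1_A x : R)%:C)%C).
Proof.
move=> mA; split; first exact: cmeasurable_indic.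
by exists 1 => x; rewrite cmod_real indicE ger0_norm// lern1 leq_b1.
Qed.

Lemma bm_in_L1 nu f : (nu setT < +oo)%E -> bm f -> in_L1 nu f.
Proof.
move=> nuoo [mf [M fM]]; split=> //.
have /integrableP[_] : nu.-integrable setT (EFin \o (fun x => cmod (f x))).
  apply: (integral_bounded_lty (M := M)) => //; first exact: measurable_cmod.
  by move=> x; rewrite ger0_norm ?cmod_ge0.
by under eq_integral do rewrite /= ger0_norm ?cmod_ge0//.
Qed.

(** The squared L^2 norm, possibly infinite. Working with it instead of the
    norm keeps all estimates quadratic. *)
Definition energy nu f : \bar R := (\int[nu]_x (cmod (f x) ^+ 2)%:E)%E.

Lemma energy_ge0 nu f : (0 <= energy nu f)%E.
Proof. by apply: integral_ge0 => x _; rewrite lee_fin sqr_ge0. Qed.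

Lemma energy_le nu f g : cmeasurable f -> cmeasurable g ->
  (forall x, cmod (f x) <= cmod (g x)) -> (energy nu f <= energy nu g)%E.
Proof.
move=> mf mg fg; apply: ge0_le_integral => //.
- by move=> x _; rewrite lee_fin sqr_ge0.
- exact: emeasurable_cmod2.
- exact: emeasurable_cmod2.
- by move=> x _; rewrite lee_fin ler_pXn2r ?nnegrE ?cmod_ge0.
Qed.

Lemma energyD nu f g : cmeasurable f -> cmeasurable g ->
  (energy nu (fun x => f x + g x)%R <= 2%:E * energy nu f + 2%:E * energy nu g)%E.
Proof.
move=> mf mg; have mfg := cmeasurableD mf mg.
have ge0 (h : X -> R[i]) x : (0 <= (cmod (h x) ^+ 2)%:E)%E by rewrite lee_fin sqr_ge0.
rewrite /energy -!ge0_integralZl_EFin//; do ?exact: emeasurable_cmod2.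
rewrite -ge0_integralD//.
- apply: ge0_le_integral => //.
  + by move=> x _; rewrite lee_fin sqr_ge0.
  + exact: emeasurable_cmod2.
  + by apply: emeasurable_funD; apply: measurable_funeM; exact: emeasurable_cmod2.
  + by move=> x _; rewrite -!EFinM -EFinD lee_fin cmod2D.
- by move=> x _; rewrite -EFinM lee_fin mulr_ge0// sqr_ge0.
- by apply: measurable_funeM; exact: emeasurable_cmod2.
- by move=> x _; rewrite -EFinM lee_fin mulr_ge0// sqr_ge0.
- by apply: measurable_funeM; exact: emeasurable_cmod2.
Qed.

Lemma energyM nu f g (M : R) : cmeasurable f -> cmeasurable g ->
  (forall x, cmod (g x) <= M) ->
  (energy nu (fun x => g x * f x)%R <= (M ^+ 2)%:E * energy nu f)%E.
Proof.
move=> mf mg gM; have mfg := cmeasurableM mg mf.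
rewrite /energy -ge0_integralZl_EFin ?sqr_ge0//; last 2 first.
- by move=> x _; rewrite lee_fin sqr_ge0.
- exact: emeasurable_cmod2.
apply: ge0_le_integral => //.
- by move=> x _; rewrite lee_fin sqr_ge0.
- exact: emeasurable_cmod2.
- by apply: measurable_funeM; exact: emeasurable_cmod2.
- move=> x _; rewrite -EFinM lee_fin cmodM exprMn ler_wpM2r ?sqr_ge0//.
  by rewrite ler_pXn2r ?nnegrE ?cmod_ge0// (le_trans (cmod_ge0 (g x))).
Qed.

Lemma energyN nu f : energy nu (fun x => - f x)%R = energy nu f.
Proof. by apply: eq_integral => x _; rewrite cmodN. Qed.

Lemma energy_subC nu f g :
  energy nu (fun x => f x - g x)%R = energy nu (fun x => g x - f x)%R.
Proof. by apply: eq_integral => x _; rewrite -cmodN opprB. Qed.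

Lemma ae_eq_energy nu f g : cmeasurable f -> cmeasurable g ->
  {ae nu, forall x, f x = g x} -> energy nu f = energy nu g.
Proof.
move=> mf mg fg; apply: ge0_ae_eq_integral => //.
- exact: emeasurable_cmod2.
- exact: emeasurable_cmod2.
- by move=> x _; rewrite lee_fin sqr_ge0.
- by move=> x _; rewrite lee_fin sqr_ge0.
- by apply: filterS fg => x -> .
Qed.

(** Dominated convergence: the domination by a constant suffices because the
    measure is finite. *)
Lemma energy_cvg0 nu (f_ : nat -> X -> R[i]) f (M : R) : (nu setT < +oo)%E ->
  (forall n, cmeasurable (f_ n)) -> cmeasurable f ->
  (forall n x, cmod (f_ n x - f x) <= M) ->
  (forall x, (fun n => cmod (f_ n x - f x)) @ \oo --> (0 : R)) ->
  (fun n => energy nu (fun x => f_ n x - f x)%R) @ \oo --> 0%E.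
Proof.
move=> nuoo mf_ mf fM cf.
have M0 (x : X) : 0 <= M by rewrite (le_trans (cmod_ge0 _) (fM 0%N x)).
have [] := @dominated_convergence _ X R nu setT measurableT
  (fun n x => (cmod (f_ n x - f x) ^+ 2)%:E) (cst 0%E) (cst (M ^+ 2)%:E).
- by move=> n; apply: emeasurable_cmod2; exact: cmeasurableB.
- exact: measurable_cst.
- apply: aeW => x _; apply: cvg_EFin; first by near=> n.
  rewrite (_ : _ \o _ = (fun n => cmod (f_ n x - f x) * cmod (f_ n x - f x))).
    by rewrite -[X in _ --> X](mulr0 (0 : R)); apply: cvgM; exact: cf.
  by apply/funext => n /=; rewrite expr2.
- apply/integrableP; split; first exact: measurable_cst.
  by rewrite integral_cst//= lte_mul_pinfty// ?lee_fin ?normr_ge0.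
- apply: aeW => x n _; rewrite /= lee_fin ger0_norm ?sqr_ge0//.
  by rewrite ler_pXn2r ?nnegrE ?cmod_ge0// (M0 x).
move=> _ _; rewrite integral0; exact.
Unshelve. all: by end_near. Qed.

End bounded_functions.
Notation bm := bounded_cmeasurable.

Section approximation.
Context (R : realType) (d : nat) (G : 'M[R]_d).
Context (nu : {measure set 'cV[R]_d -> \bar R}) (nuoo : (nu setT < +oo)%E).
Implicit Types (f g : 'cV[R]_d -> R[i]) (u v : 'cV[R]_d -> R).
Local Notation char := (R[i] * 'cV[int]_d)%type.

Definition trigpoly (s : seq char) x : R[i] := \sum_(p <- s) p.1 * chi G p.2 x.

Lemma bm_chi k : bm (chi G k).
Proof.
split; first exact: cmeasurable_chi.
by exists 1 => x; rewrite cmod_chi.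
Qed.

Lemma bm_trigpoly s : bm (trigpoly s).
Proof. by apply: bm_sum => p; apply: bmZ; exact: bm_chi. Qed.

Lemma trigpolyM s t x :
  trigpoly [seq (p.1 * q.1, p.2 + q.2) | p <- s, q <- t] x =
  trigpoly s x * trigpoly t x.
Proof.
rewrite /trigpoly big_allpairs_dep big_distrlr /=.
by apply: eq_bigr => p _; apply: eq_bigr => q _; rewrite chi_add; ring.
Qed.

Lemma trigpolyD s t x : trigpoly (s ++ t) x = trigpoly s x + trigpoly t x.
Proof. by rewrite /trigpoly big_cat. Qed.

Let lt_quarters (a b : \bar R) (e : R) : (a < (e / 4)%:E -> b < (e / 4)%:E ->
  2%:E * a + 2%:E * b < e%:E)%E.
Proof.
move=> ae be; rewrite (_ : e = 2 * (e / 4) + 2 * (e / 4)); last by field.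
by rewrite [X in (_ < X)%E]EFinD; apply: lteD; rewrite EFinM lte_pmul2l// lte_fin.
Qed.

Let lt_scaled (a : \bar R) (N e : R) : (0 <= a -> a < (e / (N ^+ 2 + 1))%:E ->
  (N ^+ 2)%:E * a < e%:E)%E.
Proof.
move=> a0 ae; have N0 : 0 < N ^+ 2 + 1 by rewrite ltr_wpDl// sqr_ge0.
apply: (@le_lt_trans _ _ ((N ^+ 2 + 1)%:E * a)%E).
  by rewrite lee_wpmul2r// lee_fin lerDl.
rewrite (_ : e = (N ^+ 2 + 1) * (e / (N ^+ 2 + 1))); last first.
  by rewrite mulrCA divff ?mulr1// gt_eqF.
by rewrite EFinM lte_pmul2l// lte_fin.
Qed.

(** The bounded functions in the L^2-closure of the trigonometric
    polynomials. *)
Definition approximable f := bm f /\ forall eps : R, 0 < eps ->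
  exists s, (energy nu (fun x => f x - trigpoly s x)%R < eps%:E)%E.

Lemma approximable_trigpoly s : approximable (trigpoly s).
Proof.
split=> [|e e0]; first exact: bm_trigpoly.
exists s; rewrite /energy; under eq_integral do rewrite subrr cmod0 expr0n.
by rewrite integral0 lte_fin.
Qed.

Lemma approximableD f g : approximable f -> approximable g ->
  approximable (fun x => f x + g x).
Proof.
move=> [bf af] [bg ag]; split=> [|e e0]; first exact: bmD.
have e4 : 0 < e / 4 by rewrite divr_gt0.
have [s fs] := af _ e4; have [t gt] := ag _ e4; exists (s ++ t).
rewrite (_ : (fun x => _) =
    (fun x => (f x - trigpoly s x) + (g x - trigpoly t x))); last first.
  by apply/funext => x; rewrite trigpolyD; ring.
have mfs := (bmB bf (bm_trigpoly s)).1; have mgt := (bmB bg (bm_trigpoly t)).1.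
by apply: le_lt_trans (energyD nu mfs mgt) _; exact: lt_quarters.
Qed.

(** Approximate f first, by s with a precision that takes a bound of g into
    account, and then g with a precision that takes a bound of s into account. *)
Lemma approximableM f g : approximable f -> approximable g ->
  approximable (fun x => f x * g x).
Proof.
move=> [bf af] [bg ag]; split=> [|e e0]; first exact: bmM.
have [mg [N gN]] := bg.
have e4 : 0 < e / 4 by rewrite divr_gt0.
have pos (M : R) : 0 < e / 4 / (M ^+ 2 + 1) by rewrite divr_gt0// ltr_wpDl// sqr_ge0.
have [s fs] := af _ (pos N).
have [ms [P sP]] := bm_trigpoly s.
have [t gt] := ag _ (pos P).
exists [seq (p.1 * q.1, p.2 + q.2) | p <- s, q <- t].
rewrite (_ : (fun x => _) = (fun x => g x * (f x - trigpoly s x) +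
    trigpoly s x * (g x - trigpoly t x))); last first.
  by apply/funext => x; rewrite trigpolyM; ring.
have mfs := (bmB bf (bm_trigpoly s)).1; have mgt := (bmB bg (bm_trigpoly t)).1.
have mgfs := cmeasurableM mg mfs; have msgt := cmeasurableM ms mgt.
apply: le_lt_trans (energyD nu mgfs msgt) _; apply: lt_quarters.
  by apply: le_lt_trans (energyM nu mfs mg gN) _; apply: lt_scaled => //; exact: energy_ge0.
by apply: le_lt_trans (energyM nu mgt ms sP) _; apply: lt_scaled => //; exact: energy_ge0.
Qed.

Lemma approximable_energy_cvg (f_ : nat -> 'cV[R]_d -> R[i]) f :
  (forall n, approximable (f_ n)) -> bm f ->
  (fun n => energy nu (fun x => f_ n x - f x)%R) @ \oo --> 0%E ->
  approximable f.
Proof.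
move=> af_ bf cf; split=> // e e0.
have e4 : 0 < e / 4 by rewrite divr_gt0.
have [n fn] : exists n, (energy nu (fun x => f_ n x - f x)%R < (e / 4)%:E)%E.
  have : \forall n \near \oo, (energy nu (fun x => f_ n x - f x)%R < (e / 4)%:E)%E.
    by apply: (ecvg_lt_near cf); rewrite lte_fin.
  by move=> [N _ HN]; exists N; apply: HN => /=.
have [bfn /(_ _ e4)[s fs]] := af_ n; exists s.
rewrite (_ : (fun x => _) = (fun x => (f x - f_ n x) + (f_ n x - trigpoly s x))); last first.
  by apply/funext => x; ring.
have m1 := (bmB bf bfn).1; have m2 := (bmB bfn (bm_trigpoly s)).1.
apply: le_lt_trans (energyD nu m1 m2) _; apply: lt_quarters => //.
by rewrite energy_subC.
Qed.

Lemma approximable_lim (f_ : nat -> 'cV[R]_d -> R[i]) f (M : R) :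
  (forall n, approximable (f_ n)) -> bm f ->
  (forall n x, cmod (f_ n x - f x) <= M) ->
  (forall x, (fun n => cmod (f_ n x - f x)) @ \oo --> (0 : R)) ->
  approximable f.
Proof.
move=> af_ bf fM cf; apply: (approximable_energy_cvg af_ bf).
apply: (energy_cvg0 (M := M)) => //; last exact: bf.1.
by move=> n; exact: (af_ n).1.1.
Qed.

Lemma approximable_ae f g : bm g -> {ae nu, forall x, f x = g x} ->
  approximable f -> approximable g.
Proof.
move=> bg fg [bf af]; split=> // e e0; have [s fs] := af _ e0; exists s.
apply: le_lt_trans fs; rewrite le_eqVlt; apply/orP; left; apply/eqP.
apply: ae_eq_energy.
- exact: (bmB bg (bm_trigpoly s)).1.
- exact: (bmB bf (bm_trigpoly s)).1.
- by apply: filterS fg => x ->.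
Qed.

Definition rapproximable u := approximable (fun x => ((u x)%:C)%C).

Lemma rapproximableD u v : rapproximable u -> rapproximable v ->
  rapproximable (fun x => u x + v x).
Proof.
move=> au av; have := approximableD au av; rewrite /rapproximable.
by under [in X in _ -> X]eq_fun do rewrite rmorphD.
Qed.

Lemma rapproximableM u v : rapproximable u -> rapproximable v ->
  rapproximable (fun x => u x * v x).
Proof.
move=> au av; have := approximableM au av; rewrite /rapproximable.
by under [in X in _ -> X]eq_fun do rewrite rmorphM.
Qed.

Lemma rapproximable_cst (c : R) : rapproximable (fun=> c).
Proof.
rewrite /rapproximable (_ : (fun=> _) = trigpoly [:: ((c%:C)%C, 0)]).
  exact: approximable_trigpoly.
by apply/funext => x; rewrite /trigpoly big_seq1 chi0 mulr1.
Qed.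

Lemma rapproximable_sum (I : Type) (s : seq I) (h : I -> 'cV[R]_d -> R) :
  (forall i, rapproximable (h i)) ->
  rapproximable (fun x => \sum_(i <- s) h i x).
Proof.
move=> mh; elim: s => [|i s ih].
  by under eq_fun do rewrite big_nil; exact: rapproximable_cst.
by under eq_fun do rewrite big_cons; exact: rapproximableD.
Qed.

Lemma rapproximable_lim (u_ : nat -> 'cV[R]_d -> R) u (M : R) :
  (forall n, rapproximable (u_ n)) -> measurable_fun setT u ->
  (forall n x, `|u_ n x| <= M) -> (forall x, `|u x| <= M) ->
  (forall x, (fun n => u_ n x) @ \oo --> u x) ->
  rapproximable u.
Proof.
move=> au mu_ u_M uM cu; apply: (approximable_lim (M := M + M) au).
- split; first exact: cmeasurable_real.
  by exists M => x; rewrite cmod_real.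
- by move=> n x; rewrite -rmorphB cmod_real (le_trans (ler_normB _ _))// lerD.
- move=> x; under eq_fun do rewrite -rmorphB cmod_real.
  have : (fun n => u_ n x - u x) @ \oo --> (0 : R).
    by rewrite -(subrr (u x)); apply: cvgB => //; exact: cvg_cst.
  by move=> /cvg_norm; rewrite normr0.
Qed.

Lemma rapproximable_chi_Re k : rapproximable (fun x => complex.Re (chi G k x)).
Proof.
rewrite /rapproximable (_ : (fun=> _) =
    trigpoly [:: ((2^-1%:C)%C, k); ((2^-1%:C)%C, - k)]).
  exact: approximable_trigpoly.
apply/funext => x; rewrite /trigpoly !big_cons big_nil addr0 /= chi_opp.
by apply: complex_ext; rewrite !ReIm_simp /=; field.
Qed.

Lemma rapproximable_chi_Im k : rapproximable (fun x => complex.Im (chi G k x)).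
Proof.
rewrite /rapproximable (_ : (fun=> _) =
    trigpoly [:: (Complex 0 (- 2^-1), k); (Complex 0 2^-1, - k)]).
  exact: approximable_trigpoly.
apply/funext => x; rewrite /trigpoly !big_cons big_nil addr0 /= chi_opp.
by apply: complex_ext; rewrite !ReIm_simp /=; field.
Qed.

End approximation.

Section sign_iteration.
Context (R : realType).
Implicit Types u : R.

(** The odd polynomial [signstep] maps [-1, 1] to itself and pushes nonzero
    points towards the endpoints, so that its iterates converge to the sign. *)
Definition signstep u : R := (3 * u - u ^+ 3) / 2.

Lemma signstepN u : signstep (- u) = - signstep u.
Proof. by rewrite /signstep; field. Qed.

Lemma iter_signstepN n u : iter n signstep (- u) = - iter n signstep u.
Proof. by elim: n => //= n ->; rewrite signstepN. Qed.

(** One step multiplies the distance 1 - w to 1 by 1 - w (1 + w) / 2, and w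
    never falls below its initial value u. *)
Lemma iter_signstep_bound n u : 0 <= u <= 1 ->
  u <= iter n signstep u <= 1 /\ 1 - iter n signstep u <= (1 - u / 2) ^+ n.
Proof.
move=> /andP[u0 u1]; elim: n => [|n [/andP[h1 h2] h3]] /=.
  by rewrite expr0 lexx u1 gerBl.
set w := iter n signstep u in h1 h2 h3 *.
have w0 : 0 <= w by rewrite (le_trans u0).
have E : 1 - signstep w = (1 - w) * (1 - w * (1 + w) / 2).
  by rewrite /signstep; field.
have E2 : signstep w - w = w * (1 - w) * (1 + w) / 2.
  by rewrite /signstep; field.
have ww : w <= signstep w.
  by rewrite -subr_ge0 E2 divr_ge0// !mulr_ge0// ?subr_ge0// addr_ge0.
have s1 : signstep w <= 1.
  rewrite -subr_ge0 E mulr_ge0 ?subr_ge0//.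
  by rewrite ler_pdivrMr// mul1r; nra.
split; first by rewrite (le_trans h1 ww) s1.
rewrite E exprSr ler_pM ?subr_ge0//.
- by rewrite ler_pdivrMr// mul1r; nra.
- by rewrite lerD2l lerN2 ler_pM2r// (le_trans h1)// -[leLHS]mulr1 ler_wpM2l// lerDl.
Qed.

Lemma iter_signstep_cvg u : `|u| <= 1 ->
  (fun n => iter n signstep u) @ \oo --> Num.sg u.
Proof.
have pos v : 0 < v -> v <= 1 -> (fun n => iter n signstep v) @ \oo --> (1 : R).
  move=> v0 v1; have v01 : 0 <= v <= 1 by rewrite ltW.
  apply/cvgrPdist_le => e e0.
  have : (fun n => (1 - v / 2) ^+ n) @ \oo --> (0 : R).
    by apply: cvg_expr; rewrite ger0_norm; lra.
  move=> /cvgr0_norm_le/(_ _ e0); apply: filterS => n.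
  have [/andP[h1 h2] h3] := iter_signstep_bound n v01.
  by move=> he; rewrite ger0_norm ?subr_ge0// (le_trans h3)// (le_trans (ler_norm _)).
move=> u1; have [u0|u0|->] := ltgtP u 0.
- rewrite ltr0_sg//; have := pos (- u); rewrite oppr_gt0 => /(_ u0).
  move=> /(_ (le_trans (ler_norm _) _)); rewrite normrN => /(_ u1) /cvgN.
  rewrite (_ : (fun n => iter n signstep u) = - (fun n => iter n signstep (- u)))//.
  by apply/funext => n /=; rewrite [RHS](_ : _ = - iter n signstep (- u))// iter_signstepN opprK.
- by rewrite gtr0_sg//; apply: pos => //; rewrite (le_trans (ler_norm _)).
- rewrite sgr0 (_ : (fun n => _) = cst 0); first exact: cvg_cst.
  apply/funext => n; elim: n => //= n ->.
  by rewrite /signstep expr0n mulr0 subr0 mul0r.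
Qed.

Lemma iter_signstep_norm n u : `|u| <= 1 -> `|iter n signstep u| <= 1.
Proof.
move=> u1; wlog u0 : u u1 / 0 <= u => [hw|].
  have [u0|u0] := leP 0 u; first exact: hw.
  by rewrite -normrN -iter_signstepN hw ?normrN// oppr_ge0 ltW.
have u01 : 0 <= u <= 1 by rewrite u0 (le_trans (ler_norm _)).
have [/andP[h1 h2] _] := iter_signstep_bound n u01.
by rewrite ger0_norm// (le_trans u0).
Qed.

End sign_iteration.

Section completeness.
Context (R : realType) (d : nat) (G : 'M[R]_d).
Context (nu : {measure set 'cV[R]_d -> \bar R}) (nuoo : (nu setT < +oo)%E).
Implicit Types (u v : 'cV[R]_d -> R) (E : set 'cV[R]_d).
Local Notation rappr := (rapproximable G nu).

Lemma rapproximable_iter_signstep u n : rappr u ->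
  rappr (fun x => iter n (@signstep R) (u x)).
Proof.
move=> au; elim: n => [|n ih] //=.
rewrite (_ : (fun x => _) = (fun x => 3 / 2 * iter n (@signstep R) (u x) +
  - 2^-1 * (iter n (@signstep R) (u x) *
    (iter n (@signstep R) (u x) * iter n (@signstep R) (u x))))).
  apply: rapproximableD; first by apply: rapproximableM => //; exact: rapproximable_cst.
  by do !apply: rapproximableM => //; exact: rapproximable_cst.
by apply/funext => x; rewrite /signstep; field.
Qed.

(** The indicator of the positive reals is (s^2 + s) / 2, where s is the sign,
    a bounded limit of polynomials by [iter_signstep_cvg]. *)
Lemma rapproximable_gt0 u : rappr u -> measurable_fun setT u ->
  (forall x, `|u x| <= 1) -> rappr (\1_[set x | 0 < u x]).
Proof.
move=> au mu_ u1.
have asg : rappr (fun x => Num.sg (u x)).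
  apply: (@rapproximable_lim _ _ _ _ nuoo (fun n x => iter n (@signstep R) (u x)) _ 1).
  - by move=> n; exact: rapproximable_iter_signstep.
  - apply: (measurable_fun_cvg (h := fun n x => iter n (@signstep R) (u x))) => //.
      move=> n; elim: n => [|n ih]//=.
      by apply: measurable_funM => //; apply: measurable_funB;
        [exact: measurable_funM|exact: measurable_funX].
    by move=> x _; exact: iter_signstep_cvg.
  - by move=> n x; exact: iter_signstep_norm.
  - by move=> x; rewrite normr_sg lern1 leq_b1.
  - by move=> x; exact: iter_signstep_cvg.
rewrite (_ : \1__ = fun x => 2^-1 * (Num.sg (u x) * Num.sg (u x) + Num.sg (u x))).
  by apply: rapproximableM; [exact: rapproximable_cst|
    apply: rapproximableD => //; exact: rapproximableM].
apply/funext => x; rewrite indicE; case: (ltgtP (u x) 0) => u0.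
- rewrite memNset/= ?ltr0_sg//; first by ring.
  by move=> /(lt_trans u0); rewrite ltxx.
- by rewrite mem_set//= gtr0_sg//; field.
- by rewrite memNset/= u0 ?sgr0 ?ltxx//; ring.
Qed.

(** These sets form a sigma-algebra, so that it is enough to find generators
    among the superlevel sets of characters. *)
Definition approximable_set E := measurable E /\ rappr (\1_E).

Lemma approximable_setC E : approximable_set E -> approximable_set (~` E).
Proof.
move=> [mE aE]; split; first exact: measurableC.
rewrite (_ : \1__ = fun x => 1 + -1 * \1_E x).
  apply: rapproximableD; first exact: rapproximable_cst.
  by apply: rapproximableM => //; exact: rapproximable_cst.
by apply/funext => x; rewrite !indicE in_setC; case: (x \in E) => /=; ring.
Qed.

Lemma approximable_setI E F : approximable_set E -> approximable_set F ->
  approximable_set (E `&` F).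
Proof.
move=> [mE aE] [mF aF]; split; first exact: measurableI.
rewrite (_ : \1__ = fun x => \1_E x * \1_F x); first exact: rapproximableM.
by apply/funext => x; rewrite !indicE in_setI; case: (x \in E) => /=; case: (x \in F) => /=; ring.
Qed.

Lemma approximable_setT : approximable_set setT.
Proof.
split=> //; rewrite (_ : \1__ = fun=> 1); first exact: rapproximable_cst.
by apply/funext => x; rewrite indicT.
Qed.

Lemma approximable_set0 : approximable_set set0.
Proof. by rewrite -setCT; apply: approximable_setC; exact: approximable_setT. Qed.

Lemma approximable_bigcap (F : nat -> set 'cV[R]_d) :
  (forall n, approximable_set (F n)) -> approximable_set (\bigcap_n F n).
Proof.
move=> aF; pose H n := \bigcap_(i in `I_n) F i.
have aH n : approximable_set (H n).
  elim: n => [|n ih]; first by rewrite /H II0 bigcap_set0; exact: approximable_setT.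
  rewrite (_ : H n.+1 = H n `&` F n); first exact: approximable_setI.
  rewrite /H; apply/seteqP; split => x /=.
    by move=> h; split=> [i ? |]; apply: h => //=; rewrite ltnS// ltnW.
  by move=> [h1 h2] i /=; rewrite ltnS leq_eqVlt => /predU1P[->//|/h1].
split; first by apply: bigcapT_measurable => n; exact: (aF n).1.
apply: (@rapproximable_lim _ _ _ _ nuoo (fun n => \1_(H n)) _ 1).
- by move=> n; exact: (aH n).2.
- by apply: measurable_indic; apply: bigcapT_measurable => n; exact: (aF n).1.
- by move=> n x; rewrite indicE ger0_norm// lern1 leq_b1.
- by move=> x; rewrite indicE ger0_norm// lern1 leq_b1.
move=> x; apply: cvg_near_cst; case: (pselect ((\bigcap_n F n) x)) => [Fx|nFx].
  by near=> n; rewrite !indicE !mem_set// => i _; exact: Fx.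
have [m nFm] : exists m, ~ F m x.
  by apply: contrapT => h; apply: nFx => m _; apply: contrapT => ?; apply: h; exists m.
near=> n; rewrite !indicE !memNset// => /(_ m)/= h; apply: nFm; apply: h.
by near: n; exact: nbhs_infty_gt.
Unshelve. all: by end_near. Qed.

Lemma approximable_bigcup (F : nat -> set 'cV[R]_d) :
  (forall n, approximable_set (F n)) -> approximable_set (\bigcup_n F n).
Proof.
move=> aF; rewrite -[X in approximable_set X]setCK setC_bigcup.
apply: approximable_setC; apply: approximable_bigcap => n.
by apply: approximable_setC; exact: aF.
Qed.

Lemma approximable_sigma_algebra d' (Y : measurableType d') (phi : 'cV[R]_d -> Y)
    (C : set (set Y)) : (forall B, C B -> approximable_set (phi @^-1` B)) ->
  forall B, <<s C >> B -> approximable_set (phi @^-1` B).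
Proof.
move=> aC; apply: (@smallest_sub _ _ _ [set B | approximable_set (phi @^-1` B)]).
  2: exact: aC.
split=> //=.
- by rewrite preimage_set0; exact: approximable_set0.
- by move=> A aA; rewrite setTD preimage_setC; exact: approximable_setC.
- by move=> F aF; rewrite preimage_bigcup; exact: approximable_bigcup.
Qed.

End completeness.

Section torus_coordinates.
Context (R : realType) (d : nat) (G : 'M[R]_d) (uG : G \in unitmx).
Context (nu : {measure set 'cV[R]_d -> \bar R}) (nuoo : (nu setT < +oo)%E).
Implicit Types (u v : 'cV[R]_d -> R) (E : set 'cV[R]_d) (x : 'cV[R]_d).
Local Notation appr := (approximable_set G nu).

Definition fracpart (y : R) : R := y - (Num.floor y)%:~R.

Lemma fracpart_bounds y : 0 <= fracpart y < 1.
Proof.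
rewrite /fracpart subr_ge0 ltrBlDr addrC.
by have /andP[-> ] := floor_itv y; rewrite intrD.
Qed.

Lemma expi_fracpart y : expi (2 * pi * fracpart y) = expi (2 * pi * y).
Proof.
by rewrite /fracpart mulrBr expiD expiN expi_int conjc1 mulr1.
Qed.

(** The representative of [x] modulo the lattice, in lattice coordinates. *)
Definition torus_coord x : 'cV[R]_d := \col_i fracpart ((invmx G *m x) i 0).

Lemma torus_coordE x : exists k, x = lat G k + G *m torus_coord x.
Proof.
exists (\col_i Num.floor ((invmx G *m x) i 0)).
rewrite /lat -mulmxDr -{1}(mulKVmx uG x); congr (_ *m _).
apply/matrixP => i j; rewrite ord1 [RHS]mxE /torus_coord [in RHS]mxE.
by rewrite [(\col__ _) i 0]mxE [(\col__ _) i 0]mxE /fracpart addrC subrK.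
Qed.

Lemma approximable_gtr u r : rapproximable G nu u -> measurable_fun setT u ->
  (exists M, forall x, `|u x| <= M) -> appr [set x | r < u x].
Proof.
move=> au mu_ [M uM].
(* The scaling brings u - r into [-1, 1], where the sign iteration works. *)
pose c := (`|M| + `|r| + 1)^-1.
have c0 : 0 < c by rewrite invr_gt0 ltr_wpDl// addr_ge0.
have E : [set x | r < u x] = [set x | 0 < c * (u x + - r)].
  by apply/seteqP; split => x /=; rewrite pmulr_rgt0// subr_gt0.
have mv : measurable_fun setT (fun x => c * (u x + - r)).
  by apply: measurable_funM => //; exact: measurable_funD.
rewrite E; split.
  rewrite -[X in measurable X]setTI.
  have := mv measurableT `]0, +oo[%classic (measurable_itv _).
  by rewrite (_ : _ @^-1` _ = [set x | 0 < c * (u x + - r)])//; apply/seteqP; split => x /=; rewrite in_itv/= andbT.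
apply: rapproximable_gt0 => //.
  apply: rapproximableM => //; first exact: rapproximable_cst.
  by apply: rapproximableD => //; exact: rapproximable_cst.
move=> x; rewrite normrM gtr0_norm// /c mulrC ler_pdivrMr ?mul1r; last first.
  by rewrite ltr_wpDl// addr_ge0.
rewrite (le_trans (ler_normD _ _))// normrN -addrA.
have := uM x; have := ler_norm M; lra.
Qed.

Let coord_char (i : 'I_d) : 'cV[int]_d := \col_j (i == j)%:Z.

Lemma chi_coord i x :
  chi G (coord_char i) x = expi (2 * pi * torus_coord x i 0).
Proof.
rewrite chiE mxE expi_fracpart; congr (expi (_ * _)).
rewrite /dotprod (bigD1 i)//= big1 ?addr0; last first.
  by move=> j ij; rewrite !mxE eq_sym (negPf ij) mul0r.
by rewrite !mxE eqxx mul1r.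
Qed.

Lemma approximable_cos_gt i r :
  appr [set x | r < cos (2 * pi * torus_coord x i 0)].
Proof.
rewrite (_ : [set _ | _] = [set x | r < complex.Re (chi G (coord_char i) x)]); last first.
  by apply/funext => x; rewrite /mkset chi_coord.
apply: approximable_gtr.
- exact: rapproximable_chi_Re.
- exact: (cmeasurable_chi G (coord_char i)).1.
- by exists 1 => x; rewrite (le_trans (Re_le_cmod _))// cmod_chi.
Qed.

Lemma approximable_cos_lt i r :
  appr [set x | r < - cos (2 * pi * torus_coord x i 0)].
Proof.
rewrite (_ : [set _ | _] = [set x | r < -1 * complex.Re (chi G (coord_char i) x)]); last first.
  by apply/funext => x; rewrite /mkset chi_coord mulN1r.
apply: approximable_gtr.
- by apply: rapproximableM => //; [exact: rapproximable_cst|exact: rapproximable_chi_Re].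
- by apply: measurable_funM => //; exact: (cmeasurable_chi G (coord_char i)).1.
- by exists 1 => x; rewrite mulN1r normrN (le_trans (Re_le_cmod _))// cmod_chi.
Qed.

Lemma approximable_sin_gt i r :
  appr [set x | r < - sin (2 * pi * torus_coord x i 0)].
Proof.
rewrite (_ : [set _ | _] = [set x | r < -1 * complex.Im (chi G (coord_char i) x)]); last first.
  by apply/funext => x; rewrite /mkset chi_coord mulN1r.
apply: approximable_gtr.
- by apply: rapproximableM => //; [exact: rapproximable_cst|exact: rapproximable_chi_Im].
- by apply: measurable_funM => //; exact: (cmeasurable_chi G (coord_char i)).2.
- by exists 1 => x; rewrite mulN1r normrN (le_trans (Im_le_cmod _))// cmod_chi.
Qed.

Let sin_ge0_frac (y : R) : 0 <= y < 1 -> (0 <= sin (2 * pi * y)) = (y <= 2^-1).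
Proof.
move=> /andP[y0 y1]; have pi0 := pi_gt0 R.
apply/idP/idP => [|h]; last by apply: sin_ge0_pi; apply/andP; split; nra.
apply: contraTT; rewrite -!ltNge => h.
have -> : 2 * pi * y = (2 * pi * y - pi) + pi by ring.
by rewrite sinDpi oppr_lt0; apply: sin_gt0_pi; apply/andP; split; nra.
Qed.

Let cos_lt_frac (y z : R) : 0 <= y <= 2^-1 -> 0 <= z <= 2^-1 ->
  (cos (2 * pi * z) < cos (2 * pi * y)) = (y < z).
Proof.
move=> /andP[y0 y1] /andP[z0 z1]; have pi0 := pi_gt0 R.
rewrite ltr_cos ?in_itv/=.
- by rewrite ltr_pM2l// mulr_gt0.
- by apply/andP; split; nra.
- by apply/andP; split; nra.
Qed.

Let cos_flip (y : R) : cos (2 * pi * (1 - y)) = cos (2 * pi * y).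
Proof.
rewrite (_ : 2 * pi * (1 - y) = - (2 * pi * y) + pi *+ 2); last by rewrite mulr2n; ring.
by rewrite cosD2pi cosN.
Qed.

(** Which arcs of the circle contain a point is decided by the signs of
    c - cos and of sin: on each half circle the cosine is monotone. *)
Lemma approximable_frac_lt i (b : R) : appr [set x | torus_coord x i 0 < b].
Proof.
have bd x : 0 <= torus_coord x i 0 < 1 by rewrite mxE fracpart_bounds.
have [b0|b0] := leP b 0.
  rewrite (_ : [set _ | _] = set0); first exact: approximable_set0.
  apply/seteqP; split => // x /=; have /andP[h _] := bd x.
  by move=> /(le_lt_trans h); rewrite ltNge b0.
have [b1|b1] := leP 1 b.
  rewrite (_ : [set _ | _] = setT); first exact: approximable_setT.
  by apply/seteqP; split => // x _ /=; have /andP[_ /lt_le_trans] := bd x; apply.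
have sin0 : appr [set x | 0 <= sin (2 * pi * torus_coord x i 0)].
  rewrite (_ : [set _ | _] = ~` [set x | 0 < - sin (2 * pi * torus_coord x i 0)]).
    by apply: approximable_setC; exact: approximable_sin_gt.
  apply/seteqP; split => x /=; rewrite oppr_gt0 ltNge; first by move=> ->.
  by move=> /negP; rewrite negbK.
have [b2|b2] := leP b 2^-1.
  rewrite (_ : [set _ | _] = [set x | 0 <= sin (2 * pi * torus_coord x i 0)] `&`
      [set x | cos (2 * pi * b) < cos (2 * pi * torus_coord x i 0)]).
    by apply: approximable_setI => //; exact: approximable_cos_gt.
  apply/seteqP; split => x /=; have /andP[y0 y1] := bd x.
    move=> yb; have yh : torus_coord x i 0 <= 2^-1 by rewrite (le_trans (ltW yb)).
    rewrite sin_ge0_frac// cos_lt_frac ?y0 ?yh ?b2 ?ltW//.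
  by move=> []; rewrite sin_ge0_frac// => yh; rewrite cos_lt_frac ?y0 ?yh ?b2 ?ltW.
rewrite (_ : [set _ | _] = ~` ([set x | 0 < - sin (2 * pi * torus_coord x i 0)] `&`
    ~` [set x | - cos (2 * pi * b) < - cos (2 * pi * torus_coord x i 0)])).
  apply: approximable_setC; apply: approximable_setI => //.
    exact: approximable_sin_gt.
  by apply: approximable_setC; exact: approximable_cos_lt.
apply/seteqP; split => x /=; have /andP[y0 y1] := bd x;
    rewrite oppr_gt0 ltrN2 => h.
  move=> [sx]; apply.
  have yh : 2^-1 < torus_coord x i 0 by rewrite ltNge -sin_ge0_frac ?y0// -ltNge.
  rewrite -(cos_flip b) -(cos_flip (torus_coord x i 0)) cos_lt_frac; first lra.
    by apply/andP; split; lra.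
  by apply/andP; split; lra.
rewrite ltNge; apply/negP => yb; apply: h; split.
  by rewrite ltNge sin_ge0_frac ?y0// -ltNge (lt_le_trans b2).
apply/negP; rewrite -(cos_flip b) -(cos_flip (torus_coord x i 0)) cos_lt_frac.
- by rewrite -leNgt; lra.
- by apply/andP; split; lra.
- by apply/andP; split; lra.
Qed.

Lemma approximable_coord i (B : set R) : measurable B ->
  appr ((fun x => torus_coord x i 0) @^-1` B).
Proof.
move=> mB; have {mB} : (RGenCInfty.G (R:=R)).-sigma.-measurable B.
  by rewrite -RGenCInfty.measurableE.
move: B; apply: (@approximable_sigma_algebra _ _ _ _ nuoo _ _ (fun x => torus_coord x i 0)).
move=> _ [b ->].
rewrite (_ : _ @^-1` _ = ~` [set x | torus_coord x i 0 < b]).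
  by apply: approximable_setC; exact: approximable_frac_lt.
apply/seteqP; split => x /=; rewrite in_itv/= andbT leNgt; first by move/negP.
by move/negP.
Qed.

Lemma approximable_torus (B : set 'cV[R]_d) : measurable B ->
  appr (torus_coord @^-1` B).
Proof.
apply: approximable_sigma_algebra => // U oU.
rewrite (open_bigcup_rat_box oU) preimage_bigcup.
rewrite (_ : \bigcup_(_ in _) _ = \bigcup_n (if unpickle n is Some ab then
    if `[< @rat_box R d ab `<=` U >] then torus_coord @^-1` rat_box ab
    else set0 else set0)); last first.
  apply/seteqP; split => x.
    move=> [ab /= abU abx]; exists (pickle ab) => //.
    by rewrite pickleK; case: asboolP.
  move=> [n _]; case: (unpickle n) => [ab|//]; case: asboolP => // abU abx.
  by exists ab.
apply: approximable_bigcup => // n; case: (unpickle n) => [ab|]; last exact: approximable_set0.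
case: asboolP => _; last exact: approximable_set0.
rewrite (_ : _ @^-1` _ = \bigcap_k (if insub k is Some i then
    (fun x => torus_coord x i 0) @^-1` `]ratr (ab.1 i 0), ratr (ab.2 i 0)[
    else setT)); last first.
  apply/seteqP; split => x /=.
    move=> abx k _; case: insubP => // i _ _; rewrite /= in_itv/=; exact: abx.
  by move=> abx i; have := abx i I; rewrite valK/= in_itv.
apply: approximable_bigcap => // k; case: insubP => [i _ _|_]; last exact: approximable_setT.
by apply: approximable_coord; exact: measurable_itv.
Qed.

(** A periodic set depends only on the coordinates modulo the lattice. *)
Lemma approximable_periodic E : measurable E ->
  (forall x k, E x -> E (x + lat G k)) -> appr E.
Proof.
move=> mE perE.
rewrite (_ : E = torus_coord @^-1` ((fun y => G *m y) @^-1` E)).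
  apply: approximable_torus; rewrite -[X in measurable X]setTI.
  exact: measurable_mulmx.
apply/seteqP; split => x /=; have [k xk] := torus_coordE x.
  by move=> /(perE _ (- k)); rewrite {1}xk latN addrAC subrr add0r.
by move=> /(perE _ k); rewrite addrC -xk.
Qed.

End torus_coordinates.

Import HBNNSimple.

Section packing_completeness.
Context (R : realType) (d : nat) (G : 'M[R]_d) (uG : G \in unitmx).
Context (T : set 'cV[R]_d) (pT : exact_packing G T) (mT : measurable T).
Local Notation leb := (lebesgue_cV R d).
Context (Too : (leb T < +oo)%E).
Local Notation nu := (mrestr leb mT).
Implicit Types (u v : 'cV[R]_d -> R) (E : set 'cV[R]_d) (x : 'cV[R]_d).

Lemma mrestr_lty : (nu setT < +oo)%E.
Proof. by rewrite /mrestr setTI. Qed.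

Lemma ae_mrestr (P : 'cV[R]_d -> Prop) : (forall x, T x -> P x) ->
  {ae nu, forall x, P x}.
Proof.
move=> TP; exists (~` T); split; first exact: measurableC.
  by rewrite [LHS](_ : _ = leb (~` T `&` T))// setICl measure0.
by move=> x /= nP Tx; apply: nP; exact: TP.
Qed.

(** On a set that packs with the lattice every Borel set is the trace of a
    periodic one, namely of its own periodization. *)
Lemma rapproximable_indic E : measurable E -> rapproximable G nu (\1_E).
Proof.
move=> mE; have mET : measurable (E `&` T) by exact: measurableI.
have [_ aP] : approximable_set G nu (periodization G (E `&` T)).
  apply: approximable_periodic => //.
  - exact: mrestr_lty.
  - exact: measurable_periodization.
  - by move=> x k [l El]; exists (l + k); rewrite latD opprD addrACA subrr addr0.
apply: approximable_ae aP; first exact: bm_indic.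
apply: ae_mrestr => x Tx; congr (_%:C)%C; rewrite !indicE; congr (nat_of_bool _)%:R.
apply/idP/idP; rewrite !inE /=; last by move=> Ex; exists 0; rewrite lat0 subr0.
move=> [k [Ek Tk]]; have /(pT.2 x k 0 Tk) k0 : T (x - lat G 0) by rewrite lat0 subr0.
by move: Ek; rewrite k0 lat0 subr0.
Qed.

Lemma rapproximable_bounded v (M : R) : measurable_fun setT v ->
  (forall x, `|v x| <= M) -> rapproximable G nu v.
Proof.
move=> mv vM.
have mf : measurable_fun setT (fun x => (v x + M)%:E).
  by apply/measurable_EFinP; exact: measurable_funD.
have f0 x : (0 <= (v x + M)%:E)%E.
  by rewrite lee_fin -lerBlDr sub0r; have := vM x; rewrite ler_norml => /andP[].
pose h := nnsfun_approx measurableT mf.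
have hcvg x : (fun n => h n x) @ \oo --> v x + M.
  by have /fine_cvgP[] := cvg_nnsfun_approx measurableT mf (fun x _ => f0 x) (I : setT x).
have hle n x : h n x <= v x + M.
  rewrite -(cvg_lim (@Rhausdorff R) (hcvg x)); apply: nondecreasing_cvgn_le.
    by move=> m k mk; have /lefP := nd_nnsfun_approx measurableT mf mk; apply.
  by apply/cvg_ex; exists (v x + M); exact: hcvg.
have ah n : rapproximable G nu (h n).
  rewrite (_ : (h n : _ -> _) = fun x => \sum_(y <- finmap.enum_fset (fset_set (range (h n))))
      y * \1_(h n @^-1` [set y]) x).
    apply: rapproximable_sum => y; apply: rapproximableM; last exact: rapproximable_indic.
    exact: rapproximable_cst.
  by apply/funext => x; rewrite fimfunE fsbig_finite.
have av : rapproximable G nu (fun x => v x + M).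
  apply: (@rapproximable_lim _ _ _ _ mrestr_lty (fun n x => h n x) _ (M + M)) => //.
  - by apply: measurable_funD.
  - move=> n x; rewrite ger0_norm// (le_trans (hle n x))// lerD2r.
    by rewrite (le_trans (ler_norm _)).
  - move=> x; rewrite ger0_norm -?lee_fin// lee_fin lerD2r.
    by rewrite (le_trans (ler_norm _)).
rewrite (_ : v = fun x => (v x + M) + - M).
  by apply: rapproximableD => //; exact: rapproximable_cst.
by apply/funext => x; rewrite addrK.
Unshelve. all: by end_near. Qed.

Lemma approximable_bm f : bm f -> approximable G nu f.
Proof.
move=> [mf [M fM]].
have ar : rapproximable G nu (fun x => complex.Re (f x)).
  apply: (rapproximable_bounded (M := M) mf.1) => x.
  exact: le_trans (Re_le_cmod _) (fM x).
have ai : rapproximable G nu (fun x => complex.Im (f x)).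
  apply: (rapproximable_bounded (M := M) mf.2) => x.
  exact: le_trans (Im_le_cmod _) (fM x).
have aI : approximable G nu (fun=> Complex 0 1).
  rewrite (_ : (fun=> _) = trigpoly G [:: (Complex 0 1, 0)]).
    exact: approximable_trigpoly.
  by apply/funext => x; rewrite /trigpoly big_seq1 chi0 mulr1.
have := approximableD ar (approximableM aI ai).
rewrite (_ : (fun x => _) = f)//.
by apply/funext => x; apply: complex_ext; rewrite !ReIm_simp/=; ring.
Qed.

End packing_completeness.

(** * Parseval's identity on a fundamental domain *)

Section parseval.
Context (R : realType) (d : nat) (G : 'M[R]_d) (uG : G \in unitmx).
Context (T : set 'cV[R]_d) (fT : fundom G T) (mT : measurable T).
Local Notation leb := (lebesgue_cV R d).
Context (Too : (leb T < +oo)%E) (T0 : (0 < leb T)%E).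
Local Notation nu := (mrestr leb mT).
Implicit Types (f g : 'cV[R]_d -> R[i]) (k : 'cV[int]_d).

Let nuoo : (nu setT < +oo)%E := mrestr_lty mT Too.
Let vol := fine (leb T).

Let volE : vol%:E = leb T.
Proof. by rewrite fineK// ge0_fin_numE. Qed.

Let vol_gt0 : 0 < vol.
Proof. by rewrite -lte_fin volE. Qed.

Definition fcoef f k : R[i] := cintegral nu (fun x => f x * conjc (chi G k x)).

Let renergy f : R := \int[nu]_x (cmod (f x) ^+ 2).

Let integrable_bm2 f : bm f -> nu.-integrable setT (EFin \o (fun x => cmod (f x) ^+ 2)).
Proof.
move=> [mf [M fM]]; apply: (integral_bounded_lty (M := M ^+ 2) nuoo).
  exact: measurable_cmod2.
move=> x; rewrite ger0_norm ?sqr_ge0// ler_pXn2r ?nnegrE ?cmod_ge0//.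
exact: le_trans (cmod_ge0 _) (fM x).
Qed.

Let renergyE f : bm f -> energy nu f = (renergy f)%:E.
Proof.
move=> bf; rewrite /renergy /Rintegral fineK//.
exact: integrable_fin_num (integrable_bm2 bf).
Qed.

Let fcoef_bm f k : bm f -> in_L1 nu (fun x => f x * conjc (chi G k x)).
Proof.
by move=> bf; apply: bm_in_L1 => //; apply: bmM => //; apply: bm_conj; exact: bm_chi.
Qed.

Let fcoef_sub f a k l : bm f -> k <> l ->
  fcoef (fun x => f x - a * chi G k x) l = fcoef f l.
Proof.
move=> bf kl; rewrite /fcoef.
rewrite (_ : (fun x => _) = (fun x => f x * conjc (chi G l x) -
    a * chi G (k - l) x)); last first.
  by apply/funext => x; rewrite chi_add chi_opp; ring.
have ichi m : in_L1 nu (chi G m) by apply: bm_in_L1 => //; exact: bm_chi.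
rewrite cintegralB ?cintegralZ//; last 2 first.
- exact: fcoef_bm.
- exact: in_L1Z.
rewrite (cintegral_chi fT)// ?mulr0 ?subr0//.
by move=> /eqP; rewrite subr_eq0 => /eqP.
Qed.

Let renergy_sub f a k : bm f -> renergy (fun x => f x - a * chi G k x) =
  renergy f + (vol * cmod a ^+ 2 - 2 * complex.Re (conjc a * fcoef f k)).
Proof.
move=> bf; rewrite /renergy.
have E x : cmod (f x - a * chi G k x) ^+ 2 = cmod (f x) ^+ 2 +
    (cmod a ^+ 2 - 2 * complex.Re (conjc a * (f x * conjc (chi G k x)))).
  rewrite cmod2_sub cmodM cmod_chi mulr1 conjM.
  rewrite (_ : f x * (_ * _) = conjc a * (f x * conjc (chi G k x))); last by ring.
  by ring.
under eq_Rintegral do rewrite E.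
have i1 := integrable_bm2 bf.
have icst (c : R) : nu.-integrable setT (EFin \o (fun=> c)).
  by apply: (integral_bounded_lty (M := `|c|)) => //; exact: measurable_cst.
have f1 := in_L1Z (conjc a) (fcoef_bm k bf).
have i3 := in_L1_Re f1.
have i4 : nu.-integrable setT (EFin \o (fun x =>
    2 * complex.Re (conjc a * (f x * conjc (chi G k x))))).
  by have := integrableZl measurableT 2 i3; apply: eq_integrable.
have i5 : nu.-integrable setT (EFin \o (fun x => cmod a ^+ 2 -
    2 * complex.Re (conjc a * (f x * conjc (chi G k x))))).
  by have := integrableB measurableT (icst (cmod a ^+ 2)) i4; apply: eq_integrable.
have -> : complex.Re (conjc a * fcoef f k) =
    \int[nu]_x complex.Re (conjc a * (f x * conjc (chi G k x))).
  by rewrite -(cintegralZ _ (fcoef_bm k bf)).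
rewrite RintegralD// RintegralB// Rintegral_cst// RintegralZl//.
congr (_ + (_ - _)); rewrite mulrC; congr (fine _ * _).
by rewrite [LHS](_ : _ = leb (setT `&` T))// setTI.
Qed.

Let renergy_poly f (a : 'cV[int]_d -> R[i]) (s : seq 'cV[int]_d) : bm f -> uniq s ->
  renergy (fun x => f x - \sum_(k <- s) a k * chi G k x) =
  renergy f + \sum_(k <- s)
    (vol * cmod (a k) ^+ 2 - 2 * complex.Re (conjc (a k) * fcoef f k)).
Proof.
elim: s f => [|k s ih] f bf /=.
  move=> _; rewrite big_nil addr0; congr renergy.
  by apply/funext => x; rewrite big_nil subr0.
move=> /andP[ks us]; rewrite big_cons addrA -renergy_sub//.
have bfk : bm (fun x => f x - a k * chi G k x).
  by apply: bmB => //; apply: bmZ; exact: bm_chi.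
rewrite (_ : (fun x => _) = (fun x => (f x - a k * chi G k x) -
    \sum_(j <- s) a j * chi G j x)); last first.
  by apply/funext => x; rewrite big_cons opprD addrA.
rewrite ih//; congr (_ + _); apply: eq_big_seq => j js.
by rewrite fcoef_sub// => kj; move: ks; rewrite kj js.
Qed.

(** Completing the square: among trigonometric polynomials with frequencies in
    s, the deviation from f is smallest for the Fourier coefficients. *)
Let renergy_poly_ge f a s : bm f -> uniq s ->
  renergy f - vol^-1 * \sum_(k <- s) cmod (fcoef f k) ^+ 2 <=
  renergy (fun x => f x - \sum_(k <- s) a k * chi G k x).
Proof.
move=> bf us; rewrite renergy_poly// lerD2l mulr_sumr -sumrN.
apply: ler_sum => k _; rewrite !cmod2E !ReIm_simp.
set p := complex.Re (a k); set q := complex.Im (a k).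
set r := complex.Re (fcoef f k); set t := complex.Im (fcoef f k).
rewrite -subr_ge0 (_ : _ - _ = vol * ((p - r / vol) ^+ 2 + (q - t / vol) ^+ 2)).
  by rewrite (mulr_ge0 (ltW vol_gt0))// addr_ge0 ?sqr_ge0.
by field; rewrite gt_eqF.
Qed.

Let bessel f s : bm f -> uniq s ->
  \sum_(k <- s) cmod (fcoef f k) ^+ 2 <= vol * renergy f.
Proof.
move=> bf us.
have : 0 <= renergy (fun x => f x - \sum_(k <- s) ((vol^-1)%:C)%C * fcoef f k * chi G k x).
  by apply: Rintegral_ge0 => x _; rewrite sqr_ge0.
rewrite renergy_poly//.
rewrite (_ : \sum_(k <- s) _ = - (vol^-1 * \sum_(k <- s) cmod (fcoef f k) ^+ 2)).
  by rewrite subr_ge0 ler_pdivrMl.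
rewrite mulr_sumr -sumrN; apply: eq_bigr => k _.
rewrite !cmod2E !ReIm_simp.
set r := complex.Re (fcoef f k); set t := complex.Im (fcoef f k).
by rewrite /=; field; rewrite gt_eqF.
Qed.

Lemma energy_chi_sum (a : 'cV[int]_d -> R[i]) (s : seq 'cV[int]_d) : uniq s ->
  energy nu (fun x => \sum_(k <- s) a k * chi G k x) =
  (leb T * (\sum_(k <- s) cmod (a k) ^+ 2)%:E)%E.
Proof.
move=> us; have b0 : bm (fun _ : 'cV[R]_d => 0 : R[i]) by exact: bm_cst.
have bs : bm (fun x => 0 - \sum_(k <- s) a k * chi G k x).
  by apply: bmB => //; apply: bm_sum => k; apply: bmZ; exact: bm_chi.
rewrite -energyN (_ : (fun x => _) = (fun x => 0 - \sum_(k <- s) a k * chi G k x)).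
  rewrite renergyE// renergy_poly// -volE -EFinM; congr EFin.
  rewrite {1}/renergy; under eq_Rintegral do rewrite cmod0 expr0n.
  rewrite Rintegral_cst// mul0r add0r mulr_sumr; apply: eq_bigr => k _.
  rewrite (_ : fcoef _ _ = 0) ?mulr0 ?subr0//.
  by rewrite /fcoef; under eq_fun do rewrite mul0r; exact: cintegral0.
by apply/funext => x; rewrite sub0r.
Qed.

(** Bessel's inequality and its converse. The converse holds because f is
    approximated by trigonometric polynomials ([approximable_bm]) and its
    partial Fourier sums approximate it at least as well. *)
Theorem parseval_bm f : bm f ->
  csum (fun k => (cmod (fcoef f k) ^+ 2)%:E) = (leb T * energy nu f)%E.
Proof.
move=> bf; rewrite renergyE// -volE -EFinM.
apply/eqP; rewrite eq_le; apply/andP; split.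
  apply: csum_fin_sup => [k|s us]; first by rewrite lee_fin sqr_ge0.
  by rewrite sumEFin lee_fin bessel.
have C0 : (0 <= csum (fun k => (cmod (fcoef f k) ^+ 2)%:E))%E.
  by apply: csum_ge0 => k; rewrite lee_fin sqr_ge0.
apply/lee_addgt0Pr => e e0.
have ev : 0 < e / vol by rewrite divr_gt0.
have [_ /(_ _ ev)[s]] := approximable_bm uG fT.1 mT Too bf.
(* Collect the coefficients of equal characters. *)
set K := undup [seq p.2 | p <- s].
pose a k := \sum_(p <- s | p.2 == k) p.1.
have -> : (fun x => f x - trigpoly G s x) =
    (fun x => f x - \sum_(k <- K) a k * chi G k x).
  apply/funext => x; congr (_ - _); rewrite /trigpoly.
  transitivity (\sum_(k <- K) \sum_(p <- s | p.2 == k) p.1 * chi G p.2 x).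
    rewrite (exchange_big_dep predT)//=; apply: eq_big_seq => p ps.
    rewrite (eq_bigl (pred1 p.2)) => [|k]; last by rewrite /= eq_sym.
    rewrite -big_filter filter_pred1_uniq ?undup_uniq ?big_seq1//.
    by rewrite mem_undup map_f.
  by apply: eq_bigr => k _; rewrite big_distrl; apply: eq_bigr => p /eqP ->.
have bK : bm (fun x => f x - \sum_(k <- K) a k * chi G k x).
  by apply: bmB => //; apply: bm_sum => k; apply: bmZ; exact: bm_chi.
rewrite renergyE// lte_fin => he.
have := renergy_poly_ge a bf (undup_uniq [seq p.2 | p <- s]); rewrite -/K => hge.
apply: (@le_trans _ _ ((\sum_(k <- K) cmod (fcoef f k) ^+ 2)%:E + e%:E)%E).
  rewrite -EFinD lee_fin; move: (le_lt_trans hge he).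
  rewrite ltrBlDr -(ltr_pM2l vol_gt0) mulrDr mulrCA mulfV ?gt_eqF// mulr1.
  by rewrite mulrA mulfV ?gt_eqF// mul1r addrC => /ltW.
apply: leeD => //; rewrite -sumEFin; apply: csum_ge_fin; last exact: undup_uniq.
by move=> k; rewrite lee_fin sqr_ge0.
Qed.

End parseval.

(** * Limits in the square mean *)

Section square_mean_limits.
Context d (X : measurableType d) (R : realType).
Implicit Types (nu : {measure set X -> \bar R}) (f g : X -> R[i]).

Lemma cmod_dist (z w : R[i]) : `|cmod z - cmod w| <= cmod (z - w).
Proof.
rewrite ler_norml; apply/andP; split.
  rewrite lerNl opprB lerBlDr -(cmodN (z - w)) opprB.
  by rewrite -[in leLHS](subrK z w) cmodD.
by rewrite lerBlDr -[in leLHS](subrK w z) cmodD.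
Qed.

Lemma cvg_cmod2 (g_ : nat -> R[i]) (g : R[i]) :
  (fun n => cmod (g_ n - g)) @ \oo --> (0 : R) ->
  (fun n => (cmod (g_ n) ^+ 2)%:E) @ \oo --> (cmod g ^+ 2)%:E.
Proof.
move=> gg; have c : (fun n => cmod (g_ n)) @ \oo --> cmod g.
  apply/cvgrPdist_le => e e0; move/cvgr0_norm_le : gg => /(_ _ e0).
  apply: filterS => n h; rewrite distrC (le_trans (cmod_dist _ _))//.
  by rewrite (le_trans (ler_norm _)).
apply: cvg_EFin; first by near=> n.
rewrite (_ : _ \o _ = (fun n => cmod (g_ n) * cmod (g_ n))).
  by rewrite expr2; exact: cvgM.
by apply/funext => n /=; rewrite expr2.
Unshelve. all: by end_near. Qed.

(** Fatou's lemma, in the form in which it passes bounds to limits. *)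
Lemma energy_fatou nu (g_ : nat -> X -> R[i]) g (b : \bar R) :
  (forall n, cmeasurable (g_ n)) -> cmeasurable g ->
  {ae nu, forall x, (fun n => cmod (g_ n x - g x)) @ \oo --> (0 : R)} ->
  (forall n, energy nu (g_ n) <= b)%E -> (energy nu g <= b)%E.
Proof.
move=> mg_ mg gg gb.
have m n := emeasurable_cmod2 (mg_ n).
have p n (x : X) : setT x -> (0 <= (cmod (g_ n x) ^+ 2)%:E)%E.
  by move=> _; rewrite lee_fin sqr_ge0.
apply: (@le_trans _ _ (\int[nu]_x limn_einf (fun n => (cmod (g_ n x) ^+ 2)%:E))%E).
  apply: ae_ge0_le_integral => //.
  - by move=> x _; rewrite lee_fin sqr_ge0.
  - exact: emeasurable_cmod2.
  - move=> x _; rewrite limn_einf_lim; apply: lime_ge; first exact: is_cvg_einfs.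
    by near=> n; apply: le_ereal_inf_tmp => _ [k /= _ <-]; rewrite lee_fin sqr_ge0.
  - under eq_fun do rewrite -[limn_einf _]oppeK -limn_esupN.
    apply: measurableT_comp => //; apply: measurable_fun_limn_esup => n.
    exact: measurableT_comp.
  - apply: filterS gg => x gx _.
    by have [-> _] := cvg_limn_einf_sup (cvg_cmod2 gx).
apply: le_trans (fatou nu measurableT m p) _.
rewrite limn_einf_lim; apply: lime_le; first exact: is_cvg_einfs.
near=> n; apply: (@le_trans _ _ (energy nu (g_ n))); last exact: gb.
by apply: ereal_inf_lbound; exists n => /=.
Unshelve. all: by end_near. Qed.

(** A quadratic substitute for the triangle inequality: letting e tend to 0
    after w loses nothing in the limit. *)
Lemma cmod2D_delta (z w : R[i]) (e : R) : 0 < e ->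
  cmod (z + w) ^+ 2 <= (1 + e) * cmod z ^+ 2 + (1 + e^-1) * cmod w ^+ 2.
Proof.
move=> e0; rewrite !cmod2E !ReIm_simp.
set a := complex.Re z; set b := complex.Im z.
set c := complex.Re w; set h := complex.Im w.
rewrite -subr_ge0 (_ : _ - _ = e^-1 * ((e * a - c) ^+ 2 + (e * b - h) ^+ 2)).
  by rewrite mulr_ge0 ?invr_ge0 ?(ltW e0)// addr_ge0 ?sqr_ge0.
by field; rewrite gt_eqF.
Qed.

Lemma energyD_delta nu f g (e : R) : 0 < e -> cmeasurable f -> cmeasurable g ->
  (energy nu (fun x => f x + g x)%R <=
   (1 + e)%:E * energy nu f + (1 + e^-1)%:E * energy nu g)%E.
Proof.
move=> e0 mf mg; have mfg := cmeasurableD mf mg.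
have e1 : 0 <= 1 + e by rewrite addr_ge0// ltW.
have e2 : 0 <= 1 + e^-1 by rewrite addr_ge0// invr_ge0 ltW.
have p (h : X -> R[i]) x : (0 <= (cmod (h x) ^+ 2)%:E)%E by rewrite lee_fin sqr_ge0.
rewrite /energy -!ge0_integralZl_EFin//; do ?exact: emeasurable_cmod2.
rewrite -ge0_integralD//.
- apply: ge0_le_integral => //.
  + by move=> x _; rewrite lee_fin sqr_ge0.
  + exact: emeasurable_cmod2.
  + by apply: emeasurable_funD; apply: measurable_funeM; exact: emeasurable_cmod2.
  + by move=> x _; rewrite -!EFinM -EFinD lee_fin cmod2D_delta.
- by move=> x _; rewrite -EFinM lee_fin mulr_ge0// sqr_ge0.
- by apply: measurable_funeM; exact: emeasurable_cmod2.
- by move=> x _; rewrite -EFinM lee_fin mulr_ge0// sqr_ge0.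
- by apply: measurable_funeM; exact: emeasurable_cmod2.
Qed.

Lemma le_delta_limit (x y : \bar R) (x_ y_ z_ : nat -> \bar R) : (0 <= y)%E ->
  x_ @ \oo --> x -> y_ @ \oo --> y -> z_ @ \oo --> 0%E ->
  (forall (e : R) n, (0 < e)%R ->
    x_ n <= (1 + e)%:E * y_ n + (1 + e^-1)%:E * z_ n)%E -> (x <= y)%E.
Proof.
move=> y0 xx yy zz h; have [->|yoo] := eqVneq y +oo%E; first by rewrite leey.
have yfin : y \is a fin_num by rewrite ge0_fin_numE// ltey.
apply/lee_addgt0Pr => eps eps0.
have fy0 : 0 <= fine y by rewrite fine_ge0.
pose e := eps / 2 / (fine y + 1).
have e0 : 0 < e by rewrite !divr_gt0// ltr_wpDl.
have ei0 : 0 < e^-1 by rewrite invr_gt0.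
pose eta := eps / 2 / ((1 + e) + (1 + e^-1)).
have s0 : 0 < (1 + e) + (1 + e^-1) by rewrite !addr_gt0.
have eta0 : 0 < eta by rewrite !divr_gt0.
have yeta : (y < y + eta%:E)%E by rewrite lteDl// lte_fin.
have eta0' : (0 < eta%:E :> \bar R)%E by rewrite lte_fin.
rewrite -(cvg_lim (@ereal_hausdorff R) xx); apply: lime_le.
  by apply/cvg_ex; exists x.
apply: filterS2 (ecvg_lt_near yy yeta) (ecvg_lt_near zz eta0') => n yn zn.
apply: le_trans (h e n e0) _.
apply: (@le_trans _ _ ((1 + e)%:E * (y + eta%:E) + (1 + e^-1)%:E * eta%:E)%E).
  by apply: leeD; apply: lee_wpmul2l; rewrite ?lee_fin ?addr_ge0 ?ltW.
have yE : y = (fine y)%:E by rewrite fineK.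
rewrite yE.
change (((1 + e) * (fine y + eta) + (1 + e^-1) * eta)%:E <= (fine y + eps)%:E)%E.
rewrite lee_fin.
have -> : (1 + e) * (fine y + eta) + (1 + e^-1) * eta =
    fine y + e * fine y + eta * ((1 + e) + (1 + e^-1)) by ring.
rewrite /eta mulfVK ?gt_eqF// -addrA lerD2l.
rewrite [leRHS](_ : eps = eps / 2 + eps / 2); last by field.
by rewrite lerD2r /e mulrAC ler_pdivrMr ?ltr_wpDl// ler_wpM2l ?lerDl// divr_ge0 ?ltW.
Qed.

(** Both inequalities come from [energyD_delta], applied to g = g_n + (g - g_n)
    and to g_n = g + (g_n - g). *)
Lemma energy_lim nu (g_ : nat -> X -> R[i]) g (a : \bar R) :
  (forall n, cmeasurable (g_ n)) -> cmeasurable g ->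
  (fun n => energy nu (fun x => g_ n x - g x)%R) @ \oo --> 0%E ->
  (fun n => energy nu (g_ n)) @ \oo --> a -> (energy nu g = a)%E.
Proof.
move=> mg_ mg gg ga.
have md n : cmeasurable (fun x => g_ n x - g x) by exact: cmeasurableB.
have md' n : cmeasurable (fun x => g x - g_ n x) by exact: cmeasurableB.
have a0 : (0 <= a)%E.
  rewrite -(cvg_lim (@ereal_hausdorff R) ga); apply: lime_ge.
    by apply/cvg_ex; exists a.
  by near=> n; exact: energy_ge0.
apply/eqP; rewrite eq_le; apply/andP; split.
  apply: (le_delta_limit a0 (cvg_cst (energy nu g)) ga gg) => e n e0.
  rewrite energy_subC.
  rewrite [X in (energy nu X <= _)%E](_ : g = (fun x => g_ n x + (g x - g_ n x))).
    exact: energyD_delta.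
  by apply/funext => x; ring.
apply: (le_delta_limit (energy_ge0 _ _) ga (cvg_cst (energy nu g)) gg) => e n e0.
rewrite [X in (energy nu X <= _)%E](_ : _ = (fun x => g x + (g_ n x - g x))).
  exact: energyD_delta.
by apply/funext => x; ring.
Unshelve. all: by end_near. Qed.

Section truncation.
Context (f : X -> R[i]) (B : nat -> set X).
Hypothesis mf : cmeasurable f.
Hypothesis mB : forall n, measurable (B n).
Hypothesis Bf : forall x, f x != 0 -> \forall n \near \oo, B n x.

(** The sets B n of this section exhaust the support of f: every point where f
    does not vanish belongs to all B n from some rank on. *)
Definition trunc (A : set X) x : R[i] := f x * ((\1_A x : R)%:C)%C.

Lemma cmeasurable_trunc A : measurable A -> cmeasurable (trunc A).
Proof. by move=> mA; apply: cmeasurableM => //; exact: cmeasurable_indic. Qed.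

Lemma cmod_trunc_le A x : cmod (trunc A x) <= cmod (f x).
Proof.
rewrite cmodM cmod_real indicE; case: (x \in A).
  by rewrite normr1 mulr1.
by rewrite normr0 mulr0 cmod_ge0.
Qed.

Lemma cmod_trunc_sub_le A x : cmod (trunc A x - f x) <= cmod (f x).
Proof.
rewrite /trunc indicE; case: (x \in A); first by rewrite mulr1 subrr cmod0 cmod_ge0.
by rewrite mulr0 sub0r cmodN.
Qed.

Lemma trunc_near x : \forall n \near \oo, trunc (B n) x = f x.
Proof.
have [fx0|fx0] := eqVneq (f x) 0.
  by near=> n; rewrite /trunc fx0 mul0r.
by apply: filterS (Bf fx0) => n Bx; rewrite /trunc indicE mem_set// mulr1.
Unshelve. all: by end_near. Qed.

Lemma trunc_energy_cvg0 nu : (energy nu f < +oo)%E ->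
  (fun n => energy nu (fun x => trunc (B n) x - f x)%R) @ \oo --> 0%E.
Proof.
move=> foo; have mt n := cmeasurable_trunc (mB n).
have [] := @dominated_convergence _ X R nu setT measurableT
  (fun n x => (cmod (trunc (B n) x - f x) ^+ 2)%:E) (cst 0%E)
  (fun x => (cmod (f x) ^+ 2)%:E).
- by move=> n; apply: emeasurable_cmod2; exact: cmeasurableB.
- exact: measurable_cst.
- apply: aeW => x _; apply: cvg_near_cst.
  by apply: filterS (trunc_near x) => n ->; rewrite subrr cmod0 expr0n.
- apply/integrableP; split; first exact: emeasurable_cmod2.
  by under eq_integral do rewrite gee0_abs ?lee_fin ?sqr_ge0//.
- apply: aeW => x n _; rewrite /= lee_fin ger0_norm ?sqr_ge0//.
  by rewrite ler_pXn2r ?nnegrE ?cmod_ge0// cmod_trunc_sub_le.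
move=> _ _; rewrite integral0; exact.
Qed.

Lemma trunc_energy_cvg nu : (energy nu f < +oo)%E ->
  (fun n => energy nu (trunc (B n))) @ \oo --> energy nu f.
Proof.
move=> foo; have mt n := cmeasurable_trunc (mB n).
have [] := @dominated_convergence _ X R nu setT measurableT
  (fun n x => (cmod (trunc (B n) x) ^+ 2)%:E) (fun x => (cmod (f x) ^+ 2)%:E)
  (fun x => (cmod (f x) ^+ 2)%:E).
- by move=> n; apply: emeasurable_cmod2.
- exact: emeasurable_cmod2.
- apply: aeW => x _; apply: cvg_near_cst.
  by apply: filterS (trunc_near x) => n ->.
- apply/integrableP; split; first exact: emeasurable_cmod2.
  by under eq_integral do rewrite gee0_abs ?lee_fin ?sqr_ge0//.
- apply: aeW => x n _; rewrite /= lee_fin ger0_norm ?sqr_ge0//.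
  by rewrite ler_pXn2r ?nnegrE ?cmod_ge0// cmod_trunc_le.
by move=> _ _; exact.
Qed.

Lemma trunc_L1_cvg0 nu : in_L1 nu f ->
  (fun n => \int[nu]_x (cmod (trunc (B n) x - f x)%R)%:E)%E @ \oo --> 0%E.
Proof.
move=> [_ foo]; have mt n := cmeasurable_trunc (mB n).
have [] := @dominated_convergence _ X R nu setT measurableT
  (fun n x => (cmod (trunc (B n) x - f x))%:E) (cst 0%E) (fun x => (cmod (f x))%:E).
- by move=> n; apply: emeasurable_cmod; exact: cmeasurableB.
- exact: measurable_cst.
- apply: aeW => x _; apply: cvg_near_cst.
  by apply: filterS (trunc_near x) => n ->; rewrite subrr cmod0.
- apply/integrableP; split; first exact: emeasurable_cmod.
  by under eq_integral do rewrite gee0_abs ?lee_fin ?cmod_ge0//.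
- apply: aeW => x n _; rewrite /= lee_fin ger0_norm ?cmod_ge0//.
  exact: cmod_trunc_sub_le.
move=> _ _; rewrite integral0; exact.
Qed.

End truncation.

Lemma in_L2_energy nu f : in_L2 nu f <-> cmeasurable f /\ (energy nu f < +oo)%E.
Proof. by []. Qed.

Lemma in_L2_B nu f g : in_L2 nu f -> in_L2 nu g -> in_L2 nu (fun x => f x - g x).
Proof.
move=> [mf foo] [mg goo]; split; first exact: cmeasurableB.
have mg' := cmeasurableN mg.
apply: le_lt_trans (energyD nu mf mg') _; rewrite energyN.
by rewrite lte_add_pinfty// lte_mul_pinfty// lee_fin.
Qed.

(** On A, |f| is at most 1 + |f|^2. *)
Lemma in_L2_L1 nu f (A : set X) : measurable A -> (nu A < +oo)%E ->
  in_L2 nu f -> (forall x, ~ A x -> f x = 0) -> in_L1 nu f.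
Proof.
move=> mA Aoo [mf foo] fA; split=> //.
apply: (@le_lt_trans _ _ (\int[nu]_x ((\1_A x)%:E + (cmod (f x) ^+ 2)%:E))%E).
  apply: ge0_le_integral => //.
  - by move=> x _; rewrite lee_fin cmod_ge0.
  - exact: emeasurable_cmod.
  - apply: emeasurable_funD; last exact: emeasurable_cmod2.
    by apply/measurable_EFinP; exact: measurable_indic.
  - move=> x _; rewrite -EFinD lee_fin indicE.
    have [xA|xA] := pselect (A x).
      by rewrite mem_set//= ; have := sqr_ge0 (cmod (f x) - 1 / 2); nra.
    by rewrite fA// cmod0 expr0n addr0 ler0n.
rewrite ge0_integralD//.
- by rewrite integral_indic// setIT lte_add_pinfty.
- by apply/measurable_EFinP; exact: measurable_indic.
- by move=> x _; rewrite lee_fin sqr_ge0.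
- exact: emeasurable_cmod2.
Qed.

Lemma cintegral_cvg nu (f_ : nat -> X -> R[i]) f :
  (forall n, in_L1 nu (f_ n)) -> in_L1 nu f ->
  (fun n => \int[nu]_x (cmod (f_ n x - f x)%R)%:E)%E @ \oo --> 0%E ->
  (fun n => cmod (cintegral nu (f_ n) - cintegral nu f)) @ \oo --> (0 : R).
Proof.
move=> f_1 f1 cf; have d1 n : in_L1 nu (fun x => f_ n x - f x) by exact: in_L1B.
apply/cvgr0Pnorm_lt => e e0.
have e0' : (0 < e%:E :> \bar R)%E by rewrite lte_fin.
apply: filterS (ecvg_lt_near cf e0') => n h.
rewrite ger0_norm ?cmod_ge0// -lte_fin; apply: le_lt_trans h.
by rewrite -cintegralB//; exact: cmod_cintegral.
Qed.

Lemma integral_mrestr_signed nu (D : set X) (mD : measurable D) (f : X -> \bar R) :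
  measurable_fun setT f ->
  (\int[mrestr nu mD]_x f x = \int[nu]_(x in D) f x)%E.
Proof.
move=> mf; rewrite [LHS]integralE [RHS]integralE; congr (_ - _)%E.
  by apply: integral_mrestr => //; exact: measurable_funepos.
by apply: integral_mrestr => //; exact: measurable_funeneg.
Qed.

Lemma cintegral_mrestr nu (D : set X) (mD : measurable D) f :
  cmeasurable f -> (forall x, ~ D x -> f x = 0) ->
  cintegral (mrestr nu mD) f = cintegral nu f.
Proof.
move=> mf fD; apply: complex_ext => /=; rewrite /Rintegral; congr fine.
  rewrite integral_mrestr_signed; last by apply/measurable_EFinP; exact: mf.1.
  rewrite integral_mkcond; apply: eq_integral => x _; rewrite patchE.
  by case: ifPn => //; rewrite notin_setE => /fD ->.
rewrite integral_mrestr_signed; last by apply/measurable_EFinP; exact: mf.2.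
rewrite integral_mkcond; apply: eq_integral => x _; rewrite patchE.
by case: ifPn => //; rewrite notin_setE => /fD ->.
Qed.

Lemma energy_mrestr nu (D : set X) (mD : measurable D) f : cmeasurable f ->
  energy (mrestr nu mD) f = (\int[nu]_x ((cmod (f x) ^+ 2)%:E * (\1_D x)%:E))%E.
Proof.
move=> mf; rewrite /energy integral_mrestr.
- exact: integral_indicM.
- exact: emeasurable_cmod2.
- by move=> x; rewrite lee_fin sqr_ge0.
Qed.

Lemma energy_mrestr_supp nu (D : set X) (mD : measurable D) f : cmeasurable f ->
  (forall x, ~ D x -> f x = 0) -> energy (mrestr nu mD) f = energy nu f.
Proof.
move=> mf fD; rewrite energy_mrestr//; apply: eq_integral => x _.
rewrite indicE; have [xD|xD] := pselect (D x); first by rewrite mem_set// mule1.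
by rewrite fD// cmod0 expr0n mul0e.
Qed.

End square_mean_limits.

Section fourier_basics.
Context (R : realType) (d : nat).
Local Notation leb := (lebesgue_cV R d).
Implicit Types (f g : 'cV[R]_d -> R[i]) (t x v : 'cV[R]_d).

Lemma integral_translate_signed v (f : 'cV[R]_d -> \bar R) :
  measurable_fun setT f -> (\int[leb]_x f (x + v)%R = \int[leb]_x f x)%E.
Proof.
move=> mf; rewrite [LHS]integralE [RHS]integralE.
have mp : measurable_fun setT (f^\+)%E by exact: measurable_funepos.
have mn : measurable_fun setT (f^\-)%E by exact: measurable_funeneg.
rewrite -(lebesgue_cV_translate v mp (funepos_ge0 f)).
rewrite -(lebesgue_cV_translate v mn (funeneg_ge0 f)).
by congr (_ - _)%E; apply: eq_integral => x _; rewrite ?funeposE ?funenegE.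
Qed.

Lemma cintegral_translate v f : cmeasurable f ->
  cintegral leb (fun x => f (x + v)) = cintegral leb f.
Proof.
move=> mf; apply: complex_ext => /=; rewrite /Rintegral; congr fine.
  apply: (integral_translate_signed v (f := fun x => (complex.Re (f x))%:E)).
  by apply/measurable_EFinP; exact: mf.1.
apply: (integral_translate_signed v (f := fun x => (complex.Im (f x))%:E)).
by apply/measurable_EFinP; exact: mf.2.
Qed.

Lemma cmeasurable_translate v f : cmeasurable f -> cmeasurable (fun x => f (x + v)).
Proof.
move=> [f1 f2]; split.
  exact: (measurable_fun_translate (f := fun x => complex.Re (f x)) v f1).
exact: (measurable_fun_translate (f := fun x => complex.Im (f x)) v f2).
Qed.

Lemma energy_translate v f : cmeasurable f ->
  energy leb (fun x => f (x + v)) = energy leb f.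
Proof.
move=> mf; apply: (lebesgue_cV_translate v (f := fun x => (cmod (f x) ^+ 2)%:E)).
  exact: emeasurable_cmod2.
by move=> x; rewrite lee_fin sqr_ge0.
Qed.

Lemma in_L1_translate v f : in_L1 leb f -> in_L1 leb (fun x => f (x + v)).
Proof.
move=> [mf foo]; split; first exact: cmeasurable_translate.
rewrite (lebesgue_cV_translate v (f := fun x => (cmod (f x))%:E))//.
  exact: emeasurable_cmod.
by move=> x; rewrite lee_fin cmod_ge0.
Qed.

Definition ekern t x : R[i] := expi (- (2 * pi * dotprod t x)).

Lemma fourierE f t : fourier f t = cintegral leb (fun x => f x * ekern t x).
Proof. by []. Qed.

Lemma cmod_ekern t x : cmod (ekern t x) = 1.
Proof. exact: cmod_expi. Qed.

Lemma ekern_add t x y : ekern t (x + y) = ekern t x * ekern t y.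
Proof. by rewrite /ekern dotprodDr mulrDr opprD expiD. Qed.

Lemma ekern_shift G t k x :
  ekern (t + lat (dual G) k) x = ekern t x * conjc (chi G k x).
Proof. by rewrite /ekern dotprodDl mulrDr opprD expiD /chi -expiN. Qed.

Lemma cmeasurable_ekern t : cmeasurable (ekern t).
Proof.
apply: cmeasurable_expi; apply: measurable_funN; apply: measurable_funM => //.
exact: measurable_dotprod.
Qed.

Lemma in_L1_ekern f t : in_L1 leb f -> in_L1 leb (fun x => f x * ekern t x).
Proof.
move=> f1; rewrite (_ : (fun x => _) = (fun x => ekern t x * f x)).
  apply: (in_L1M_bounded (M := 1)) => //; first exact: cmeasurable_ekern.
  by move=> x; rewrite cmod_ekern.
by apply/funext => x; rewrite mulrC.
Qed.

Lemma fourierD f g t : in_L1 leb f -> in_L1 leb g ->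
  fourier (fun x => f x + g x) t = fourier f t + fourier g t.
Proof.
move=> f1 g1; rewrite !fourierE -cintegralD; do ?exact: in_L1_ekern.
by congr cintegral; apply/funext => x; rewrite mulrDl.
Qed.

Lemma fourierZ c f t : in_L1 leb f -> fourier (fun x => c * f x) t = c * fourier f t.
Proof.
move=> f1; rewrite !fourierE -cintegralZ; last exact: in_L1_ekern.
by congr cintegral; apply/funext => x; rewrite mulrA.
Qed.

Lemma fourierB f g t : in_L1 leb f -> in_L1 leb g ->
  fourier (fun x => f x - g x) t = fourier f t - fourier g t.
Proof.
move=> f1 g1; rewrite !fourierE -cintegralB; do ?exact: in_L1_ekern.
by congr cintegral; apply/funext => x; rewrite mulrBl.
Qed.

Lemma fourier_sum (I : Type) (s : seq I) (h : I -> 'cV[R]_d -> R[i]) t :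
  (forall i, in_L1 leb (h i)) ->
  fourier (fun x => \sum_(i <- s) h i x) t = \sum_(i <- s) fourier (h i) t.
Proof.
move=> h1; rewrite fourierE.
under eq_fun do rewrite mulr_suml.
by rewrite cintegral_sum// => i; exact: in_L1_ekern.
Qed.

Lemma fourier_translate f v t : in_L1 leb f ->
  fourier (fun x => f (x - v)) t = ekern t v * fourier f t.
Proof.
move=> f1; have fe := in_L1_ekern t f1.
rewrite !fourierE -cintegralZ//.
rewrite -(cintegral_translate (- v) (f := fun x => ekern t v * (f x * ekern t x))).
  congr cintegral; apply/funext => x.
  have -> : ekern t x = ekern t (x - v) * ekern t v by rewrite -ekern_add subrK.
  by rewrite mulrA mulrC.
exact: (in_L1Z _ fe).1.
Qed.

Lemma fourier_ae f g t : in_L1 leb f -> in_L1 leb g ->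
  {ae leb, forall x, f x = g x} -> fourier f t = fourier g t.
Proof.
move=> f1 g1 fg; apply: ae_eq_cintegral; do ?exact: in_L1_ekern.
by apply: filterS fg => x ->.
Qed.

Lemma fourier_cvg (f_ : nat -> 'cV[R]_d -> R[i]) f t :
  (forall n, in_L1 leb (f_ n)) -> in_L1 leb f ->
  (fun n => \int[leb]_x (cmod (f_ n x - f x)%R)%:E)%E @ \oo --> 0%E ->
  (fun n => cmod (fourier (f_ n) t - fourier f t)) @ \oo --> (0 : R).
Proof.
move=> f_1 f1 cf; apply: cintegral_cvg.
- by move=> n; exact: in_L1_ekern.
- exact: in_L1_ekern.
rewrite (_ : (fun n => _) = (fun n => \int[leb]_x (cmod (f_ n x - f x)%R)%:E)%E)//.
apply/funext => n; apply: eq_integral => x _.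
by rewrite -mulrBl cmodM cmod_ekern mulr1.
Qed.

End fourier_basics.

(** * Plancherel's identity for a periodic union of tiles *)

Section fourier_measurability.
Context (R : realType) (d : nat).
Local Notation leb := (lebesgue_cV R d).
Implicit Types (f g : 'cV[R]_d -> R[i]) (t x v : 'cV[R]_d).

Lemma cmeasurable_fst f : cmeasurable f ->
  cmeasurable (fun p : 'cV[R]_d * 'cV[R]_d => f p.1).
Proof.
move=> [f1 f2]; split.
  exact: (measurableT_comp f1 measurable_fst).
exact: (measurableT_comp f2 measurable_fst).
Qed.

Lemma cmeasurable_snd f : cmeasurable f ->
  cmeasurable (fun p : 'cV[R]_d * 'cV[R]_d => f p.2).
Proof.
move=> [f1 f2]; split.
  exact: (measurableT_comp f1 measurable_snd).
exact: (measurableT_comp f2 measurable_snd).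
Qed.

Lemma cmeasurable_ekern2 :
  cmeasurable (fun p : 'cV[R]_d * 'cV[R]_d => ekern p.1 p.2).
Proof.
apply: cmeasurable_expi; apply: measurable_funN; apply: measurable_funM => //.
apply: measurable_sum => i; apply: measurable_funM.
  exact: (measurableT_comp (measurable_coord_cV i 0) measurable_fst).
exact: (measurableT_comp (measurable_coord_cV i 0) measurable_snd).
Qed.

Lemma measurable_Rintegral2 (u : 'cV[R]_d * 'cV[R]_d -> R) :
  measurable_fun setT u ->
  measurable_fun setT (fun t => \int[leb]_x u (t, x)).
Proof.
move=> mu_; have me : measurable_fun setT (EFin \o u) by exact/measurable_EFinP.
apply: measurableT_comp => //.
under eq_fun do rewrite integralE.
apply: emeasurable_funB.
  have := @measurable_fun_fubini_tonelli_F _ _ _ _ R leb (EFin \o u)^\+%E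
    (measurable_funepos me) (funepos_ge0 _).
  by apply: eq_measurable_fun => t _; apply: eq_integral => x _; rewrite !funeposE.
have := @measurable_fun_fubini_tonelli_F _ _ _ _ R leb (EFin \o u)^\-%E
  (measurable_funeneg me) (funeneg_ge0 _).
by apply: eq_measurable_fun => t _; apply: eq_integral => x _; rewrite !funenegE.
Qed.

Lemma cmeasurable_fourier f : cmeasurable f -> cmeasurable (fourier f).
Proof.
move=> mf; have [m1 m2] := cmeasurableM (cmeasurable_snd mf) cmeasurable_ekern2.
split; [exact: (measurable_Rintegral2 m1)|exact: (measurable_Rintegral2 m2)].
Qed.

Lemma integral_swap (F : 'cV[R]_d * 'cV[R]_d -> \bar R) :
  measurable_fun setT F -> (forall p, 0 <= F p)%E ->
  (\int[leb]_t \int[leb]_x F (t, x) = \int[leb]_x \int[leb]_t F (t, x))%E.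
Proof. by move=> mF F0; exact: fubini_tonelli mF F0. Qed.

End fourier_measurability.

Section packing_plancherel.
Context (R : realType) (d : nat) (G : 'M[R]_d) (uG : G \in unitmx).
Context (T : set 'cV[R]_d) (fT : fundom G T) (mT : measurable T).
Local Notation leb := (lebesgue_cV R d).
Context (Too : (leb T < +oo)%E) (T0 : (0 < leb T)%E).
Implicit Types (f g h : 'cV[R]_d -> R[i]) (t x v : 'cV[R]_d) (k : 'cV[int]_d).

Lemma bm_supp_in_L1 h : bm h -> (forall x, ~ T x -> h x = 0) -> in_L1 leb h.
Proof.
move=> bh hT; split; first exact: bh.1.
have [_] := bm_in_L1 (mrestr_lty mT Too) bh; rewrite integral_mrestr.
- rewrite integral_mkcond; under eq_integral do rewrite patchE.
  rewrite (eq_integral (fun x => (cmod (h x))%:E))// => x _.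
  by case: ifPn => //; rewrite notin_setE => /hT ->; rewrite cmod0.
- exact: emeasurable_cmod bh.1.
- by move=> x; rewrite lee_fin cmod_ge0.
Qed.

Lemma bm_ekern t : bm (ekern t).
Proof.
split; first exact: cmeasurable_ekern.
by exists 1 => x; rewrite cmod_ekern.
Qed.

Lemma fourier_fcoef h t k : bm h -> (forall x, ~ T x -> h x = 0) ->
  fourier h (t + lat (dual G) k) = fcoef G mT (fun x => h x * ekern t x) k.
Proof.
move=> bh hT; rewrite fourierE /fcoef cintegral_mrestr.
- by congr cintegral; apply/funext => x; rewrite ekern_shift mulrA.
- apply: cmeasurableM; last by apply: cmeasurable_conj; exact: cmeasurable_chi.
  by apply: cmeasurableM; [exact: bh.1|exact: cmeasurable_ekern].
- by move=> x /hT ->; rewrite !mul0r.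
Qed.

(** Parseval's identity for h times the kernel at t: the Fourier coefficients
    of this function are the values of the transform of h along t + G', where
    G' is the dual lattice. *)
Lemma csum_fourier h t : bm h -> (forall x, ~ T x -> h x = 0) ->
  csum (fun k => (cmod (fourier h (t + lat (dual G) k)) ^+ 2)%:E) =
  (leb T * energy leb h)%E.
Proof.
move=> bh hT; under eq_csum do rewrite fourier_fcoef//.
rewrite parseval_bm//; last by apply: bmM => //; exact: bm_ekern.
rewrite energy_mrestr_supp; last 2 first.
- by apply: cmeasurableM; [exact: bh.1|exact: cmeasurable_ekern].
- by move=> x /hT ->; rewrite mul0r.
by congr (_ * _)%E; apply: eq_integral => x _; rewrite cmodM cmod_ekern mulr1.
Qed.

Section superposition.
Context (I : Type) (s : seq I) (h : I -> 'cV[R]_d -> R[i]) (m : I -> 'cV[int]_d).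
Hypothesis bh : forall i, bm (h i).
Hypothesis hT : forall i x, ~ T x -> h i x = 0.

Definition superposition x : R[i] := \sum_(i <- s) h i (x - lat G (m i)).

Definition modulated t x : R[i] := \sum_(i <- s) ekern t (lat G (m i)) * h i x.

Lemma bm_modulated t : bm (modulated t).
Proof. by apply: bm_sum => i; exact: bmZ. Qed.

Lemma modulated_supp t x : ~ T x -> modulated t x = 0.
Proof. by move=> nTx; rewrite /modulated big1// => i _; rewrite hT// mulr0. Qed.

(** At frequency t, translating by a lattice vector amounts to multiplying by
    a phase. *)
Lemma fourier_superposition t : fourier superposition t = fourier (modulated t) t.
Proof.
have h1 i : in_L1 leb (h i) by exact: bm_supp_in_L1 (bh i) (hT i).
rewrite /superposition fourier_sum; last by move=> i; exact: in_L1_translate.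
rewrite /modulated fourier_sum; last by move=> i; exact: in_L1Z.
by apply: eq_bigr => i _; rewrite fourier_translate// fourierZ.
Qed.

(** The phases do not change when t moves along the dual lattice; this is why
    the sum over a coset of the dual lattice can be computed by Parseval's
    identity on the single tile T. *)
Lemma modulated_shift t k : modulated (t + lat (dual G) k) = modulated t.
Proof.
apply/funext => x; apply: eq_bigr => i _.
by rewrite ekern_shift chi_lat// conjc1 mulr1.
Qed.

Lemma cmeasurable_modulated2 :
  cmeasurable (fun p : 'cV[R]_d * 'cV[R]_d => modulated p.1 p.2).
Proof.
apply: cmeasurable_sum => i; apply: cmeasurableM.
  apply: (cmeasurable_fst (f := fun t => ekern t (lat G (m i)))).
  rewrite (_ : (fun t => _) = ekern (lat G (m i))); first exact: cmeasurable_ekern.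
  by apply/funext => t; rewrite /ekern dotprodC.
by apply: cmeasurable_snd; exact: (bh i).1.
Qed.

Lemma in_L1_superposition : in_L1 leb superposition.
Proof.
by apply: in_L1_sum => i; apply: in_L1_translate; exact: bm_supp_in_L1 (bh i) (hT i).
Qed.

(** Fold the integral over the periodization of S0 into one over S0, sum over
    the dual lattice with [csum_fourier], and exchange the integrations. *)
Lemma energy_fourier_superposition (S0 : set 'cV[R]_d) (mS0 : measurable S0) :
  exact_packing (dual G) S0 ->
  (\int[leb]_t ((cmod (fourier superposition t) ^+ 2)%:E *
     (\1_(periodization (dual G) S0) t)%:E) =
   leb T * \int[leb]_x energy (mrestr leb mS0) (fun t => modulated t x))%E.
Proof.
move=> pS0; have mf := cmeasurable_fourier in_L1_superposition.1.
rewrite integral_periodization//; last 2 first.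
- exact: emeasurable_cmod2.
- by move=> t; rewrite lee_fin sqr_ge0.
rewrite -integral_csum; last 2 first.
- move=> k; apply: measurable_indicM => //.
  apply: (measurable_fun_translate (f := fun t => (cmod (fourier superposition t) ^+ 2)%:E)).
  exact: emeasurable_cmod2.
- by move=> k t; rewrite mule_ge0// lee_fin sqr_ge0.
have mmod := emeasurable_cmod2 cmeasurable_modulated2.
have mmodS : measurable_fun setT (fun p : 'cV[R]_d * 'cV[R]_d =>
    ((cmod (modulated p.1 p.2) ^+ 2)%:E * (\1_S0 p.1)%:E)%E).
  apply: emeasurable_funM => //; apply/measurable_EFinP.
  apply: (measurableT_comp (f := \1_S0 : _ -> R)); first exact: measurable_indic.
  exact: measurable_fst.
transitivity (\int[leb]_t (leb T * (energy leb (modulated t) * (\1_S0 t)%:E)))%E.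
  apply: eq_integral => t _; rewrite muleA -(csum_fourier t (bm_modulated t) (@modulated_supp t)).
  rewrite muleC -ge0_csumZl; [|by rewrite lee_fin|by move=> k; rewrite lee_fin sqr_ge0].
  by apply: eq_csum => k; rewrite muleC fourier_superposition modulated_shift.
have menergy : measurable_fun setT (fun t => energy leb (modulated t) * (\1_S0 t)%:E)%E.
  apply: measurable_indicM => //.
  have p0 (p : 'cV[R]_d * 'cV[R]_d) : (0 <= (cmod (modulated p.1 p.2) ^+ 2)%:E)%E.
    by rewrite lee_fin sqr_ge0.
  exact: (@measurable_fun_fubini_tonelli_F _ _ _ _ R leb _ mmod p0).
rewrite ge0_integralZl//; last first.
  by move=> t _; rewrite mule_ge0// ?energy_ge0// lee_fin.
congr (_ * _)%E.
transitivity (\int[leb]_t \int[leb]_x ((cmod (modulated t x) ^+ 2)%:E * (\1_S0 t)%:E))%E.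
  apply: eq_integral => t _; rewrite ge0_integralZr//.
  - by apply: emeasurable_cmod2; exact: (bm_modulated t).1.
  - by move=> x _; rewrite lee_fin sqr_ge0.
rewrite (integral_swap mmodS); last by move=> p; rewrite mule_ge0// lee_fin sqr_ge0.
apply: eq_integral => x _; rewrite energy_mrestr//.
apply: cmeasurable_sum => i; apply: cmeasurableM; last exact: cmeasurable_cst.
rewrite (_ : (fun t => _) = ekern (lat G (m i))); first exact: cmeasurable_ekern.
by apply/funext => t; rewrite /ekern dotprodC.
Qed.

End superposition.

End packing_plancherel.

Section plancherel.
Context (R : realType) (d : nat) (G : 'M[R]_d) (uG : G \in unitmx).
Context (N : 'M[int]_d).
Local Notation L := (G *m int_mx R N).
Context (uL : L \in unitmx).
Context (T : set 'cV[R]_d) (fT : fundom G T).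
Context (S0 : set 'cV[R]_d) (fS0 : fundom (dual L) S0).
Local Notation leb := (lebesgue_cV R d).
Context (Too : (leb T < +oo)%E) (T0 : (0 < leb T)%E).
Context (Soo : (leb S0 < +oo)%E).
Implicit Types (f g h : 'cV[R]_d -> R[i]) (t x v : 'cV[R]_d) (k l : 'cV[int]_d).
Local Notation S := (periodization (dual G) S0).

Let mT : measurable T := fT.1.1.
Let mS0 : measurable S0 := fS0.1.1.

Lemma exact_packing_sublattice : exact_packing L T.
Proof.
split=> // x k l; rewrite !latM => Tk Tl.
by apply: (lat_inj uL); rewrite !latM (fT.1.2 x _ _ Tk Tl).
Qed.

Hypothesis pS0 : exact_packing (dual G) S0.

Lemma measurable_dual_periodization : measurable S.
Proof. exact: measurable_periodization. Qed.

Local Notation mS := measurable_dual_periodization.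
Local Notation nuS := (mrestr leb mS).

Let uD : dual L \in unitmx.
Proof. by rewrite dual_unit. Qed.

(** The phases attached to the vectors of the sublattice L are distinct
    characters of the dual lattice of L, hence orthogonal on S0. *)
Lemma energy_superposition_dual (K : seq 'cV[int]_d) (h : 'cV[int]_d -> 'cV[R]_d -> R[i]) x :
  uniq K ->
  energy (mrestr leb mS0) (fun t => modulated G K h (fun l => N *m l) t x) =
  (leb S0 * (\sum_(l <- K) cmod (h l x) ^+ 2)%:E)%E.
Proof.
move=> uK; under [in RHS]eq_bigr do rewrite -cmod_conj.
rewrite -(energy_chi_sum uD fS0 mS0 Soo (fun l => conjc (h l x)) uK).
apply: eq_integral => t _; rewrite -cmod_conj; congr (cmod _ ^+ 2)%:E.
rewrite /modulated rmorph_sum; apply: eq_bigr => l _ /=.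
rewrite -latM conjM mulrC; congr (_ * _).
by rewrite /ekern /chi dualK dotprodC expiN conj_conj.
Qed.

(** A bounded g on finitely many translates of T by L is a superposition of
    its pieces moved into T, and orthogonality on S0 separates the pieces. *)
Lemma plancherel_finite g (K : seq 'cV[int]_d) : bm g -> uniq K ->
  (forall x, g x != 0 -> exists2 l, l \in K & T (x - lat L l)) ->
  in_L1 leb g /\
  energy nuS (fourier g) = (leb T * leb S0 * energy leb g)%E.
Proof.
move=> bg uK gK.
(* The piece of g on the tile T + L l, moved into T. *)
pose h l x : R[i] := g (x + lat L l) * ((\1_T x : R)%:C)%C.
have bgl l : bm (fun x => g (x + lat L l)).
  split; first by apply: cmeasurable_translate; exact: bg.1.
  by have [_ [M gM]] := bg; exists M.
have bh l : bm (h l) by apply: bmM => //; exact: bm_indic.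
have hT l x : ~ T x -> h l x = 0 by move=> nT; rewrite /h indicE memNset// mulr0.
have gE0 x l : h l (x - lat L l) = g x * ((\1_T (x - lat L l) : R)%:C)%C.
  by rewrite /h subrK.
have pL := exact_packing_sublattice.
have one x : g x != 0 -> exists2 l, l \in K & T (x - lat L l) /\
    (forall j, j != l -> h j (x - lat L j) = 0).
  move=> /gK[l lK Tl]; exists l => //; split=> // j jl.
  rewrite hT// => Tj; move/eqP: jl; apply; exact: pL.2 Tj Tl.
have gE : g = superposition G K h (fun l => N *m l).
  apply/funext => x; rewrite /superposition.
  under eq_bigr do rewrite -latM.
  have [g0|g0] := eqVneq (g x) 0.
    by rewrite g0 big1// => l _; rewrite gE0 g0 mul0r.
  have [l lK [Tl hj]] := one x g0.
  rewrite (bigD1_seq l)//= big1 ?addr0; last by move=> j jl; exact: hj.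
  by rewrite gE0 indicE mem_set// mulr1.
split.
  rewrite gE; exact: (in_L1_superposition G mT Too K (fun l => N *m l) bh hT).
have mfg : cmeasurable (fourier g).
  by apply: cmeasurable_fourier; exact: bg.1.
rewrite energy_mrestr// {1}gE
  (energy_fourier_superposition uG fT mT Too T0 K (fun l => N *m l) bh hT mS0 pS0).
rewrite -muleA; congr (_ * _)%E.
under eq_integral do rewrite energy_superposition_dual//.
have mh2 l : measurable_fun setT (fun x => (cmod (h l x) ^+ 2)%:E).
  by apply: emeasurable_cmod2; exact: (bh l).1.
have h20 l x : setT x -> (0 <= (cmod (h l x) ^+ 2)%:E)%E.
  by move=> _; rewrite lee_fin sqr_ge0.
rewrite ge0_integralZl//; last 2 first.
- by under eq_fun do rewrite -sumEFin; apply: emeasurable_sum.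
- by move=> x _; rewrite lee_fin sumr_ge0// => l _; rewrite sqr_ge0.
congr (_ * _)%E.
under eq_integral do rewrite -sumEFin.
rewrite ge0_integral_sum//.
have mhL l : measurable_fun setT (fun x => (cmod (h l (x - lat L l)) ^+ 2)%:E).
  by apply: emeasurable_cmod2; apply: cmeasurable_translate; exact: (bh l).1.
transitivity (\sum_(l <- K) \int[leb]_x (cmod (h l (x - lat L l)) ^+ 2)%:E)%E.
  apply: eq_bigr => l _; apply/esym.
  by apply: (energy_translate (- lat L l) (f := h l)); exact: (bh l).1.
rewrite -ge0_integral_sum//; last first.
  by move=> l x _; rewrite lee_fin sqr_ge0.
apply: eq_integral => x _; rewrite sumEFin; congr EFin.
have [g0|g0] := eqVneq (g x) 0.
  by rewrite g0 cmod0 expr0n big1// => l _; rewrite gE0 g0 mul0r cmod0 expr0n.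
have [l lK [Tl hj]] := one x g0.
rewrite (bigD1_seq l)//= big1 ?addr0.
  by rewrite gE0 indicE mem_set// mulr1.
by move=> j jl; rewrite hj// cmod0 expr0n.
Qed.

Let keys n : seq 'cV[int]_d := undup (pmap (@pickle_inv 'cV[int]_d) (iota 0 n)).

Let mem_keys k n : (pickle k < n)%N -> k \in keys n.
Proof.
move=> kn; rewrite mem_undup mem_pmap; apply/mapP; exists (pickle k).
  by rewrite mem_iota.
by rewrite pickleK_inv.
Qed.

Let window f n := [set x | cmod (f x) <= n%:R] `&`
  \bigcup_(l in [set` keys n]) [set x | T (x - lat L l)].

Let measurable_window f n : cmeasurable f -> measurable (window f n).
Proof.
move=> mf; apply: measurableI.
  rewrite -[X in measurable X]setTI.
  have := measurable_cmod mf measurableT (measurable_itv `]-oo, n%:R]).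
  by rewrite (_ : _ @^-1` _ = [set x | cmod (f x) <= n%:R])//; apply/seteqP; split => x /=; rewrite in_itv.
apply: fin_bigcup_measurable => [|l _]; first exact: finite_seq.
exact: measurable_preimage_translate.
Qed.

Let window_mono f m n : (m <= n)%N -> window f m `<=` window f n.
Proof.
move=> mn x [fm [l /= lm Tl]]; split; first by rewrite /= (le_trans fm)// ler_nat.
exists l => //=; move: lm; rewrite !mem_undup !mem_pmap => /mapP[j jm lj].
by apply/mapP; exists j => //; move: jm; rewrite !mem_iota/= !add0n => /leq_trans; apply.
Qed.

Let window_near f x : periodization L T x -> \forall n \near \oo, window f n x.
Proof.
move=> [l Tl]; near=> n; split => /=.
  rewrite (le_trans (ltW (archi_boundP (cmod_ge0 (f x)))))// ler_nat.
  by near: n; exact: nbhs_infty_ge.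
exists l => //=; apply: mem_keys.
by near: n; exact: nbhs_infty_gt.
Unshelve. all: by end_near. Qed.

(** The general case follows by truncating f to sets on which it is bounded
    and which meet finitely many tiles. The transforms of the truncations
    converge pointwise because f is integrable, and in the square mean by the
    finite case applied to the differences. *)
Lemma plancherel f : in_L1 leb f -> in_L2 leb f ->
  (forall x, f x != 0 -> periodization L T x) ->
  energy nuS (fourier f) = (leb T * leb S0 * energy leb f)%E.
Proof.
move=> f1 [mf f2] fL.
pose B := window f.
have mB n : measurable (B n) by exact: measurable_window.
have Bf x : f x != 0 -> \forall n \near \oo, B n x by move=> /fL; exact: window_near.
pose f_ n := trunc f (B n).
have mf_ n : cmeasurable (f_ n) by exact: cmeasurable_trunc.
have bf_ n : bm (f_ n).
  split=> //; exists n%:R => x; rewrite /f_ /trunc indicE.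
  have [Bx|nBx] := pselect (B n x); first by rewrite mem_set// mulr1; exact: Bx.1.
  by rewrite memNset// mulr0 cmod0.
have supp_ n x : f_ n x != 0 -> exists2 l, l \in keys n & T (x - lat L l).
  rewrite /f_ /trunc indicE; have [[_ [l /= lK Tl]] _|nBx] := pselect (B n x).
    by exists l.
  by rewrite memNset// mulr0 eqxx.
have C0 : (0 <= leb T * leb S0)%E by rewrite mule_ge0.
have f_1 n := (plancherel_finite (bf_ n) (undup_uniq _) (supp_ n)).1.
have Ef_ n := (plancherel_finite (bf_ n) (undup_uniq _) (supp_ n)).2.
have mff_ n := cmeasurable_fourier (mf_ n).
have mff := cmeasurable_fourier mf.
have cfin : (leb T * leb S0)%E \is a fin_num.
  by rewrite fin_numM// ge0_fin_numE.
have cZ (u : nat -> \bar R) (l : \bar R) : u @ \oo --> l ->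
    (fun n => leb T * leb S0 * u n)%E @ \oo --> (leb T * leb S0 * l)%E.
  by move=> ul; rewrite -(fineK cfin); apply: cvgeZl.
have pw t : (fun n => cmod (fourier (f_ n) t - fourier f t)) @ \oo --> (0 : R).
  by apply: fourier_cvg => //; exact: trunc_L1_cvg0.
apply: (energy_lim (g_ := fun n => fourier (f_ n))) => //; last first.
  under eq_fun do rewrite Ef_; apply: cZ; exact: trunc_energy_cvg.
have e0 := cZ _ _ (trunc_energy_cvg0 mf mB Bf f2); rewrite mule0 in e0.
apply: (squeeze_cvge _ (cvg_cst 0%E) e0); near=> n.
rewrite energy_ge0 /=.
apply: (@energy_fatou _ _ _ _ (fun m t => fourier (f_ n) t - fourier (f_ (n + m)%N) t)).
- by move=> m; exact: cmeasurableB.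
- exact: cmeasurableB.
- apply: aeW => t.
  rewrite (_ : (fun m => _) = (fun m => cmod (fourier (f_ (m + n)%N) t - fourier f t))).
    by rewrite (cvg_shiftn n (fun m => cmod (fourier (f_ m) t - fourier f t))).
  by apply/funext => m; rewrite -cmodN addnC; congr cmod; ring.
move=> m.
rewrite (_ : (fun t => _) = fourier (fun x => f_ n x - f_ (n + m)%N x)); last first.
  by apply/funext => t; rewrite fourierB.
have bnm : bm (fun x => f_ n x - f_ (n + m)%N x) by exact: bmB.
have [|_ ->] := plancherel_finite bnm (undup_uniq (pmap (@pickle_inv _) (iota 0 (n + m)%N))).
  move=> x nz; apply: supp_; apply: contra_neq nz => fnm0.
  rewrite fnm0 subr0 /f_ /trunc indicE; have [Bx|nBx] := pselect (B n x).
    have Bnm : B (n + m)%N x by apply: window_mono Bx; exact: leq_addr.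
    by move: fnm0; rewrite /f_ /trunc !indicE !mem_set.
  by rewrite memNset// mulr0.
apply: lee_wpmul2l => //; apply: energy_le.
- exact: bnm.1.
- exact: (cmeasurableB (mf_ n) mf).
move=> x; rewrite /f_ /trunc !indicE.
have [Bx|nBx] := pselect (B n x).
  have Bnm : B (n + m)%N x by apply: window_mono Bx; exact: leq_addr.
  by rewrite !mem_set// subrr cmod0 cmod_ge0.
rewrite (memNset nBx) mulr0 !sub0r !cmodN.
by case: (x \in B (n + m)%N); rewrite ?mulr1// mulr0 cmod0 cmod_ge0.
Unshelve. all: by end_near. Qed.

End plancherel.

(** * Tiles and their volumes *)

Section null_sets.
Context (R : realType) (d : nat).
Local Notation leb := (lebesgue_cV R d).
Implicit Types (G : 'M[R]_d) (x v : 'cV[R]_d) (k l : 'cV[int]_d).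
Implicit Types (M U T : set 'cV[R]_d).

Lemma measure_translate M v : measurable M -> leb [set x | M (x - v)] = leb M.
Proof.
move=> mM; have mMv := measurable_preimage_translate (- v) mM.
rewrite !measure_indic// -[RHS](lebesgue_cV_translate (- v)).
- by apply: eq_integral => x _; rewrite !indicE.
- by apply/measurable_EFinP; exact: measurable_indic.
- by move=> x; rewrite lee_fin.
Qed.

Lemma null_periodization G M : measurable M -> leb M = 0%E ->
  leb (periodization G M) = 0%E.
Proof.
move=> mM M0; have : leb.-negligible (periodization G M).
  rewrite (_ : periodization G M = \bigcup_n (if @pickle_inv 'cV[int]_d n is Some k
      then [set x | M (x - lat G k)] else set0)); last first.
    apply/seteqP; split => [x [k Mk]|x [n _]].
      by exists (pickle k) => //; rewrite pickleK_inv.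
    by case: pickle_inv => [k Mk|//]; exists k.
  apply: negligible_bigcup => n; case: pickle_inv => [k|]; last exact: negligible_set0.
  apply/negligibleP; first exact: measurable_preimage_translate.
  by rewrite -M0; exact: measure_translate.
by move/(measure_negligible (measurable_periodization G mM)).
Qed.

Lemma null_sub M U : measurable M -> measurable U -> M `<=` U -> leb U = 0%E -> leb M = 0%E.
Proof.
move=> mM mU MU U0; apply/eqP; rewrite eq_le measure_ge0 andbT -U0.
by apply: le_measure; rewrite ?inE.
Qed.

Lemma periodization_shift G U x k :
  periodization G U (x + lat G k) <-> periodization G U x.
Proof.
split=> [[l Ul]|[l Ul]].
  by exists (l - k); rewrite latB opprB addrA.
by exists (l + k); rewrite latD opprD addrACA subrr addr0.
Qed.

(** Removing from U the countably many null overlaps with its translates makes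
    the packing exact. *)
Lemma packing_refine G U : measurable U ->
  (forall k, k <> 0 -> leb (U `&` [set x | U (x - lat G k)]) = 0%E) ->
  exists U', [/\ exact_packing G U', U' `<=` U & leb (U `\` U') = 0%E].
Proof.
move=> mU U0.
pose N := \bigcup_n (if @pickle_inv 'cV[int]_d n is Some k then
    (if k == 0 then set0 else U `&` [set x | U (x - lat G k)]) else set0).
have mNn n : measurable (if @pickle_inv 'cV[int]_d n is Some k then
    (if k == 0 then set0 else U `&` [set x | U (x - lat G k)]) else set0).
  case: pickle_inv => [k|//]; case: ifP => // _.
  by apply: measurableI => //; exact: measurable_preimage_translate.
have mN : measurable N by exact: bigcupT_measurable.
exists (U `\` N); split.
- split; first exact: measurableD.
  move=> x k l [Uk nNk] [Ul _]; apply: contrapT => kl; apply: nNk.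
  exists (pickle (l - k)) => //; rewrite pickleK_inv subr_eq0.
  case: eqP => [lk|_]; first by apply: kl.
  by split=> //=; rewrite latB opprB addrA subrK.
- exact: subDsetl.
- rewrite setDD; have : leb.-negligible (U `&` N).
    apply: (@negligibleS _ _ _ _ N); first exact: subIsetr.
    apply: negligible_bigcup => n; apply/negligibleP; first exact: mNn.
    case: pickle_inv => [k|]; last by rewrite measure0.
    by case: eqP => [_|k0]; [rewrite measure0|exact: U0].
  by move/(measure_negligible (measurableI _ _ mU mN)).
Qed.

End null_sets.

Section cells.
Context (R : realType) (d : nat) (G : 'M[R]_d) (uG : G \in unitmx).
Local Notation leb := (lebesgue_cV R d).
Implicit Types (x v : 'cV[R]_d) (k l : 'cV[int]_d) (a : R).

(** Half-open cells are exact fundamental domains. The pair measure is defined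
    with the closed ones, which differ by a null set ([closed_cell_null]). *)
Definition cell a : set 'cV[R]_d := [set x | forall i, a <= (invmx G *m x) i 0 < a + 1].
Definition closed_cell a : set 'cV[R]_d :=
  [set x | forall i, a <= (invmx G *m x) i 0 <= a + 1].

Lemma measurable_cell_coord i (B : set R) : measurable B ->
  measurable [set x | B ((invmx G *m x) i 0)].
Proof.
move=> mB; rewrite -[X in measurable X]setTI.
have := measurableT_comp (measurable_coord_cV i 0) (measurable_mulmx (invmx G)).
by move=> /(_ measurableT B mB).
Qed.

Lemma measurable_forall (P : 'I_d -> set 'cV[R]_d) : (forall i, measurable (P i)) ->
  measurable [set x | forall i, P i x].
Proof.
move=> mP; rewrite (_ : [set _ | _] = \bigcap_(i in [set: 'I_d]) P i).
  by apply: fin_bigcap_measurable.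
by apply/seteqP; split => x /= h i; [move=> _; exact: h|exact: h].
Qed.

Lemma measurable_cell a : measurable (cell a).
Proof.
apply: measurable_forall => i.
have := measurable_cell_coord i (measurable_itv `[a, a + 1[).
by rewrite (_ : [set _ | _] = [set x | a <= (invmx G *m x) i 0 < a + 1])//; apply/seteqP; split => x /=; rewrite in_itv.
Qed.

Lemma measurable_closed_cell a : measurable (closed_cell a).
Proof.
apply: measurable_forall => i.
have := measurable_cell_coord i (measurable_itv `[a, a + 1]).
by rewrite (_ : [set _ | _] = [set x | a <= (invmx G *m x) i 0 <= a + 1])//; apply/seteqP; split => x /=; rewrite in_itv.
Qed.

Lemma cell_coord x k i : (invmx G *m (x - lat G k)) i 0 = (invmx G *m x) i 0 - (k i 0)%:~R.
Proof. by rewrite mulmxBr mulKmx// !mxE. Qed.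

Lemma fundom_cell a : fundom G (cell a).
Proof.
split; first split; first exact: measurable_cell.
  move=> x k l hk hl; apply/matrixP => i j; rewrite ord1.
  have /andP[k1 k2] := hk i; have /andP[l1 l2] := hl i.
  rewrite cell_coord in k1 k2; rewrite cell_coord in l1 l2.
  have e (m : int) : a <= (invmx G *m x) i 0 - m%:~R ->
      (invmx G *m x) i 0 - m%:~R < a + 1 -> Num.floor ((invmx G *m x) i 0 - a) = m.
    by move=> m1 m2; apply: floor_def; rewrite intrD; apply/andP; split; lra.
  by rewrite -(e _ k1 k2) -(e _ l1 l2).
move=> x; exists (\col_i Num.floor ((invmx G *m x) i 0 - a)) => i.
rewrite cell_coord mxE; have := floor_itv ((invmx G *m x) i 0 - a).
by rewrite intrD => /andP[h1 h2]; apply/andP; split; lra.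
Qed.

Lemma closed_cell_lty a : (leb (closed_cell a) < +oo)%E.
Proof.
pose C := \sum_i \sum_j `|G i j| * (`|a| + 1).
have C0 : 0 <= C by apply: sumr_ge0 => i _; apply: sumr_ge0 => j _; rewrite mulr_ge0// addr_ge0.
have CC : forall i : 'I_d, (\col__ (- C) : 'cV[R]_d) i 0 <= (\col__ C : 'cV[R]_d) i 0.
  by move=> i; rewrite !mxE; lra.
apply: (@le_lt_trans _ _ (leb [set x | forall i, (\col__ (- C) : 'cV[R]_d) i 0 <= x i 0
    <= (\col__ C : 'cV[R]_d) i 0])); last by rewrite lebesgue_cV_box// ltry.
apply: le_measure; rewrite ?inE.
- exact: measurable_closed_cell.
- apply: measurable_forall => i.
  have := measurable_coord_cV i 0 measurableT (measurable_itv `[(\col__ (- C) : 'cV[R]_d) i 0, (\col__ C : 'cV[R]_d) i 0]).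
  by rewrite setTI (_ : _ @^-1` _ = [set x : 'cV[R]_d | (\col__ (- C) : 'cV[R]_d) i 0 <= x i 0
    <= (\col__ C : 'cV[R]_d) i 0])//; apply/seteqP; split => x /=; rewrite in_itv.
move=> x hx i; rewrite !mxE -ler_norml -(mulKVmx uG x) mxE.
apply: le_trans (ler_norm_sum _ _ _) _.
apply: (@le_trans _ _ (\sum_j `|G i j| * (`|a| + 1))); last first.
  rewrite /C [leRHS](bigD1 i)//= lerDl.
  by apply: sumr_ge0 => j _; apply: sumr_ge0 => l _; rewrite mulr_ge0// addr_ge0.
apply: ler_sum => j _; rewrite normrM ler_wpM2l//.
have /andP[h1 h2] := hx j; rewrite ler_norml; apply/andP; split.
  by have := ler_norm (- a); rewrite normrN; lra.
by have := ler_norm a; lra.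
Qed.

(** Pushing the face into the closed cell by the distances 1 / (n + 1) gives
    infinitely many disjoint translates in a set of finite volume. *)
Lemma face_null a i :
  leb (closed_cell a `&` [set x | (invmx G *m x) i 0 = a + 1]) = 0%E.
Proof.
set F := _ `&` _.
have mF : measurable F.
  apply: measurableI; first exact: measurable_closed_cell.
  exact: (measurable_cell_coord i (measurable_set1 (a + 1))).
pose w : 'cV[R]_d := \col_j (i == j)%:R.
(* The inward displacements: distinct and at most the width 1 of the cell. *)
pose s (n : nat) : R := n.+1%:R^-1.
pose v n := G *m (s n *: w).
have coordv x n j : (invmx G *m (x + v n)) j 0 = (invmx G *m x) j 0 + s n * (i == j)%:R.
  by rewrite mulmxDr mulKmx// !mxE.
have s01 n : 0 < s n <= 1 by rewrite invr_gt0 ltr0n/= invf_le1 ?ltr0n// ler1n.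
have Fv x n : F (x + v n) -> (invmx G *m x) i 0 = a + 1 - s n /\ closed_cell a x.
  move=> [hx]; rewrite /= coordv eqxx mulr1 => e; split; first lra.
  move=> j; have := hx j; rewrite coordv; have [ij|ij] := eqVneq i j.
    by rewrite -ij mulr1 => _; have := s01 n; lra.
  by rewrite mulr0 addr0.
have pw x : (csum (fun n : nat => (\1_F (x + v n) : R)%:E) <= (\1_(closed_cell a) x)%:E)%E.
  have [[n Fn]|nF] := pselect (exists n, F (x + v n)).
    rewrite (csum_single (k0 := n)).
    - by rewrite !indicE !mem_set//; exact: (Fv _ _ Fn).2.
    - by move=> m; rewrite lee_fin.
    - move=> m mn; rewrite indicE memNset// => Fm; apply: mn.
      have := (Fv _ _ Fm).1; rewrite (Fv _ _ Fn).1 => e.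
      have : s n = s m by lra.
      by move/invr_inj/eqP; rewrite eqr_nat => /eqP[].
  rewrite (_ : csum _ = 0%E) ?lee_fin//.
  rewrite -[RHS](@csum0 R nat); apply: eq_csum => n.
  by rewrite indicE memNset// => Fn; apply: nF; exists n.
have le1 : (csum (fun n : nat => leb F) <= leb (closed_cell a))%E.
  rewrite (_ : csum _ = (\int[leb]_x csum (fun n : nat => (\1_F (x + v n) : R)%:E))%E).
    rewrite measure_indic; last exact: measurable_closed_cell.
    apply: ge0_le_integral => //.
    - by move=> x _; apply: csum_ge0 => n; rewrite lee_fin.
    - by apply: measurable_csum => [n|n x]; [exact: measurable_indic_translate|rewrite lee_fin].
    - by apply/measurable_EFinP; apply: measurable_indic; exact: measurable_closed_cell.
  rewrite integral_csum.
  - apply: eq_csum => n; rewrite measure_indic//.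
    rewrite (lebesgue_cV_translate (v n) (f := fun x => (\1_F x)%:E))//.
    + by apply/measurable_EFinP; exact: measurable_indic.
  - by move=> n; exact: measurable_indic_translate.
  - by move=> n x; rewrite lee_fin.
apply/eqP; rewrite eq_le measure_ge0 andbT leNgt; apply/negP => F0.
have Ffin : leb F \is a fin_num.
  rewrite ge0_fin_numE//; apply: le_lt_trans (closed_cell_lty a).
  apply: le_trans le1; exact: (@csum_ge R nat (fun=> leb F) 0%N).
have F0' : 0 < fine (leb F) by rewrite -lte_fin fineK.
have Cfin : leb (closed_cell a) \is a fin_num by rewrite ge0_fin_numE// closed_cell_lty.
have := archi_boundP (divr_ge0 (fine_ge0 (measure_ge0 leb (closed_cell a))) (ltW F0')).
set n := Num.bound _; rewrite ltr_pdivrMr// -lte_fin EFinM !fineK// ltNge => /negP; apply.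
apply: le_trans le1; have := @csum_ge_fin R nat (fun=> leb F) (iota 0 n) (fun=> measure_ge0 _ _) (iota_uniq _ _).
rewrite -(fineK Ffin) sumEFin big_const_seq count_predT size_iota iter_addr_0.
by rewrite -EFinM mulr_natl.
Qed.

Lemma closed_cell_null a : leb (closed_cell a `\` cell a) = 0%E.
Proof.
have mC := measurable_closed_cell a; have mc := measurable_cell a.
have : leb.-negligible (closed_cell a `\` cell a).
  apply: (@negligibleS _ _ _ _ (\bigcup_n (if insub n is Some i then
    closed_cell a `&` [set x | (invmx G *m x) (i : 'I_d) 0 = a + 1] else set0))).
    move=> x [Cx nx].
    have [i ix] : exists i, ~ (a <= (invmx G *m x) i 0 < a + 1).
      by apply: contrapT => h; apply: nx => i; apply: contrapT => hi; apply: h; exists i.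
    exists (val i) => //; rewrite valK; split=> //=.
    have /andP[h1 h2] := Cx i; apply/eqP; rewrite eq_le h2 /= leNgt.
    by apply/negP => h3; apply: ix; rewrite h1.
  apply: negligible_bigcup => n; case: insubP => [i _ _|_]; last exact: negligible_set0.
  apply/negligibleP; last exact: face_null.
  apply: measurableI => //.
  exact: (measurable_cell_coord i (measurable_set1 (a + 1))).
by move/(measure_negligible (measurableD mC mc)).
Qed.

Lemma cell_closed_cell a : cell a `<=` closed_cell a.
Proof. by move=> x hx i; have /andP[-> /ltW ->] := hx i. Qed.

Lemma measure_closed_cell a : leb (closed_cell a) = leb (cell a).
Proof.
have mc := measurable_cell a; have mC := measurable_closed_cell a.
rewrite -[in LHS](setDUK (@cell_closed_cell a)) measureU ?setDIK//.
  by rewrite [X in (_ + X)%E]closed_cell_null adde0.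
exact: measurableD.
Qed.

End cells.

(** * Covolumes of lattices containing the integer lattice *)

Section lattice_volume.
Context (R : realType) (d : nat).
Local Notation leb := (lebesgue_cV R d).
Implicit Types (G : 'M[R]_d) (x v : 'cV[R]_d) (k l r : 'cV[int]_d).

(** The missing faces are null, so this is the volume of a closed box. *)
Lemma measure_cell1 : leb (cell 1%:M 0) = 1%E.
Proof.
rewrite -measure_closed_cell ?unitmx1//.
have -> : closed_cell (1%:M : 'M[R]_d) 0 = [set x | forall i, (0 : 'cV[R]_d) i 0 <= x i 0
    <= (const_mx 1 : 'cV[R]_d) i 0].
  apply/seteqP; split => x hx i; have := hx i; rewrite invmx1 mul1mx !mxE add0r//.
rewrite lebesgue_cV_box; last by move=> i; rewrite !mxE.
by rewrite big1// => i _; rewrite !mxE subr0.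
Qed.

Lemma fundom1_measure T : fundom 1%:M T -> leb T = 1%E.
Proof. by move=> fT; rewrite (measure_fundom fT (fundom_cell (unitmx1 _ _) 0)) measure_cell1. Qed.

(** Representatives of the quotient of Z^d by the diagonal sublattice D Z^d. *)
Definition residues (D : 'I_d -> int) : set 'cV[int]_d :=
  [set r | forall i, 0 <= r i 0 < `|D i|].

(** Here G Z^d contains Z^d with quotient isomorphic to Z^d / D Z^d, so the
    translates of S by representatives of the quotient add up to a
    fundamental domain of Z^d, which has volume 1. *)
Lemma index_measure G (U V : 'M[int]_d) (D : 'I_d -> int) S :
  U \in unitmx -> V \in unitmx -> (forall i, D i != 0) ->
  G *m int_mx R (U *m diag_mx (\row_i D i) *m V) = 1%:M -> fundom G S ->
  (csum (fun r => (\1_(residues D) r)%:E) * leb S)%E = 1%E.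
Proof.
move=> uU uV D0 GB [[mS pS] cS]; have [uG _] := mulmx1_unit GB.
(* The fundamental domain of Z^d assembled from #(residues D) copies of S. *)
pose T := [set x | exists r, residues D r /\ S (x - lat G (U *m r))].
have lat1E k : lat (1%:M : 'M[R]_d) k = lat G (U *m (diag_mx (\row_i D i) *m (V *m k))).
  by rewrite -GB latM !mulmxA.
have resU x k l r r' : residues D r -> residues D r' ->
    S (x - lat 1%:M k - lat G (U *m r)) -> S (x - lat 1%:M l - lat G (U *m r')) ->
    k = l /\ r = r'.
  move=> hr hr'; rewrite !lat1E -!addrA -!opprD -!latD -!mulmxDr => h1 h2.
  have /(can_inj (mulKmx uU)) /matrixP e := pS _ _ _ h1 h2.
  have e' i : D i * (V *m k) i 0 + r i 0 = D i * (V *m l) i 0 + r' i 0.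
    by have := e i 0; rewrite !mul_diag_mx !mxE.
  have er : r = r'.
    apply/matrixP => i j; rewrite ord1.
    have := congr1 (fun z => (z %% D i)%Z) (e' i); rewrite ![D i * _]mulrC !modzMDl.
    have sm (z : int) : 0 <= z < `|D i| -> (z %% D i)%Z = z.
      by move=> hz; rewrite -modz_abs modz_small.
    by rewrite !sm.
  split=> //; apply: (can_inj (mulKmx uV)); apply/matrixP => i j; rewrite ord1.
  by have := e' i; rewrite er => /addIr /(mulfI (D0 i)).
have mSr r : measurable [set x | S (x - lat G (U *m r))].
  exact: measurable_preimage_translate.
have indT x : csum (fun r => (\1_(residues D) r)%:E * (\1_S (x - lat G (U *m r)) : R)%:E)%E
    = (\1_T x)%:E.
  have [[r0 [hr0 Sr0]]|nT] := pselect (T x).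
    rewrite (csum_single (k0 := r0)).
    - by rewrite !indicE !mem_set ?mule1//; exists r0.
    - by move=> r; rewrite mule_ge0// lee_fin.
    - move=> r rr0; rewrite !indicE; have [hr|nr] := pselect (residues D r); last first.
        by rewrite (memNset nr) mul0e.
      rewrite (@memNset _ S) ?mule0// => Sr; apply: rr0.
      by apply: (resU x 0 0 _ _ hr hr0 _ _).2; rewrite lat0 subr0.
  rewrite [in RHS]indicE memNset//; apply: etrans (@csum0 R 'cV[int]_d).
  apply: eq_csum => r.
  rewrite !indicE; have [hr|nr] := pselect (residues D r); last first.
    by rewrite (memNset nr) mul0e.
  by rewrite (@memNset _ S) ?mule0// => Sr; apply: nT; exists r.
have fT : fundom 1%:M T.
  split; first split.
  - rewrite (_ : T = \bigcup_r (if `[< residues D r >] then [set x | S (x - lat G (U *m r))] else set0)).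
      by apply: countable_bigcupT_measurable => // r; case: ifP.
    apply/seteqP; split => [x [r [hr Sr]]|x [r _]].
      by exists r => //; rewrite asboolT.
    by case: asboolP => // hr Sr; exists r.
  - by move=> x k l [r [hr Sr]] [r' [hr' Sr']]; have [] := resU x k l r r' hr hr' Sr Sr'.
  - move=> x; have [m Sm] := cS x.
    pose r : 'cV[int]_d := \col_i ((invmx U *m m)%R i 0%R %% D i)%Z.
    pose q : 'cV[int]_d := \col_i ((invmx U *m m)%R i 0%R %/ D i)%Z.
    exists (invmx V *m q); exists r; split.
      by move=> i; rewrite mxE modz_ge0 ?ltz_mod//.
    rewrite lat1E -addrA -opprD -latD -mulmxDr mulKVmx//.
    rewrite (_ : _ + r = invmx U *m m) ?mulKVmx//.
    apply/matrixP => i j; rewrite ord1 mul_diag_mx [LHS]mxE ![in LHS]mxE mulrC.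
    by rewrite -divz_eq mxE.
rewrite -(fundom1_measure fT) [RHS]measure_indic; last exact: fT.1.1.
under [RHS]eq_integral do rewrite -indT.
rewrite integral_csum; last 2 first.
- move=> r; apply: emeasurable_funM => //; exact: measurable_indic_translate.
- by move=> r x; rewrite mule_ge0// lee_fin.
rewrite muleC -ge0_csumZl; [|exact: measure_ge0|by move=> r; rewrite lee_fin].
apply: eq_csum => r; rewrite ge0_integralZl; last 4 first.
- exact: measurableT.
- exact: measurable_indic_translate.
- by move=> x _; rewrite lee_fin.
- by rewrite lee_fin.
rewrite muleC; congr (_ * _)%E; rewrite -(measure_translate (lat G (U *m r)) mS).
by rewrite measure_indic//; apply: eq_integral => x _; rewrite !indicE.
Qed.

Lemma measure_diagonal_cell (D : 'I_d -> int) : (forall i, D i != 0) ->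
  leb (cell (invmx (int_mx R (diag_mx (\row_i D i)))) (- 2^-1)) = (\prod_i `|(D i)%:~R : R|^-1)%:E.
Proof.
move=> D0; set M := int_mx R _.
have uM : M \in unitmx.
  by rewrite unitmxE /M /int_mx det_map_mx unitfE intr_eq0 det_diag; apply/prodf_neq0 => i _; rewrite mxE.
have uI : invmx M \in unitmx by rewrite unitmx_inv.
rewrite -measure_closed_cell//.
pose b : 'cV[R]_d := \col_i (2^-1 / `|(D i)%:~R|).
have Dp i : 0 < `|(D i)%:~R : R| by rewrite normr_gt0 intr_eq0.
have -> : closed_cell (invmx M) (- 2^-1) = [set x | forall i, (- b) i 0 <= x i 0 <= b i 0].
  have e x i : (invmx (invmx M) *m x) i 0 = (D i)%:~R * x i 0.
    by rewrite invmxK /M /int_mx map_diag_mx mul_diag_mx !mxE.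
  have e2 x i : (- 2^-1 <= (invmx (invmx M) *m x) i 0 <= - 2^-1 + 1) = ((- b) i 0 <= x i 0 <= b i 0).
    rewrite e (_ : - 2^-1 + 1 = 2^-1 :> R); last by field.
    by rewrite !mxE -!ler_norml normrM ler_pdivlMr// mulrC.
  by apply/seteqP; split => x hx i; have := hx i; rewrite e2.
rewrite lebesgue_cV_box; last first.
  by move=> i; rewrite !mxE -subr_ge0 opprK -mulrDl divr_ge0// addr_ge0// invr_ge0.
congr EFin; apply: eq_bigr => i _; rewrite !mxE opprK -mulrDl.
by rewrite (_ : 2^-1 + 2^-1 = 1 :> R) ?mul1r//; field.
Qed.

(** By the Smith normal form B = U D V, with U and V invertible over the
    integers. The lattices inverse to B and to D both contain Z^d with index
    the number of residues modulo D, so their covolumes agree by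
    [index_measure]; for D the fundamental domain is a box. *)
Lemma measure_fundom_invmx (B : 'M[int]_d) S : \det B != 0 ->
  fundom (invmx (int_mx R B)) S -> leb S = (`|(\det B)%:~R : R|^-1)%:E.
Proof.
have [U uU [V uV [ds _ BE]]] := int_Smith_normal_form B.
pose D (i : 'I_d) : int := ds`_i.
have {}BE : B = U *m diag_mx (\row_i D i) *m V.
  rewrite {1}BE; congr (_ *m _ *m _); apply/matrixP => i j; rewrite !mxE.
  by rewrite -val_eqE; have [->|] := eqVneq i j.
move=> dB fS; have uB : int_mx R B \in unitmx.
  by rewrite unitmxE /int_mx det_map_mx unitfE intr_eq0.
have detB : `|\det B| = \prod_i `|D i|.
  rewrite BE !det_mulmx det_diag !normrM.
  have nu (X : 'M[int]_d) : X \in unitmx -> `|\det X| = 1.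
    by rewrite unitmxE => /unitrP[y [h _]]; have := congr1 (fun z : int => `|z|%N) h; rewrite abszM => /eqP; rewrite muln_eq1 => /andP[_ /eqP e]; rewrite -abszE e.
  by rewrite !nu// mulr1 mul1r normr_prod; apply: eq_bigr => i _; rewrite mxE.
have D0 i : D i != 0.
  by move: dB; rewrite -normr_eq0 detB prodf_seq_neq0 => /allP/(_ i); rewrite normr_eq0; apply; rewrite mem_index_enum.
have h1 := @index_measure _ U V D S uU uV D0 _ fS.
have u1 : (1%:M : 'M[int]_d) \in unitmx by exact: unitmx1.
set M := int_mx R (diag_mx (\row_i D i)).
have uM : M \in unitmx.
  by rewrite unitmxE /M /int_mx det_map_mx unitfE intr_eq0 det_diag; apply/prodf_neq0 => i _; rewrite mxE.
have fD : fundom (invmx M) (cell (invmx M) (- 2^-1)) by apply: fundom_cell; rewrite unitmx_inv.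
have h2 := @index_measure _ 1%:M 1%:M D _ u1 u1 D0 _ fD.
rewrite mul1mx mulmx1 mulVmx// in h2; rewrite -BE mulVmx// in h1.
have {}h1 := h1 erefl; have {}h2 := h2 erefl.
rewrite measure_diagonal_cell// -/M in h2.
have pD : 0 < \prod_i `|(D i)%:~R : R|^-1.
  by apply: prodr_gt0 => i _; rewrite invr_gt0 normr_gt0 intr_eq0.
have -> : `|(\det B)%:~R : R|^-1 = \prod_i `|(D i)%:~R : R|^-1.
  rewrite -intr_norm detB rmorph_prod -prodfV; apply: eq_bigr => i _.
  by rewrite -intr_norm.
move: h1 h2; set c := csum _.
have : (0 <= c)%E by apply: csum_ge0 => r; rewrite lee_fin.
case: c => [c| |]//; last first.
  by move=> _ _; rewrite gt0_mulye ?lte_fin.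
move=> c0 h1 /eqP; rewrite -EFinM eqe => /eqP h2.
have cn0 : c != 0 by apply/eqP => c1; move: h2; rewrite c1 mul0r => /eqP; rewrite eq_sym oner_eq0.
move: h1; case: (leb S) => [s| |].
- rewrite -EFinM => /eqP; rewrite eqe => /eqP h1; congr EFin.
  by apply: (mulfI cn0); rewrite h1 h2.
- by rewrite gt0_muley// lte_fin lt_def cn0.
- by rewrite gt0_muleNy// lte_fin lt_def cn0.
Qed.

End lattice_volume.

(** * Tilings and packings up to null sets *)

Section tilings.
Context (R : realType) (d : nat).
Local Notation leb := (lebesgue_cV R d).
Implicit Types (G : 'M[R]_d) (x v : 'cV[R]_d) (k l r : 'cV[int]_d).
Implicit Types (U T : set 'cV[R]_d).

Lemma translateE U v : translate U v = [set x | U (x - v)].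
Proof.
apply/seteqP; split => [_ [x Ux <-]|x /= Ux]; first by rewrite /= addrK.
by exists (x - v) => //; rewrite subrK.
Qed.

Lemma ZlatticeE : Zlattice = range (lat (1%:M : 'M[R]_d)).
Proof. by apply/seteqP; split => _ [k _ <-]; exists k => //; rewrite lat1. Qed.

Lemma latticeE (A : 'M[int]_d) : lattice R A = range (lat (int_mx R A)).
Proof.
apply/seteqP; split => [_ [_ [k _ <-] <-]|_ [k _ <-]]; first by exists k.
by exists (int_mx R k) => //; exists k.
Qed.

Lemma periodizationE G U : periodization G U = [set x + y | x in U & y in range (lat G)].
Proof.
apply/seteqP; split => [x [k Uk]|_ [x Ux [_ [k _ <-] <-]]].
  by exists (x - lat G k) => //; exists (lat G k); [exists k|rewrite subrK].
by exists k; rewrite addrK.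
Qed.

Lemma bigcup_translate G U : \bigcup_(t in range (lat G)) translate U t = periodization G U.
Proof.
apply/seteqP; split => [x [_ [k _ <-]]|x [k Uk]].
  by rewrite translateE => Uk; exists k.
by exists (lat G k); [exists k|rewrite translateE].
Qed.

Lemma negligible_countable (I : countType) (F : I -> set 'cV[R]_d) :
  (forall i, leb.-negligible (F i)) -> leb.-negligible (\bigcup_i F i).
Proof.
move=> F0; rewrite (_ : \bigcup_i F i = \bigcup_n (if @pickle_inv I n is Some k
    then F k else set0)).
  by apply: negligible_bigcup => n; case: pickle_inv => [k|]; [exact: F0|exact: negligible_set0].
apply/seteqP; split => [x [k _ Fk]|x [n _]].
  by exists (pickle k) => //; rewrite pickleK_inv.
by case: pickle_inv => [k Fk|//]; exists k.
Qed.

Lemma negligible_translate U v : leb.-negligible U -> leb.-negligible [set x | U (x - v)].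
Proof.
move=> [N [mN N0 UN]]; exists [set x | N (x - v)]; split.
- exact: measurable_preimage_translate.
- by apply: etrans N0; exact: measure_translate.
- by move=> x; exact: UN.
Qed.

Lemma negligible_null U : measurable U -> leb.-negligible U <-> leb U = 0%E.
Proof. by move=> mU; split=> [/(measure_negligible mU)|/(negligibleP _ mU)]. Qed.

Lemma packs_disjoint G U : G \in unitmx -> packs U (range (lat G)) ->
  forall k, k <> 0 -> leb (U `&` [set x | U (x - lat G k)]) = 0%E.
Proof.
move=> uG [mU pU] k k0; apply/negligible_null.
  by apply: measurableI => //; exact: measurable_preimage_translate.
have := pU (lat G 0) (lat G k); rewrite !translateE lat0.
rewrite (_ : [set x | U (x - 0)] = U); last by apply/seteqP; split => x /=; rewrite subr0.
apply; [by exists 0; rewrite ?lat0|by exists k|].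
by rewrite -(lat0 G) => /(lat_inj uG) /esym.
Qed.

Lemma disjoint_packs G U : measurable U ->
  (forall k, k <> 0 -> leb (U `&` [set x | U (x - lat G k)]) = 0%E) ->
  packs U (range (lat G)).
Proof.
move=> mU U0; split=> // _ _ [k _ <-] [l _ <-] kl; rewrite !translateE.
have lk : l - k <> 0 by move/eqP; rewrite subr_eq0 => /eqP lk; apply: kl; rewrite lk.
have := U0 _ lk => /negligible_null.
move=> /(_ (measurableI _ _ mU (measurable_preimage_translate _ mU))).
move=> /(negligible_translate (lat G k)); apply: negligibleS => x /= [Uk Ul]; split=> //.
by rewrite latB opprB addrA subrK.
Qed.

Lemma measure_setDI U T : measurable U -> measurable T ->
  leb U = (leb (U `\` T) + leb (U `&` T))%E.
Proof. exact: measureDI. Qed.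

Lemma eq_measure_null U T : measurable U -> measurable T ->
  leb (U `\` T) = 0%E -> leb (T `\` U) = 0%E -> leb U = leb T.
Proof.
move=> mU mT UT TU.
have e V W : measurable V -> measurable W -> leb (V `\` W) = 0%E -> leb V = leb (V `&` W).
  by move=> mV mW VW; rewrite (measure_setDI mV mW) VW add0e.
by rewrite (e U T)// (e T U)// setIC.
Qed.

(** Make the packing exact, then repair the null set left uncovered by adding
    the points of a cell that it misses. *)
Lemma tiles_fundom G U : G \in unitmx -> tiles U (range (lat G)) ->
  exists T, [/\ fundom G T, leb (U `\` T) = 0%E & leb (T `\` U) = 0%E].
Proof.
move=> uG [pU cU]; have [mU _] := pU.
have [U' [[mU' eU'] U'U U'0]] := packing_refine mU (packs_disjoint uG pU).
have mP := measurable_periodization G mU'.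
have [[mC eC] cC] := fundom_cell uG 0.
exists (U' `|` (cell G 0 `\` periodization G U')); split.
- split; first split.
  + by apply: measurableU => //; exact: measurableD.
  + have per x k l : U' (x - lat G k) -> (cell G 0 `\` periodization G U') (x - lat G l) -> False.
      move=> Uk [_]; apply; exists (k - l); rewrite latB opprB addrA subrK; exact: Uk.
    move=> x k l [Uk|Ck] [Ul|Cl]; [exact: eU' Uk Ul|by case: (per _ _ _ Uk Cl)|by case: (per _ _ _ Ul Ck)|].
    exact: (eC _ _ _ Ck.1 Cl.1).
  + move=> x; have [[k Uk]|nU] := pselect (periodization G U' x); first by exists k; left.
    have [k Ck] := cC x; exists k; right; split=> //.
    by rewrite -latN => /periodization_shift.
- apply: (null_sub _ _ _ U'0).
  + by apply: measurableD => //; apply: measurableU => //; exact: measurableD.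
  + exact: measurableD.
  + by move=> x [Ux nT]; split=> // Ux'; apply: nT; left.
- apply/negligible_null.
    by apply: measurableD => //; apply: measurableU => //; exact: measurableD.
  have : leb.-negligible (~` periodization G U `|` periodization G (U `\` U')).
    apply: negligibleU; first by rewrite -bigcup_translate.
    apply/negligible_null; first by apply: measurable_periodization; exact: measurableD.
    by apply: null_periodization => //; exact: measurableD.
  apply: negligibleS => x [[U'x|[_ nx]] nUx]; first by case: nUx; exact: U'U.
  have [[k Uk]|nU] := pselect (periodization G U x); [right|by left].
  by exists k; split=> // U'k; apply: nx; exists k.
Qed.

(** Folding U into a fundamental domain Q preserves volume, so that the
    translates of U miss only a null part of Q, hence of the space. *)
Lemma packs_tiles G U Q : G \in unitmx -> packs U (range (lat G)) -> fundom G Q ->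
  leb U = leb Q -> (leb Q < +oo)%E -> tiles U (range (lat G)).
Proof.
move=> uG pU fQ UQ Qoo; split=> //; have [mU _] := pU; have [[mQ eQ] cQ] := fQ.
have [U' [[mU' eU'] U'U U'0]] := packing_refine mU (packs_disjoint uG pU).
have mP := measurable_periodization G mU'.
have U'Q : leb U' = leb Q.
  rewrite -UQ; apply: eq_measure_null => //.
  by rewrite (_ : _ `\` _ = set0) ?measure0//; apply/seteqP; split => // x [/U'U].
have : leb Q = leb (Q `&` periodization G U').
  rewrite -U'Q [LHS]measure_indic// [RHS]measure_indic; last exact: measurableI.
  transitivity (\int[leb]_x ((fun=> 1%E) x * (\1_U' x)%:E))%E.
    by apply: eq_integral => x _; rewrite mul1e.
  rewrite (integral_packing_fundom (conj mU' eU') fQ)//.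
  by apply: eq_integral => x _; rewrite mul1e indicI /= -EFinM mulrC.
rewrite bigcup_translate => QP.
have QD : leb (Q `\` periodization G U') = 0%E.
  have fI : leb (Q `&` periodization G U') \is a fin_num by rewrite ge0_fin_numE// -QP.
  move: QP; rewrite (measure_setDI mQ mP) -(fineK fI).
  case: (leb (Q `\` _)) => [b| |]//.
  rewrite -EFinD => /eqP; rewrite eqe => /eqP e; congr EFin.
  by apply: (addIr (fine (leb (Q `&` periodization G U')))); rewrite e add0r.
have mD := measurableD mQ mP.
have : leb.-negligible (periodization G (Q `\` periodization G U')).
  by apply/negligible_null; [exact: measurable_periodization|exact: null_periodization].
apply: negligibleS => x nx; have [k Qk] := cQ x; exists k; split=> //.
rewrite -latN => /periodization_shift [l U'l]; apply: nx; exists l; exact: U'U.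
Qed.

Lemma tiles_measure1 U : tiles U Zlattice -> leb U = 1%E.
Proof.
rewrite ZlatticeE => tU; have [mU _] := tU.1.
have [T [fT UT TU]] := tiles_fundom (unitmx1 _ _) tU.
by rewrite (eq_measure_null mU fT.1.1 UT TU) fundom1_measure.
Qed.

End tilings.

Section cosets.
Context (R : realType) (d : nat) (A : 'M[int]_d) (reps : set 'cV[int]_d).
Hypothesis reps_complete : complete_representatives A reps.
Local Notation leb := (lebesgue_cV R d).
Local Notation GA := (int_mx R A).
Variable U : set 'cV[R]_d.
Hypothesis mU : measurable U.
Local Notation UA := (periodization GA U).

Lemma bigcup_cosets : \bigcup_(t in @int_mx R d 1 @` reps) translate UA t =
  periodization 1%:M U.
Proof.
apply/seteqP; split => [x [_ [r _ <-]]|x [k Uk]].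
  rewrite translateE => -[l Ul]; exists (r + A *m l).
  by rewrite lat1 int_mxD int_mxM opprD addrA.
have [r [[hr [m km]] _]] := reps_complete k.
exists (int_mx R r); first by exists r.
rewrite translateE; exists m; rewrite -addrA -opprD.
by rewrite /lat -int_mxM -int_mxD -km [r + _]addrC subrK -lat1.
Qed.

(** The translates of U by Z^d are those of the sets U + A Z^d by the
    representatives, grouped by cosets of A Z^d. *)
Lemma tiles_lattice_cosets : tiles U Zlattice -> tiles UA (@int_mx R d 1 @` reps).
Proof.
rewrite ZlatticeE => -[[_ pU]]; rewrite bigcup_translate => cU.
split; last by rewrite bigcup_cosets.
split; first exact: measurable_periodization.
move=> _ _ [r hr <-] [s hs <-] rs; rewrite !translateE.
apply: (@negligibleS _ _ _ _ (\bigcup_(kl : 'cV[int]_d * 'cV[int]_d)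
   (translate U (lat 1%:M (r + A *m kl.1)) `&` translate U (lat 1%:M (s + A *m kl.2))))).
  move=> x /= [[k Uk] [l Ul]]; exists (k, l) => //; rewrite !translateE /= !lat1 !int_mxD !int_mxM.
  by rewrite !opprD !addrA.
apply: negligible_countable => -[k l] /=; apply: pU.
- by exists (r + A *m k).
- by exists (s + A *m l).
- move/(lat_inj (unitmx1 _ _)) => e; apply: rs; congr int_mx.
  have [q [_ uq]] := reps_complete r; rewrite -(uq r) ?(uq s)//; split=> //.
    by exists (l - k); rewrite mulmxBr; apply/eqP; rewrite subr_eq addrAC [_ + s]addrC -e addrK.
  by exists 0; rewrite subrr mulmx0.
Qed.

(** Two translates of U by vectors of the same coset are almost disjoint by
    the packing hypothesis, and two by vectors of different cosets lie in
    almost disjoint translates of U + A Z^d. *)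
Lemma tiles_cosets_lattice : packs U (range (lat GA)) ->
  tiles UA (@int_mx R d 1 @` reps) -> tiles U Zlattice.
Proof.
move=> [_ pA] [[_ pU]]; rewrite bigcup_cosets => cU; rewrite ZlatticeE.
split; last by rewrite bigcup_translate.
split=> // _ _ [k _ <-] [l _ <-] kl; rewrite !translateE.
have [r [[hr [m km]] _]] := reps_complete k.
have [s [[hs [n ln]] _]] := reps_complete l.
have {}km : k = r + A *m m by rewrite -km addrC subrK.
have {}ln : l = s + A *m n by rewrite -ln addrC subrK.
have [rs|rs] := pselect (r = s).
  have : leb.-negligible (translate U (lat GA m) `&` translate U (lat GA n)).
    apply: pA; [by exists m|by exists n|].
    by move=> mn; apply: kl; rewrite km ln rs !lat1 !int_mxD !int_mxM -/(lat GA m) mn.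
  move=> /(negligible_translate (int_mx R r)); apply: negligibleS => x /=.
  rewrite !translateE /= km ln -rs !lat1 !int_mxD !int_mxM.
  by rewrite !opprD !addrA.
have := pU (int_mx R r) (int_mx R s); rewrite !translateE => h.
apply: (negligibleS _ (h _ _ _)); [|by exists r|by exists s|by move/int_mx_inj].
move=> x /=; rewrite km ln !lat1 !int_mxD !int_mxM !opprD !addrA => -[Um Un].
by split; [exists m|exists n].
Qed.

End cosets.

(** * Square-mean norms and the multiplication formula *)

Section L2norm_energy.
Context d (X : measurableType d) (R : realType).
Implicit Types (nu : {measure set X -> \bar R}) (f g : X -> R[i]).

Lemma L2normE nu f : L2norm nu f = (energy nu f `^ 2^-1)%E.
Proof.
rewrite /L2norm unlock /=; congr (_ `^ _)%E; apply: eq_integral => x _.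
by rewrite ger0_norm ?cmod_ge0// powR_mulrn ?cmod_ge0.
Qed.

Lemma energy_L2norm nu f : energy nu f = (L2norm nu f `^ 2)%E.
Proof.
rewrite L2normE -poweRrM mulVf ?poweRe1//; exact: energy_ge0.
Qed.

Lemma L2norm_lt nu f (e : R) : 0 < e ->
  (energy nu f < (e ^+ 2)%:E)%E -> (L2norm nu f < e%:E)%E.
Proof.
move=> e0 h; rewrite ltNge; apply/negP => eh; move: h; apply/negP; rewrite -leNgt.
rewrite energy_L2norm.
have -> : ((e ^+ 2)%:E = e%:E `^ 2)%E by rewrite poweR_EFin powR_mulrn// ltW.
have L0 : (0 <= L2norm nu f)%E by rewrite L2normE poweR_ge0.
by apply: gt0_ler_poweR; rewrite ?eh ?ler0n// in_itv/= leey ?andbT ?lee_fin ?(ltW e0).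
Qed.

Lemma eq_energy_mrestr nu (D E : set X) (mD : measurable D) (mE : measurable E) f :
  nu (D `\` E) = 0%E -> nu (E `\` D) = 0%E ->
  energy (mrestr nu mD) f = energy (mrestr nu mE) f.
Proof.
move=> DE ED; apply: eq_measure_integral => A mA _.
have e V W : measurable V -> measurable W -> nu (V `\` W) = 0%E ->
    nu (A `&` V) = nu (A `&` V `&` W).
  move=> mV mW VW; have mAV := measurableI _ _ mA mV.
  have : nu (A `&` V) = (nu (A `&` V `\` W) + nu (A `&` V `&` W))%E by exact: measureDI.
  move=> ->; rewrite (_ : nu (_ `\` W) = 0%E) ?add0e//.
  apply/eqP; rewrite eq_le measure_ge0 andbT -VW; apply: le_measure; rewrite ?inE.
  - exact: measurableD.
  - exact: measurableD.
  - by move=> x [[_ Vx] nWx].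
by apply: etrans (e D E mD mE DE) _; rewrite setIAC; apply/esym/e.
Qed.

End L2norm_energy.

Section multiplication_formula.
Context (R : realType) (d : nat).
Local Notation leb := (lebesgue_cV R d).
Implicit Types (f g h : 'cV[R]_d -> R[i]) (t x v : 'cV[R]_d).

Lemma Rintegral_swap (u : 'cV[R]_d * 'cV[R]_d -> R) : measurable_fun setT u ->
  (\int[leb]_t \int[leb]_x (`|u (t, x)|)%:E < +oo)%E ->
  (forall t, leb.-integrable setT (fun x => (u (t, x))%:E)) ->
  (forall x, leb.-integrable setT (fun t => (u (t, x))%:E)) ->
  \int[leb]_t \int[leb]_x u (t, x) = \int[leb]_x \int[leb]_t u (t, x).
Proof.
move=> mu uoo i1 i2; rewrite /Rintegral.
have me : measurable_fun setT (EFin \o u) by exact/measurable_EFinP.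
have iu : (leb \x leb)%E.-integrable setT (EFin \o u) by apply/(@integrable12ltyP _ _ _ _ R leb leb _ me).
congr fine; under eq_integral do rewrite fineK ?integrable_fin_num//.
under [RHS]eq_integral do rewrite fineK ?integrable_fin_num//.
exact: (Fubini iu).
Qed.

(** Fubini's theorem for f x * ekern t x * h t, whose modulus is the product
    of two integrable functions of different variables. *)
Lemma fourier_multiplication f h : in_L1 leb f -> in_L1 leb h ->
  cintegral leb (fun t => fourier f t * h t) = cintegral leb (fun x => f x * fourier h x).
Proof.
move=> f1 h1; pose F t x := f x * ekern t x * h t.
have mF : cmeasurable (fun p : 'cV[R]_d * 'cV[R]_d => F p.1 p.2).
  apply: cmeasurableM; last by apply: cmeasurable_fst; exact: h1.1.
  apply: cmeasurableM; first by apply: cmeasurable_snd; exact: f1.1.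
  exact: cmeasurable_ekern2.
have ekC t x : ekern t x = ekern x t by rewrite /ekern dotprodC.
have F1 t : in_L1 leb (F t).
  rewrite /F; under eq_fun do rewrite mulrC; apply: in_L1Z; exact: in_L1_ekern.
have F2 x : in_L1 leb (fun t => F t x).
  rewrite /F; under eq_fun do rewrite -mulrA [ekern _ _ * _]mulrC ekC.
  by apply: in_L1Z; exact: in_L1_ekern.
have -> : (fun t => fourier f t * h t) = (fun t => cintegral leb (F t)).
  apply/funext => t; rewrite mulrC fourierE -cintegralZ; last exact: in_L1_ekern.
  by congr cintegral; apply/funext => x; rewrite /F mulrC.
have -> : (fun x => f x * fourier h x) = (fun x => cintegral leb (fun t => F t x)).
  apply/funext => x; rewrite fourierE -cintegralZ; last exact: in_L1_ekern.
  by congr cintegral; apply/funext => t; rewrite /F -mulrA [ekern _ _ * _]mulrC ekC.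
have Foo : (\int[leb]_t \int[leb]_x (cmod (F t x))%:E < +oo)%E.
  rewrite (_ : (\int[leb]_t _)%E = (\int[leb]_t ((\int[leb]_x (cmod (f x))%:E) * (cmod (h t))%:E))%E).
    rewrite ge0_integralZl.
    - by rewrite lte_mul_pinfty ?h1.2 ?ge0_fin_numE ?f1.2//; apply: integral_ge0 => x _; rewrite lee_fin cmod_ge0.
    - exact: measurableT.
    - exact: emeasurable_cmod h1.1.
    - by move=> x _; rewrite lee_fin cmod_ge0.
    - by apply: integral_ge0 => x _; rewrite lee_fin cmod_ge0.
  apply: eq_integral => t _; rewrite muleC -ge0_integralZl.
  - by apply: eq_integral => x _; rewrite /F !cmodM cmod_ekern mulr1 mulrC EFinM.
  - exact: measurableT.
  - exact: emeasurable_cmod f1.1.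
  - by move=> x _; rewrite lee_fin cmod_ge0.
  - by rewrite lee_fin cmod_ge0.
have bnd (u : 'cV[R]_d * 'cV[R]_d -> R) : measurable_fun setT u ->
    (forall t x, `|u (t, x)| <= cmod (F t x)) ->
    (\int[leb]_t \int[leb]_x (`|u (t, x)|)%:E < +oo)%E.
  move=> mu uF; apply: le_lt_trans Foo.
  have mnu : measurable_fun setT (fun p => (`|u p|)%:E).
    by apply/measurable_EFinP; exact: measurableT_comp.
  have mcF := emeasurable_cmod mF.
  apply: ge0_le_integral.
  - exact: measurableT.
  - by move=> t _; apply: integral_ge0 => x _; rewrite lee_fin.
  - exact: (@measurable_fun_fubini_tonelli_F _ _ _ _ R leb (fun p => (`|u p|)%:E) mnu (fun p => normr_ge0 _)).
  - exact: (@measurable_fun_fubini_tonelli_F _ _ _ _ R leb (fun p => (cmod (F p.1 p.2))%:E) mcF (fun p => cmod_ge0 _)).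
  move=> t _; apply: ge0_le_integral.
  - exact: measurableT.
  - by move=> x _; rewrite lee_fin.
  - exact: (measurableT_comp mnu (pair1_measurable t)).
  - exact: emeasurable_cmod (F1 t).1.
  - by move=> x _; rewrite lee_fin.
apply: complex_ext => /=.
- apply: (Rintegral_swap (u := fun p => complex.Re (F p.1 p.2))).
  + exact: mF.1.
  + exact: (bnd (fun p => complex.Re (F p.1 p.2)) mF.1 (fun t x => Re_le_cmod _)).
  + by move=> t; exact: (in_L1_Re (F1 t)).
  + by move=> x; exact: (in_L1_Re (F2 x)).
- apply: (Rintegral_swap (u := fun p => complex.Im (F p.1 p.2))).
  + exact: mF.2.
  + exact: (bnd (fun p => complex.Im (F p.1 p.2)) mF.2 (fun t x => Im_le_cmod _)).
  + by move=> t; exact: (in_L1_Im (F1 t)).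
  + by move=> x; exact: (in_L1_Im (F2 x)).
Qed.

End multiplication_formula.

(** * The support of the pair measure *)

Section dual_cell.
Context (R : realType) (d : nat) (A : 'M[int]_d).
Hypothesis detA : \det A != 0.
Local Notation leb := (lebesgue_cV R d).
Local Notation GA := (int_mx R A).

Lemma int_mx_unit : GA \in unitmx.
Proof. by rewrite unitmxE /int_mx det_map_mx unitfE intr_eq0. Qed.

Lemma dual1 : dual (1%:M : 'M[R]_d) = 1%:M.
Proof. by rewrite /dual invmx1 trmx1. Qed.

Lemma dual_int_mx : dual GA *m int_mx R A^T = 1%:M.
Proof. by rewrite /dual /int_mx -map_trmx -trmx_mul mulmxV ?trmx1 ?int_mx_unit. Qed.

Lemma unit_dual : dual GA \in unitmx.
Proof. by rewrite dual_unit int_mx_unit. Qed.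

(** A half-open version of the parallelepiped in the definition of the pair
    measure, so that it is exactly a fundamental domain of the dual lattice
    of A Z^d. *)
Definition dual_cell : set 'cV[R]_d := cell (dual GA) (- 2^-1).

Lemma fundom_dual_cell : fundom (dual GA) dual_cell.
Proof. exact: fundom_cell unit_dual _. Qed.

Lemma measure_dual_cell : leb dual_cell = (`|(\det A)%:~R : R|^-1)%:E.
Proof.
rewrite -det_tr; apply: measure_fundom_invmx; first by rewrite det_tr.
rewrite (_ : invmx (int_mx R A^T) = dual GA); first exact: fundom_dual_cell.
by rewrite /dual trmx_inv /int_mx map_trmx.
Qed.

Lemma dual_cell_gt0 : (0 < leb dual_cell)%E.
Proof. by rewrite measure_dual_cell lte_fin invr_gt0 normr_gt0 intr_eq0. Qed.

Lemma dual_cell_lty : (leb dual_cell < +oo)%E.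
Proof. by rewrite measure_dual_cell ltry. Qed.

(** The dual lattice of A Z^d contains Z^d. *)
Lemma exact_packing_dual_cell : exact_packing (dual 1%:M) dual_cell.
Proof.
rewrite dual1 -dual_int_mx; apply: exact_packing_sublattice fundom_dual_cell.
by rewrite dual_int_mx unitmx1.
Qed.

Definition dual_cells : set 'cV[R]_d := periodization 1%:M dual_cell.

Lemma measurable_dual_cells : measurable dual_cells.
Proof. by apply: measurable_periodization; exact: fundom_dual_cell.1.1. Qed.

Lemma dual_support_cells : leb (dual_support A `\` dual_cells) = 0%E /\
  leb (dual_cells `\` dual_support A) = 0%E.
Proof.
have mc : measurable dual_cell by exact: fundom_dual_cell.1.1.
have mC := measurable_closed_cell (dual GA) (- 2^-1).
have cC : dual_cell `<=` closed_cell (dual GA) (- 2^-1) by exact: cell_closed_cell.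
have invE : invmx (dual GA) = GA^T by rewrite /dual trmx_inv invmxK.
have uT : GA^T \in unitmx by rewrite unitmx_tr int_mx_unit.
have h2 : - 2^-1 + 1 = 2^-1 :> R by field.
have E : dual_support A = periodization 1%:M (closed_cell (dual GA) (- 2^-1)).
  apply/seteqP; split => [_ [_ [y hy <-] [_ [k _ <-] <-]]|x [k Ck]].
    by exists k => i; rewrite lat1 addrK invE mulKVmx// h2; exact: hy.
  exists (x - int_mx R k); last by exists (int_mx R k); [exists k|rewrite subrK].
  exists (GA^T *m (x - int_mx R k)); last by rewrite mulKmx.
  by move=> i; have := Ck i; rewrite lat1 invE h2.
rewrite E; split; last first.
  rewrite (_ : _ `\` _ = set0) ?measure0//; apply/seteqP; split => // x [[k Sk]].
  by apply; exists k; exact: cC.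
apply: (null_sub _ _ (U := periodization 1%:M (closed_cell (dual GA) (- 2^-1) `\` dual_cell))).
- by apply: measurableD; [exact: measurable_periodization|exact: measurable_dual_cells].
- by apply: measurable_periodization; exact: measurableD.
- by move=> x [[k Ck] nx]; exists k; split=> // Sk; apply: nx; exists k.
- apply: null_periodization; first exact: measurableD.
  exact: (closed_cell_null unit_dual).
Qed.

(** The support of the pair measure and [dual_cells] differ by translates of
    the boundary of a cell. *)
Lemma energy_pair_measure (U : set 'cV[R]_d) f : cmeasurable f ->
  energy (pair_measure U detA) f = ((`|(\det A)%:~R : R| / fine (leb U))%:E *
    energy (mrestr leb measurable_dual_cells) f)%E.
Proof.
move=> mf; rewrite /pair_measure /energy ge0_integral_mscale.
- congr (_ * _)%E; have [h1 h2] := dual_support_cells.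
  exact: eq_energy_mrestr.
- exact: measurableT.
- exact: emeasurable_cmod2.
- by move=> x _; rewrite lee_fin sqr_ge0.
Qed.

End dual_cell.
Arguments dual_cell R [d] A _.
Arguments dual_cells R [d] A _.

(** * Bounded windows and square-mean inner products *)

Section windows.
Context (R : realType) (d : nat).
Local Notation leb := (lebesgue_cV R d).

Definition window (n : nat) : set 'cV[R]_d := [set x | forall i, `|x i 0| <= n%:R].

Lemma measurable_window n : measurable (window n).
Proof.
apply: measurable_forall => i.
have := measurable_coord_cV i 0 measurableT (measurable_itv `[- (n%:R : R), n%:R]).
rewrite setTI (_ : _ @^-1` _ = [set x : 'cV[R]_d | `|x i 0| <= n%:R])//.
by apply/seteqP; split => x /=; rewrite in_itv/= ler_norml.
Qed.

Lemma window_lty n : (leb (window n) < +oo)%E.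
Proof.
rewrite (_ : window n = [set x | forall i, (const_mx (- n%:R) : 'cV[R]_d) i 0 <= x i 0
    <= (const_mx n%:R : 'cV[R]_d) i 0]).
  rewrite lebesgue_cV_box ?ltry// => i; rewrite !mxE.
  by rewrite -subr_ge0 opprK addr_ge0.
by apply/seteqP; split => x hx i; have := hx i; rewrite /= !mxE ler_norml.
Qed.

Lemma window_bounded (K : set 'cV[R]_d) (M : 'I_d -> R) :
  (forall x i, K x -> `|x i 0| <= M i) -> exists n, K `<=` window n.
Proof.
move=> KM; pose S := \sum_i `|M i|.
have S0 : 0 <= S by apply: sumr_ge0.
exists (Num.bound S) => x Kx i; apply: (le_trans (KM x i Kx)).
apply: (@le_trans _ _ S); last by rewrite ltW// archi_boundP.
by rewrite /S (bigD1 i)//= (le_trans (ler_norm _))// lerDl sumr_ge0.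
Qed.

Lemma window_near x : \forall n \near \oo, window n x.
Proof.
have [n hn] := @window_bounded [set x] (fun i => `|x i 0|) ltac:(by move=> y i ->).
exists n => // m /= nm i; apply: (le_trans (hn x erefl i)).
by rewrite ler_nat.
Qed.

(** The coordinates of the points of a compact set are bounded. *)
Lemma compact_window (K : set 'cV[R]_d) : compact K -> exists n, K `<=` window n.
Proof.
move=> cK.
have bK i : exists M : R, forall x, K x -> `|x i 0| <= M.
  have : compact [set x i 0 | x in K].
    apply: continuous_compact => //; apply: continuous_subspaceT.
    exact: coord_continuous.
  move/compact_bounded => [M [_ hM]]; exists (M + 1) => x Kx.
  by apply: (hM (M + 1)); [rewrite ltrDl|exists x].
have /choice[M hM] := bK.
by apply: (@window_bounded K M) => x i Kx; exact: hM.
Qed.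

End windows.

Section energy_inner.
Context d (X : measurableType d) (R : realType).
Implicit Types (nu : {measure set X -> \bar R}) (f g : X -> R[i]).

Lemma energyZ nu c f : cmeasurable f ->
  energy nu (fun x => c * f x) = ((cmod c ^+ 2)%:E * energy nu f)%E.
Proof.
move=> mf; rewrite /energy -ge0_integralZl.
- by apply: eq_integral => x _; rewrite cmodM exprMn EFinM.
- exact: measurableT.
- exact: emeasurable_cmod2.
- by move=> x _; rewrite lee_fin sqr_ge0.
- by rewrite lee_fin sqr_ge0.
Qed.

Lemma energy_conj nu f : energy nu (fun x => conjc (f x)) = energy nu f.
Proof. by apply: eq_integral => x _; rewrite cmod_conj. Qed.

Lemma energy_fin nu f : in_L2 nu f -> energy nu f = (fine (energy nu f))%:E.
Proof. by move=> [_ foo]; rewrite fineK// ge0_fin_numE// energy_ge0. Qed.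

Lemma in_L1_mul_conj nu f g : in_L2 nu f -> in_L2 nu g ->
  in_L1 nu (fun x => f x * conjc (g x)).
Proof.
move=> [mf foo] [mg goo]; have mfg := cmeasurableM mf (cmeasurable_conj mg).
split=> //; apply: (@le_lt_trans _ _ (energy nu f + energy nu g)%E); last first.
  by rewrite lte_add_pinfty.
rewrite -ge0_integralD.
- apply: ge0_le_integral.
  + exact: measurableT.
  + by move=> x _; rewrite lee_fin cmod_ge0.
  + exact: emeasurable_cmod.
  + by apply: emeasurable_funD; exact: emeasurable_cmod2.
  + move=> x _; rewrite -EFinD lee_fin cmodM cmod_conj.
    have := sqr_ge0 (cmod (f x) - cmod (g x)); have := cmod_ge0 (f x); have := cmod_ge0 (g x).
    nra.
- exact: measurableT.
- by move=> x _; rewrite lee_fin sqr_ge0.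
- exact: emeasurable_cmod2.
- by move=> x _; rewrite lee_fin sqr_ge0.
- exact: emeasurable_cmod2.
Qed.

Lemma energyB_inner nu f g : in_L2 nu f -> in_L2 nu g ->
  energy nu (fun x => f x - g x) =
  (fine (energy nu f) + fine (energy nu g)
   - 2 * complex.Re (cintegral nu (fun x => f x * conjc (g x))))%:E.
Proof.
move=> f2 g2; have fg1 := in_L1_mul_conj f2 g2.
have i2 h : in_L2 nu h -> nu.-integrable setT (fun x => (cmod (h x) ^+ 2)%:E).
  move=> [mh hoo]; apply/integrableP; split; first exact: emeasurable_cmod2.
  by apply: le_lt_trans hoo; under eq_integral do rewrite abse_EFin ger0_norm ?sqr_ge0//.
have iRe := in_L1_Re fg1.
rewrite EFinB EFinD -!energy_fin// EFinM [X in (_ - _ * X)%E](_ : _ =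
  \int[nu]_x (complex.Re (f x * conjc (g x)))%:E)%E; last first.
  by rewrite fineK// integrable_fin_num.
rewrite -integralZl//; rewrite -integralD//; [|exact: i2|exact: i2].
rewrite -integralB//; [|by apply: integrableD => //; exact: i2|exact: integrableZl].
by apply: eq_integral => x _; rewrite cmod2_sub -EFinM -!EFinD; congr EFin; ring.
Qed.

End energy_inner.

(** * Isometry and density of the Fourier transform *)

Section spectrality.
Context (R : realType) (d : nat) (A : 'M[int]_d).
Hypothesis detA : \det A != 0.
Local Notation leb := (lebesgue_cV R d).
Local Notation GA := (int_mx R A).
Local Notation S := (dual_cells R A).
Local Notation mS := (@measurable_dual_cells R d A detA).
Local Notation nuS := (mrestr leb mS).
Context (T : set 'cV[R]_d) (fT : fundom 1%:M T).
Local Notation OmT := (periodization GA T).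
Implicit Types (f g h : 'cV[R]_d -> R[i]) (t x : 'cV[R]_d).

(** Case G = 1, L = A Z^d of [plancherel]. *)
Lemma plancherel_dual_cells f : in_L1 leb f -> in_L2 leb f ->
  (forall x, f x != 0 -> OmT x) ->
  energy nuS (fourier f) = (leb (dual_cell R A) * energy leb f)%E.
Proof.
move=> f1 f2 fO.
have u1 : (1%:M : 'M[R]_d) \in unitmx by exact: unitmx1.
have uL : (1%:M *m GA : 'M[R]_d) \in unitmx by rewrite mul1mx int_mx_unit.
have fS0 : fundom (dual (1%:M *m GA)) (dual_cell R A).
  by rewrite mul1mx; exact: fundom_dual_cell.
have fO' x : f x != 0 -> periodization (1%:M *m GA) T x by rewrite mul1mx; exact: fO.
have Too : (leb T < +oo)%E by rewrite fundom1_measure// ltry.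
have T0 : (0 < leb T)%E by rewrite fundom1_measure// lte01.
have := plancherel u1 uL fT fS0 Too T0 (dual_cell_lty R detA)
  (exact_packing_dual_cell R detA) f1 f2 fO'.
rewrite (fundom1_measure fT) mul1e => <-.
apply: eq_energy_mrestr; rewrite dual1.
- by apply: etrans (measure0 leb); congr (leb _); exact: setDv.
- by apply: etrans (measure0 leb); congr (leb _); exact: setDv.
Qed.

Lemma exact_packing_int_mx : exact_packing GA T.
Proof.
have : exact_packing (1%:M *m GA) T.
  by apply: exact_packing_sublattice fT; rewrite mul1mx int_mx_unit.
by rewrite mul1mx.
Qed.

(** Case of [plancherel] where G is the dual lattice of A Z^d and L = Z^d: the
    roles of the two tiles T and [dual_cell] are exchanged. *)
Lemma plancherel_periodization (mO : measurable OmT) h : in_L1 leb h -> in_L2 leb h ->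
  (forall t, h t != 0 -> S t) ->
  energy (mrestr leb mO) (fourier h) = (leb (dual_cell R A) * energy leb h)%E.
Proof.
move=> h1 h2 hS.
have uL : (dual GA *m int_mx R A^T) \in unitmx by rewrite dual_int_mx// unitmx1.
have fS0 : fundom (dual (dual GA *m int_mx R A^T)) T by rewrite dual_int_mx// dual1.
have hS' t : h t != 0 -> periodization (dual GA *m int_mx R A^T) (dual_cell R A) t.
  by rewrite dual_int_mx//; exact: hS.
have Too : (leb T < +oo)%E by rewrite fundom1_measure// ltry.
have T0 : (0 < leb T)%E by rewrite fundom1_measure// lte01.
have pT : exact_packing (dual (dual GA)) T by rewrite dualK; exact: exact_packing_int_mx.
have := plancherel (unit_dual R detA) uL (fundom_dual_cell R detA) fS0 (dual_cell_lty R detA)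
  (dual_cell_gt0 R detA) Too pT h1 h2 hS'.
rewrite (fundom1_measure fT) mule1 => <-.
apply: eq_energy_mrestr; rewrite dualK.
- by apply: etrans (measure0 leb); congr (leb _); exact: setDv.
- by apply: etrans (measure0 leb); congr (leb _); exact: setDv.
Qed.

Context (Om : set 'cV[R]_d) (mOm : measurable Om).
Hypothesis OmOmT : leb (Om `\` OmT) = 0%E.
Hypothesis OmTOm : leb (OmT `\` Om) = 0%E.
Local Notation D := (`|(\det A)%:~R : R|).
Context (mu : {measure set 'cV[R]_d -> \bar R}).
Hypothesis muE : forall f, cmeasurable f -> energy mu f = (D%:E * energy nuS f)%E.

Let mOmT : measurable OmT.
Proof. by apply: measurable_periodization; exact: fT.1.1. Qed.

Lemma abs_det_gt0 : 0 < D.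
Proof. by rewrite normr_gt0 intr_eq0. Qed.

(** Replacing f by its restriction to the exact periodization of T changes it
    on a null set only. *)
Lemma fourier_isometry f : in_L1 leb f -> in_L2 leb f -> supported Om f ->
  energy mu (fourier f) = energy leb f.
Proof.
move=> f1 f2 fO; pose f' := trunc f OmT.
have mf := f1.1.
have mf' : cmeasurable f' by exact: cmeasurable_trunc.
have f'1 : in_L1 leb f' by apply: (in_L1_le mf' f1) => x; exact: cmod_trunc_le.
have aeff' : {ae leb, forall x, f x = f' x}.
  exists (Om `\` OmT); split; [exact: measurableD|exact: OmOmT|] => x /= ff'.
  split.
    by apply: contrapT => nO; apply: ff'; rewrite /f' /trunc (fO _ nO) mul0r.
  by move=> Ox; apply: ff'; rewrite /f' /trunc indicE mem_set// mulr1.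
have f'2 : in_L2 leb f'.
  apply/in_L2_energy; split=> //.
  by rewrite -(ae_eq_energy mf mf' aeff'); exact: f2.2.
have -> : fourier f = fourier f' by apply/funext => t; exact: fourier_ae.
rewrite muE; last exact: cmeasurable_fourier.
rewrite plancherel_dual_cells//; last first.
  move=> x; apply: contraNP => nO; rewrite /f' /trunc indicE memNset//.
  by rewrite mulr0.
rewrite (measure_dual_cell R detA) muleA -EFinM divff ?gt_eqF ?abs_det_gt0// mul1e.
exact/esym/ae_eq_energy.
Qed.

Lemma energy_dual_eq f g : cmeasurable f -> cmeasurable g ->
  (forall t, S t -> f t = g t) -> energy nuS f = energy nuS g.
Proof.
move=> mf mg fg; rewrite !energy_mrestr//; apply: eq_integral => t _.
have [St|nSt] := pselect (S t); first by rewrite fg.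
by rewrite indicE memNset// !mule0.
Qed.

(** By [plancherel_periodization] the inverse transform f of g' is square
    integrable on Om, with the energy of g' for mu. By the multiplication
    formula the inner product in L^2(mu) of g' with the transform of a
    truncation f_n of f is the energy of f_n, so the difference between that
    transform and g' has the energy of f minus the energy of f_n. *)
Lemma fourier_dense_step g' : in_L1 leb g' -> in_L2 leb g' ->
  (forall t, ~ S t -> g' t = 0) -> forall e : R, 0 < e ->
  exists2 f, L1L2_on Om f & (energy mu (fun t => fourier f t - g' t)%R < e%:E)%E.
Proof.
move=> g1 g2 gS e e0; pose h t := conjc (g' t).
have h1 : in_L1 leb h by exact: in_L1_conj.
have h2 : in_L2 leb h.
  by apply/in_L2_energy; split; [exact: h1.1|rewrite energy_conj; exact: g2.2].
have hS t : ~ S t -> h t = 0 by move=> nS; rewrite /h gS// rmorph0.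
have mh := cmeasurable_fourier h1.1.
(* The inverse transform of g', up to the density |det A| of mu. *)
pose f0 x := (D%:C)%C * conjc (fourier h x).
have mf0 : cmeasurable f0.
  by apply: cmeasurableM; [exact: cmeasurable_cst|exact: cmeasurable_conj].
have mI : measurable (Om `&` OmT) by exact: measurableI.
pose f := trunc f0 (Om `&` OmT).
have mf : cmeasurable f by exact: cmeasurable_trunc.
have Ef : energy leb f = (D%:E * energy leb g')%E.
  have -> : energy leb f = energy (mrestr leb mI) f0.
    rewrite energy_mrestr// /energy; apply: eq_integral => x _.
    by rewrite /f /trunc cmodM exprMn cmod_real EFinM indicE; case: (_ \in _); rewrite ?normr1 ?normr0 ?expr1n ?expr0n ?mulr1.
  rewrite (@eq_energy_mrestr _ _ _ _ _ _ mI mOmT); last 2 first.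
  - by apply: etrans (measure0 leb); congr (leb _); apply/seteqP; split => // x [[_ ?] ?].
  - apply: etrans OmTOm; congr (leb _); apply/seteqP; split => x [OTx nx]; split=> //.
      by move=> Ox; apply: nx.
    by case.
  rewrite /f0 energyZ; last exact: cmeasurable_conj.
  rewrite energy_conj plancherel_periodization//; last first.
    by move=> t; apply: contraNP => nS; rewrite hS.
  rewrite energy_conj (measure_dual_cell R detA) muleA -EFinM; congr (_%:E * _)%E.
  by rewrite cmod_real normr_id expr2 mulfK// gt_eqF// abs_det_gt0.
have f2 : in_L2 leb f.
  apply/in_L2_energy; split=> //; rewrite Ef lte_mul_pinfty ?lee_fin//.
  exact: g2.2.
pose f_ n := trunc f (window n).
have mf_ n : cmeasurable (f_ n) by apply: cmeasurable_trunc => //; exact: measurable_window.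
have f_2 n : in_L2 leb (f_ n).
  apply/in_L2_energy; split=> //; apply: le_lt_trans f2.2.
  by apply: energy_le => // x; exact: cmod_trunc_le.
have f_1 n : in_L1 leb (f_ n).
  apply: (in_L2_L1 (measurable_window n) (window_lty R d n)) => // x nw.
  by rewrite /f_ /trunc indicE memNset// mulr0.
have f_O n : supported Om (f_ n).
  move=> x nO; rewrite /f_ /f /trunc [\1_(Om `&` OmT) x]indicE memNset; last by case.
  by rewrite mulr0 mul0r.
have Ef_cvg : (fun n => energy leb (f_ n)) @ \oo --> energy leb f.
  apply: trunc_energy_cvg => //; first by move=> n; exact: measurable_window.
  - by move=> x _; exact: window_near.
  - exact: f2.2.
have [n hn] : exists n, (energy leb f < energy leb (f_ n) + e%:E)%E.
  have : \forall n \near \oo, (energy leb f - e%:E < energy leb (f_ n))%E.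
    have lt : (energy leb f - e%:E < energy leb f)%E.
      by rewrite (energy_fin f2) -EFinB lte_fin ltrBlDr ltrDl.
    have := open_nbhs_nbhs (conj (@open_ereal_gt_ereal R (energy leb f - e%:E)%E) lt).
    exact: Ef_cvg.
  case=> n _ /(_ n (leqnn n)) hn; exists n.
  by rewrite -lteBlDr.
exists (f_ n); first by split; [exact: f_O|exact: f_1|exact: f_2].
have EF : (D%:E * energy nuS (fourier (f_ n)))%E = energy leb (f_ n).
  by rewrite -muE ?fourier_isometry//; exact: cmeasurable_fourier.
have Eg : energy nuS g' = energy leb g' by apply: energy_mrestr_supp => //; exact: g1.1.
have F2 : in_L2 nuS (fourier (f_ n)).
  apply/in_L2_energy; split; first exact: cmeasurable_fourier.
  rewrite ltey; apply/eqP => Eoo; move: EF; rewrite Eoo gt0_muley ?lte_fin ?abs_det_gt0// => /esym.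
  by rewrite (energy_fin (f_2 n)).
have gS2 : in_L2 nuS g' by apply/in_L2_energy; split; [exact: g1.1|rewrite Eg; exact: g2.2].
have cross : complex.Re (cintegral nuS (fun t => fourier (f_ n) t * h t)) =
    fine (energy leb (f_ n)) / D.
  rewrite cintegral_mrestr; last 2 first.
  - by apply: cmeasurableM; [exact: cmeasurable_fourier|exact: h1.1].
  - by move=> t nS; rewrite hS// mulr0.
  rewrite fourier_multiplication//.
  have -> : (fun x => f_ n x * fourier h x) = (fun x => ((D^-1)%:C)%C * ((cmod (f_ n x) ^+ 2)%:C)%C).
    apply/funext => x; have [->|fx] := eqVneq (f_ n x) 0.
      by rewrite mul0r cmod0 expr0n mulr0.
    have hx : f_ n x = (D%:C)%C * conjc (fourier h x).
      move: fx; rewrite /f_ /f /trunc !indicE.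
      by case: (_ \in _); case: (_ \in _); rewrite ?mulr0 ?mul0r ?eqxx// !mulr1.
    rewrite -mul_conj mulrCA; congr (_ * _).
    rewrite hx conjM conj_conj mulrA conjc_real -rmorphM mulVf ?mul1r//.
    by rewrite gt_eqF// abs_det_gt0.
  rewrite cintegralZ; last first.
    have := in_L1_mul_conj (f_2 n) (f_2 n).
    by congr in_L1; apply/funext => x; rewrite mul_conj.
  by rewrite Re_mul /= mul0r subr0 mulrC.
rewrite muE; last by apply: cmeasurableB; [exact: cmeasurable_fourier|exact: g1.1].
rewrite energyB_inner// cross Eg -EFinM lte_fin.
have EF' : D * fine (energy nuS (fourier (f_ n))) = fine (energy leb (f_ n)).
  by rewrite -EF (energy_fin F2).
have Ef' : fine (energy leb f) = D * fine (energy leb g').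
  by rewrite Ef (energy_fin g2).
move: hn; rewrite (energy_fin f2) (energy_fin (f_2 n)) -EFinD lte_fin Ef' => hn.
rewrite mulrBr mulrDr EF' mulrCA [D * (_ / D)]mulrCA divff ?gt_eqF ?abs_det_gt0// mulr1.
by lra.
Qed.

(** Restrict g to the support of mu and to a large window, where it is also
    integrable, and apply [fourier_dense_step]. *)
Lemma fourier_dense g : in_L2 mu g -> forall eps : R, 0 < eps ->
  exists2 f, L1L2_on Om f & (L2norm mu (fourier f \- g)%R < eps%:E)%E.
Proof.
move=> [mg goo] eps eps0; pose g0 := trunc g S.
have mg0 : cmeasurable g0 by exact: (cmeasurable_trunc mg mS).
have e8 : 0 < eps ^+ 2 / 8 by rewrite divr_gt0// exprn_gt0.
have g00 t : ~ S t -> g0 t = 0 by move=> nS; rewrite /g0 /trunc indicE memNset// mulr0.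
have g0S t : S t -> g0 t = g t by move=> St; rewrite /g0 /trunc indicE mem_set// mulr1.
have Eg0 : (energy leb g0 < +oo)%E.
  rewrite -(energy_mrestr_supp leb mS mg0 g00) (energy_dual_eq mg0 mg g0S).
  rewrite ltey; apply/eqP => Eoo; move: goo; rewrite -/(energy mu g) muE// Eoo.
  by rewrite gt0_muley ?lte_fin ?abs_det_gt0.
pose g_ n := trunc g0 (window n).
have mg_ n : cmeasurable (g_ n) by apply: cmeasurable_trunc => //; exact: measurable_window.
have cvg0 : (fun n => energy leb (fun t => g_ n t - g0 t)%R) @ \oo --> 0%E.
  apply: trunc_energy_cvg0 => //; first by move=> n; exact: measurable_window.
  by move=> x _; exact: window_near.
have eD : 0 < eps ^+ 2 / 8 / D by rewrite divr_gt0// abs_det_gt0.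
have [n _ /(_ n (leqnn n)) hn] : \forall n \near \oo,
    (energy leb (fun t => g_ n t - g0 t)%R < (eps ^+ 2 / 8 / D)%:E)%E.
  by apply: (ecvg_lt_near cvg0); rewrite lte_fin.
have g_2 : in_L2 leb (g_ n).
  apply/in_L2_energy; split=> //; apply: le_lt_trans Eg0.
  by apply: energy_le => // x; exact: cmod_trunc_le.
have g_1 : in_L1 leb (g_ n).
  apply: (in_L2_L1 (measurable_window n) (window_lty R d n)) => // x nw.
  by rewrite /g_ /trunc indicE memNset// mulr0.
have g_S t : ~ S t -> g_ n t = 0 by move=> nS; rewrite /g_ /trunc g00// mul0r.
have [f fL hf] := fourier_dense_step g_1 g_2 g_S e8.
exists f => //; apply: L2norm_lt => //.
have mF : cmeasurable (fourier f) by apply: cmeasurable_fourier; case: fL => _ [].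
have -> : (fourier f \- g)%R = (fun t => (fourier f t - g_ n t) + (g_ n t - g t)).
  by apply/funext => t /=; rewrite addrA subrK.
have mB1 := cmeasurableB mF (mg_ n); have mB2 := cmeasurableB (mg_ n) mg.
apply: le_lt_trans (energyD _ mB1 mB2) _.
have h2 : (energy mu (fun t => g_ n t - g t)%R < (eps ^+ 2 / 8)%:E)%E.
  rewrite muE// (energy_dual_eq mB2 (cmeasurableB (mg_ n) mg0)); last first.
    by move=> t St; rewrite g0S.
  rewrite energy_mrestr_supp; last 2 first.
  - exact: cmeasurableB.
  - by move=> t nS; rewrite g_S// g00// subr0.
  by rewrite -lte_pdivlMl ?abs_det_gt0// -EFinM mulrC.
have -> : ((eps ^+ 2)%:E = 2%:E * (eps ^+ 2 / 4)%:E + 2%:E * (eps ^+ 2 / 4)%:E)%E.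
  by rewrite -EFinM -EFinD; congr EFin; field.
have e48 : ((eps ^+ 2 / 8)%:E <= (eps ^+ 2 / 4)%:E)%E.
  by rewrite lee_fin; have := e8; lra.
by apply: lteD; rewrite lte_pmul2l//; [apply: lt_le_trans hf e48|apply: lt_le_trans h2 e48].
Qed.

End spectrality.

(** * Completeness of L^2 *)

Lemma ecvg0_le (R : realType) (u : nat -> \bar R) : (forall n, 0 <= u n)%E ->
  (forall e : R, 0 < e -> exists N, forall n, (N <= n)%N -> (u n <= e%:E)%E) ->
  u @ \oo --> 0%E.
Proof.
move=> u0 ue; apply/fine_cvgP; split.
  have [N hN] := ue 1 ltr01; exists N => // n /= /hN h.
  by rewrite ge0_fin_numE// (le_lt_trans h)// ltry.
apply/cvgrPdist_le => e e0; have [N hN] := ue e e0; exists N => // n /= /hN h.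
have fu : u n \is a fin_num by rewrite ge0_fin_numE// (le_lt_trans h)// ltry.
by rewrite sub0r normrN ger0_norm ?fine_ge0// -lee_fin fineK.
Qed.

Lemma ecvg0_lin (R : realType) (a b : R) (u v w : nat -> \bar R) :
  u @ \oo --> 0%E -> v @ \oo --> 0%E -> (forall n, 0 <= w n)%E ->
  (forall n, w n <= a%:E * u n + b%:E * v n)%E -> w @ \oo --> 0%E.
Proof.
move=> u0 v0 w0 wuv.
apply: (squeeze_cvge (f := fun=> 0%E) (h := fun n => (a%:E * u n + b%:E * v n)%E)).
- by apply: nearW => n; rewrite w0 wuv.
- exact: cvg_cst.
- rewrite -[X in _ --> X]adde0; apply: cvgeD => //.
    by rewrite -(mule0 a%:E); apply: cvgeZl.
  by rewrite -(mule0 b%:E); apply: cvgeZl.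
Qed.

Section L2_completeness.
Context d (X : measurableType d) (R : realType).
Implicit Types (nu : {measure set X -> \bar R}) (f g : X -> R[i]).

Lemma sum_half_powers n : \sum_(0 <= k < n) (2^-1 : R) ^+ k <= 2.
Proof.
suff -> : \sum_(0 <= k < n) (2^-1 : R) ^+ k = 2 - 2 * 2^-1 ^+ n.
  by rewrite lerBlDr lerDl mulr_ge0// exprn_ge0// invr_ge0.
elim: n => [|n IH]; first by rewrite big_geq// expr0 mulr1 subrr.
by rewrite big_nat_recr//= IH exprS; field.
Qed.

(** The variation |u (k+1) - u k| is at most 2^k |u (k+1) - u k|^2 + 2^-k. *)
Lemma cvg_of_square_sum (u : nat -> R) (M : R) :
  (forall n, \sum_(0 <= k < n) 2 ^+ k * (u k.+1 - u k) ^+ 2 <= M) -> cvgn u.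
Proof.
move=> uM; have : cvgn (series (telescope u)).
  apply: normed_cvg; apply: nondecreasing_is_cvgn.
    by apply: nondecreasing_series => n _ _; exact: normr_ge0.
  exists (M + 2) => _ [n _ <-]; apply: le_trans (lerD (uM n) (sum_half_powers n)).
  rewrite -big_split/= ; apply: ler_sum => k _; rewrite /telescope.
  have t0 : 0 < (2 : R) ^+ k by rewrite exprn_gt0.
  rewrite exprVn; set t := 2 ^+ k in t0 *; set v := u k.+1 - u k.
  rewrite -(ler_pM2l t0) mulrDr divff ?gt_eqF// -real_normK ?num_real//.
  have := sqr_ge0 (t * `|v| - 1); have : 0 <= t * `|v| by rewrite mulr_ge0// ltW.
  nra.
rewrite telescopeK => cu.
rewrite (_ : u = (fun n => u n - u 0%N) \+ cst (u 0%N)).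
  by apply: is_cvgD => //; exact: is_cvg_cst.
by apply/funext => n /=; rewrite subrK.
Qed.

Lemma cvg_dist0 (u : nat -> R) (l : R) : u @ \oo --> l -> (fun n => `|u n - l|) @ \oo --> (0 : R).
Proof.
move=> ul; rewrite -(@normr0 R R) -(subrr l); apply: cvg_norm.
by apply: cvgB => //; exact: cvg_cst.
Qed.

(** The sum over k of 2^k |G (k+1) - G k|^2 has a finite integral, hence is
    finite almost everywhere, and [cvg_of_square_sum] applies to the real and
    imaginary parts. Setting G to 0 at the other points makes the limit
    exist, and thus be measurable, everywhere. *)
Lemma ae_cvg_fast nu (G : nat -> X -> R[i]) : (forall n, cmeasurable (G n)) ->
  (forall n, energy nu (fun x => G n.+1 x - G n x)%R <= ((8 ^+ n)^-1)%:E)%E ->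
  exists F, cmeasurable F /\
    {ae nu, forall x, (fun n => cmod (G n x - F x)) @ \oo --> (0 : R)}.
Proof.
move=> mG hG.
(* The weights 2^k still give integrals at most 2^k / 8^k <= 2^-k. *)
pose a k x := (2 ^+ k * cmod (G k.+1 x - G k x) ^+ 2)%:E : \bar R.
pose s x := (\sum_(k <oo) a k x)%E.
have mB k : cmeasurable (fun x => G k.+1 x - G k x) by exact: cmeasurableB.
have a0 k x : (0 <= a k x)%E by rewrite lee_fin mulr_ge0 ?sqr_ge0 ?exprn_ge0.
have ma k : measurable_fun setT (a k).
  by apply/measurable_EFinP; apply: measurable_funM => //; exact: measurable_cmod2.
have ms : measurable_fun setT s.
  by apply: (ge0_emeasurable_sum (P := xpredT)) => [k x _ _|k _].
have s0 x : (0 <= s x)%E by exact: nneseries_ge0.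
have is2 : (\int[nu]_x s x <= 2%:E)%E.
  rewrite integral_nneseries//; apply: lime_le.
    by apply: is_cvg_nneseries => k _ _; exact: integral_ge0.
  near=> n; apply: (@le_trans _ _ (\sum_(0 <= k < n) ((2^-1 : R) ^+ k)%:E)%E); last first.
    by rewrite sumEFin lee_fin; exact: sum_half_powers.
  apply: lee_sum => k _; rewrite /a; under eq_integral do rewrite EFinM.
  rewrite ge0_integralZl//; last 2 first.
  - exact: emeasurable_cmod2.
  - by move=> x _; rewrite lee_fin sqr_ge0.
  have t0 : (0 <= ((2 : R) ^+ k)%:E)%E by rewrite lee_fin exprn_ge0.
  apply: le_trans (lee_wpmul2l t0 (hG k)) _; rewrite -EFinM lee_fin.
  rewrite -exprVn -exprMn (_ : 2 * 8^-1 = 4^-1 :> R); last by field.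
  by rewrite lerXn2r ?nnegrE ?invr_ge0// lef_pV2 ?posrE// ler_nat.
pose E := [set x | (s x < +oo)%E].
have mE : measurable E.
  by rewrite /E -[X in measurable X]setTI; exact: emeasurable_fun_infty_o.
have cE x (pr : R[i] -> R) : (forall z w, pr (z - w) = pr z - pr w) ->
    (forall z, `|pr z| <= cmod z) -> E x -> cvgn (fun n => pr (G n x)).
  move=> prB prM Ex; have sf : s x \is a fin_num by rewrite ge0_fin_numE.
  apply: (@cvg_of_square_sum _ (fine (s x))) => n; rewrite -lee_fin fineK//.
  apply: le_trans (nneseries_lim_ge n _); last by move=> k _ _; exact: a0.
  rewrite sumEFin lee_fin; apply: ler_sum => k _; rewrite ler_wpM2l ?exprn_ge0//.
  by rewrite -prB -real_normK ?num_real// lerXn2r ?nnegrE ?cmod_ge0.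
pose H n x := G n x * ((\1_E x : R)%:C)%C.
have mH n : cmeasurable (H n).
  by apply: cmeasurableM => //; exact: cmeasurable_indic.
have HE n x : E x -> H n x = G n x by move=> Ex; rewrite /H indicE mem_set// mulr1.
have HnE n x : ~ E x -> H n x = 0 by move=> Ex; rewrite /H indicE memNset// mulr0.
have cRe x : cvgn (fun n => complex.Re (H n x)).
  have [Ex|nEx] := pselect (E x).
    rewrite (_ : (fun n => _) = (fun n => complex.Re (G n x))); last first.
      by apply/funext => n; rewrite HE.
    by apply: (cE x (@complex.Re R)) => // [z w|z]; [rewrite Re_add Re_opp|exact: Re_le_cmod].
  rewrite (_ : (fun n => _) = cst 0); first exact: is_cvg_cst.
  by apply/funext => n; rewrite HnE.
have cIm x : cvgn (fun n => complex.Im (H n x)).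
  have [Ex|nEx] := pselect (E x).
    rewrite (_ : (fun n => _) = (fun n => complex.Im (G n x))); last first.
      by apply/funext => n; rewrite HE.
    by apply: (cE x (@complex.Im R)) => // [z w|z]; [rewrite Im_add Im_opp|exact: Im_le_cmod].
  rewrite (_ : (fun n => _) = cst 0); first exact: is_cvg_cst.
  by apply/funext => n; rewrite HnE.
pose F x : R[i] := (limn (fun n => complex.Re (H n x)) +i* limn (fun n => complex.Im (H n x)))%C.
exists F; split.
  split.
    by apply: (measurable_fun_cvg (h := fun n x => complex.Re (H n x))) => [n|x _]; [exact: (mH n).1|exact: cRe].
  by apply: (measurable_fun_cvg (h := fun n x => complex.Im (H n x))) => [n|x _]; [exact: (mH n).2|exact: cIm].
have ints : nu.-integrable setT s.
  apply/integrableP; split=> //; under eq_integral do rewrite gee0_abs//.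
  by apply: le_lt_trans is2 _; rewrite ltry.
have := integrable_ae measurableT ints; apply: filterS => x /(_ I) sx.
have Ex : E x by rewrite /E /= -ge0_fin_numE.
have := cvgD (cvg_dist0 (cRe x)) (cvg_dist0 (cIm x)); rewrite addr0 => c0.
apply: (squeeze_cvgr (f := fun=> 0)); [apply: nearW => n|exact: cvg_cst|exact: c0].
rewrite /= cmod_ge0 /=; apply: le_trans (cmod_le_ReIm _) _.
by rewrite -(HE n x Ex) !Re_add !Re_opp !Im_add !Im_opp.
Unshelve. all: by end_near. Qed.

(** A subsequence that satisfies [ae_cvg_fast] has an almost everywhere limit,
    and Fatou's lemma bounds its distance to the whole sequence. *)
Theorem L2_complete nu (F_ : nat -> X -> R[i]) : (forall n, cmeasurable (F_ n)) ->
  (forall e : R, 0 < e -> exists N, forall n m, (N <= n)%N -> (N <= m)%N ->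
     (energy nu (fun x => F_ n x - F_ m x)%R <= e%:E)%E) ->
  exists F, cmeasurable F /\
    (fun n => energy nu (fun x => F_ n x - F x)%R) @ \oo --> 0%E.
Proof.
move=> mF cF.
have e8 k : 0 < ((8 : R) ^+ k)^-1 by rewrite invr_gt0 exprn_gt0.
have /choice[N hN] k := cF _ (e8 k).
(* Partial sums turn the ranks N into a sequence above N k from k on. *)
pose M k := (\sum_(j < k.+1) N j)%N.
have NM k j : (N k <= M (k + j))%N.
  have kj : (k < (k + j).+1)%N by rewrite ltnS leq_addr.
  by rewrite /M (bigD1 (Ordinal kj))//= leq_addr.
have [|F [mFF aF]] := @ae_cvg_fast nu (fun k => F_ (M k)) (fun k => mF (M k)).
  move=> k; apply: hN; first by have := NM k 1%N; rewrite addn1.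
  by have := NM k 0%N; rewrite addn0.
exists F; split=> //; apply: ecvg0_le => [n|e e0]; first exact: energy_ge0.
have [k hk] : exists k, ((8 : R) ^+ k)^-1 <= e.
  exists (Num.bound e^-1); rewrite -[leRHS]invrK lef_pV2 ?posrE ?invr_gt0 ?exprn_gt0//.
  apply: (le_trans (ltW (archi_boundP _))); first by rewrite invr_ge0 ltW.
  by rewrite -natrX ler_nat ltnW// ltn_expl.
exists (N k) => n Nn; apply: (@le_trans _ _ ((8 ^+ k)^-1)%:E); last by rewrite lee_fin.
apply: (@energy_fatou _ _ _ _ (fun j x => F_ n x - F_ (M (k + j)%N) x)).
- by move=> j; exact: cmeasurableB.
- exact: cmeasurableB.
- apply: filterS aF => x cx.
  rewrite (_ : (fun j => _) = (fun j => cmod (F_ (M j) x - F x)) \o addn k); last first.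
    by apply/funext => j /=; rewrite -cmodN; congr cmod; ring.
  apply: (cvg_comp _ _ _ cx) => P [N0 _ hN0]; exists N0 => // j /= Nj.
  by apply: hN0; exact: leq_trans Nj (leq_addl _ _).
- by move=> j; apply: hN => //; exact: NM.
Qed.

Lemma energy_eq0_ae nu f : cmeasurable f -> energy nu f = 0%E -> {ae nu, forall x, f x = 0}.
Proof.
move=> mf f0; have m2 := emeasurable_cmod2 mf.
have : ae_eq nu setT (fun x => (cmod (f x) ^+ 2)%:E) (cst 0%E).
  apply/(ae_eq_integral_abs nu measurableT m2); rewrite -[RHS]f0.
  by apply: eq_integral => x _; rewrite gee0_abs// lee_fin sqr_ge0.
apply: filterS => x /(_ I) /= /eqP; rewrite eqe sqrf_eq0 => /eqP; exact: cmod_eq0.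
Qed.

Lemma energy_lim_unique nu (G : nat -> X -> R[i]) f g :
  (forall n, cmeasurable (G n)) -> cmeasurable f -> cmeasurable g ->
  (fun n => energy nu (fun x => G n x - f x)%R) @ \oo --> 0%E ->
  (fun n => energy nu (fun x => G n x - g x)%R) @ \oo --> 0%E ->
  {ae nu, forall x, f x = g x}.
Proof.
move=> mG mf mg cf cg; have mfg := cmeasurableB mf mg.
have fg0 : energy nu (fun x => f x - g x)%R = 0%E.
  have : (fun=> energy nu (fun x => f x - g x)%R) @ \oo --> 0%E.
    apply: (ecvg0_lin (a := 2) (b := 2) cf cg) => n; first exact: energy_ge0.
    rewrite [X in (2%:E * X + _)%E]energy_subC.
    rewrite (_ : (fun x => f x - g x) = (fun x => (f x - G n x) + (G n x - g x))).
      by apply: energyD; exact: cmeasurableB.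
    by apply/funext => x; rewrite addrA subrK.
  by move/cvg_lim => <-//; rewrite lim_cst.
apply: filterS (energy_eq0_ae mfg fg0) => x /eqP; rewrite subr_eq0 => /eqP; exact.
Qed.

End L2_completeness.

(** * Extension of the Fourier transform to L^2 *)

Section fourier_extension.
Context (R : realType) (d : nat).
Local Notation leb := (lebesgue_cV R d).
Context (Om : set 'cV[R]_d) (mu : {measure set 'cV[R]_d -> \bar R}).
Implicit Types (f g h : 'cV[R]_d -> R[i]) (t x : 'cV[R]_d).

Lemma L1L2_onB f g : L1L2_on Om f -> L1L2_on Om g -> L1L2_on Om (fun x => f x - g x).
Proof.
move=> [fO f1 f2] [gO g1 g2]; split.
- by move=> x nO; rewrite fO// gO// subrr.
- exact: in_L1B.
- exact: in_L2_B.
Qed.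

Lemma L2_onL c f g : L2_on Om f -> L2_on Om g -> L2_on Om (fun x => c * f x + g x).
Proof.
move=> [fO f2] [gO g2]; have [/in_L2_energy[mf foo] /in_L2_energy[mg goo]] := (f2, g2).
split; first by move=> x nO; rewrite fO// gO// mulr0 addr0.
have mcf := cmeasurableM (cmeasurable_cst _ c) mf.
apply/in_L2_energy; split; first exact: cmeasurableD.
apply: le_lt_trans (energyD leb mcf mg) _; rewrite energyZ//.
by rewrite lte_add_pinfty// ?lte_mul_pinfty ?lee_fin ?sqr_ge0// ?mule_ge0 ?energy_ge0 ?lee_fin ?sqr_ge0 ?lte_mul_pinfty ?lee_fin ?sqr_ge0.
Qed.

Lemma trunc_window_L1L2 f n : L2_on Om f -> L1L2_on Om (trunc f (window n)).
Proof.
move=> [fO /[dup] f2 /in_L2_energy[mf foo]].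
have mt : cmeasurable (trunc f (window n)) by exact: (cmeasurable_trunc mf (measurable_window n)).
have t2 : in_L2 leb (trunc f (window n)).
  apply/in_L2_energy; split=> //; apply: le_lt_trans foo.
  by apply: energy_le => // x; exact: cmod_trunc_le.
split=> //.
- by move=> x nO; rewrite /trunc fO// mul0r.
- apply: (in_L2_L1 (measurable_window n) (window_lty R d n)) => // x nw.
  by rewrite /trunc indicE memNset// mulr0.
Qed.

Hypothesis iso : forall f, L1L2_on Om f -> energy mu (fourier f) = energy leb f.

Let cmeasurable_fourier_trunc f n : L2_on Om f -> cmeasurable (fourier (trunc f (window n))).
Proof.
by move=> /(trunc_window_L1L2 n)[_ [mf _] _]; exact: cmeasurable_fourier.
Qed.

(** The truncations of f form a Cauchy sequence in L^2, and so do their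
    transforms by the isometry. Using the same windows for all f makes the
    truncation linear in f. *)
Lemma fourier_limit f : exists F, L2_on Om f -> cmeasurable F /\
  (fun n => energy mu (fun t => fourier (trunc f (window n)) t - F t)%R) @ \oo --> 0%E.
Proof.
have [fL|nf] := pselect (L2_on Om f); last by exists (fun=> 0).
have [fO /in_L2_energy[mf foo]] := fL.
have c0 : (fun n => energy leb (fun x => trunc f (window n) x - f x)%R) @ \oo --> 0%E.
  apply: trunc_energy_cvg0 => //; first by move=> n; exact: measurable_window.
  by move=> x _; exact: window_near.
have mt n : cmeasurable (trunc f (window n)) by exact: (cmeasurable_trunc mf (measurable_window n)).
have [|e e0|F hF] := @L2_complete _ _ _ mu (fun n => fourier (trunc f (window n))); last by exists F.
  by move=> n; exact: cmeasurable_fourier_trunc.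
have e4 : (0 < (e / 4)%:E)%E by rewrite lte_fin divr_gt0.
have [N _ hN] := ecvg_lt_near c0 e4; exists N => n m /hN/= hn /hN/= hm.
have fn := trunc_window_L1L2 n fL; have fm := trunc_window_L1L2 m fL.
rewrite (_ : (fun t => _) = fourier (fun x => trunc f (window n) x - trunc f (window m) x)); last first.
  by apply/funext => t; rewrite fourierB//; [case: fn|case: fm].
rewrite iso; last exact: L1L2_onB.
rewrite (_ : (fun x => _) = (fun x => (trunc f (window n) x - f x) + (f x - trunc f (window m) x))); last first.
  by apply/funext => x; rewrite addrA subrK.
have mB1 := cmeasurableB (mt n) mf; have mB2 := cmeasurableB mf (mt m).
apply: le_trans (energyD leb mB1 mB2) _; rewrite [energy leb (fun x => f x - _)]energy_subC.
have -> : (e%:E = 2%:E * (e / 4)%:E + 2%:E * (e / 4)%:E)%E.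
  by rewrite -EFinM -EFinD; congr EFin; field.
by apply: leeD; rewrite lee_wpmul2l ?lee_fin// ltW.
Qed.

Lemma fourier_extends : fourier_extends_isometrically Om mu.
Proof.
have /choice[F hF] := fourier_limit.
have mF f : L2_on Om f -> cmeasurable (F f) by move=> /hF[].
have cF f : L2_on Om f ->
    (fun n => energy mu (fun t => fourier (trunc f (window n)) t - F f t)%R) @ \oo --> 0%E.
  by move=> /hF[].
have isoF f : L2_on Om f -> energy mu (F f) = energy leb f.
  move=> fL; have [fO /in_L2_energy[mf foo]] := fL.
  apply: (energy_lim (g_ := fun n => fourier (trunc f (window n)))).
  - by move=> n; exact: cmeasurable_fourier_trunc.
  - exact: mF.
  - exact: cF.
  - rewrite (_ : (fun n => _) = (fun n => energy leb (trunc f (window n)))); last first.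
      by apply/funext => n; rewrite iso//; exact: trunc_window_L1L2.
    apply: trunc_energy_cvg => //; first by move=> n; exact: measurable_window.
    by move=> x _; exact: window_near.
have linF c f g : L2_on Om f -> L2_on Om g ->
    {ae mu, forall t, F (fun x => c * f x + g x) t = c * F f t + F g t}.
  move=> fL gL; have hL := L2_onL c fL gL.
  apply: (energy_lim_unique (G := fun n => fourier (trunc (fun x => c * f x + g x) (window n)))).
  - by move=> n; exact: cmeasurable_fourier_trunc.
  - exact: mF.
  - by apply: cmeasurableD; [apply: cmeasurableM; [exact: cmeasurable_cst|exact: mF]|exact: mF].
  - exact: cF.
  - apply: (ecvg0_lin (a := 2 * cmod c ^+ 2) (b := 2) (cF f fL) (cF g gL)) => n.
      exact: energy_ge0.
    have fn := trunc_window_L1L2 n fL; have gn := trunc_window_L1L2 n gL.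
    have [_ f1 _] := fn; have [_ g1 _] := gn.
    pose u t := fourier (trunc f (window n)) t - F f t.
    pose v t := fourier (trunc g (window n)) t - F g t.
    have mu' : cmeasurable u by apply: cmeasurableB; [exact: cmeasurable_fourier_trunc|exact: mF].
    have mv : cmeasurable v by apply: cmeasurableB; [exact: cmeasurable_fourier_trunc|exact: mF].
    rewrite (_ : energy mu _ = energy mu (fun t => c * u t + v t)); last first.
      congr energy; apply/funext => t; rewrite /u /v.
      rewrite (_ : trunc (fun x => c * f x + g x) _ = (fun x => c * trunc f (window n) x + trunc g (window n) x)); last first.
        by apply/funext => x; rewrite /trunc mulrDl mulrA.
      rewrite fourierD//; last exact: in_L1Z.
      by rewrite fourierZ//; ring.
    have mcu := cmeasurableM (cmeasurable_cst _ c) mu'.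
    apply: le_trans (energyD mu mcu mv) _.
    by rewrite energyZ// EFinM muleA.
exists F; split=> //.
- by move=> f fL; apply/in_L2_energy; split; [exact: mF|rewrite isoF//; have [_ /in_L2_energy[]] := fL].
- move=> f g fL gL; rewrite !L2normE; congr (_ `^ _)%E.
  have dL := L2_onL (-1) gL fL.
  transitivity (energy mu (F (fun x => -1 * g x + f x))).
    apply: ae_eq_energy.
    - by apply: cmeasurableB; exact: mF.
    - exact: mF.
    - by apply: filterS (linF (-1) g f gL fL) => t ->; rewrite /= mulN1r addrC.
  rewrite isoF//; congr energy; apply/funext => x.
  by rewrite /= mulN1r addrC.
- move=> f [fO f1 f2]; have fL : L2_on Om f by [].
  have [mf foo] := (in_L2_energy _ _).1 f2.
  apply: (energy_lim_unique (G := fun n => fourier (trunc f (window n)))).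
  + by move=> n; exact: cmeasurable_fourier_trunc.
  + exact: mF.
  + exact: cmeasurable_fourier.
  + exact: cF.
  + rewrite (_ : (fun n => _) = (fun n => energy leb (fun x => trunc f (window n) x - f x)%R)).
      apply: trunc_energy_cvg0 => //; first by move=> n; exact: measurable_window.
      by move=> x _; exact: window_near.
    apply/funext => n; have fn := trunc_window_L1L2 n fL; have [_ fn1 _] := fn.
    rewrite -iso; last exact: L1L2_onB.
    by congr energy; apply/funext => t; rewrite fourierB.
Qed.

End fourier_extension.

(** * Testing the isometry on two translated boxes *)

Section boxes.
Context (R : realType) (d : nat).
Local Notation leb := (lebesgue_cV R d).
Implicit Types (v x : 'cV[R]_d) (e : R).

Definition box v e : set 'cV[R]_d := [set x | forall i, v i 0 <= x i 0 <= v i 0 + e].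

Lemma measurable_box v e : measurable (box v e).
Proof.
apply: measurable_forall => i.
have := measurable_coord_cV i 0 measurableT (measurable_itv `[v i 0, v i 0 + e]).
rewrite setTI (_ : _ @^-1` _ = [set x : 'cV[R]_d | v i 0 <= x i 0 <= v i 0 + e])//.
Qed.

Lemma measure_box v e : 0 <= e -> leb (box v e) = (e ^+ d)%:E.
Proof.
move=> e0; rewrite (_ : box v e = [set x | forall i, v i 0 <= x i 0 <= (v + const_mx e) i 0]).
  rewrite lebesgue_cV_box; last by move=> i; rewrite !mxE lerDl.
  congr EFin; rewrite (eq_bigr (fun=> e)); first by rewrite prodr_const card_ord.
  by move=> i _; rewrite !mxE addrAC subrr add0r.
by apply/seteqP; split => x hx i; have := hx i; rewrite /= !mxE.
Qed.

Lemma open_box (U : set 'cV[R]_d) v : open U -> U v ->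
  exists e, 0 < e < 1 /\ box v e `<=` U.
Proof.
move=> oU Uv; have /nbhs_ballP[e /= e0 eU] : nbhs v U by apply: open_nbhs_nbhs.
exists (Num.min e 1 / 2); have m0 : 0 < Num.min e 1 by rewrite lt_min e0 ltr01.
have m1 : Num.min e 1 <= 1 by rewrite ge_min lexx orbT.
have me : Num.min e 1 <= e by rewrite ge_min lexx.
split; first by apply/andP; split; lra.
move=> x hx; apply: eU; split=> // i j; rewrite ord1 /ball /= ltr_distlC.
by have /andP[h1 h2] := hx i; apply/andP; split; lra.
Qed.

Lemma open_translate (U : set 'cV[R]_d) v : open U -> open [set x | U (x + v)].
Proof.
move=> oU; rewrite openE => x /= Ux.
have /nbhs_ballP[e /= e0 eU] : nbhs (x + v) U by apply: open_nbhs_nbhs.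
apply/nbhs_ballP; exists e => // y [_ xy]; apply: eU; split=> // i j.
have := xy i j; rewrite /ball /= !mxE.
by rewrite opprD addrACA subrr addr0.
Qed.

Lemma box_cell v e : e < 1 -> box v e `<=` [set x | cell 1%:M 0 (x - v)].
Proof.
move=> e1 x hx i; have /andP[h1 h2] := hx i.
by rewrite invmx1 mul1mx !mxE add0r; apply/andP; split; lra.
Qed.

End boxes.

Section test_functions.
Context (R : realType) (d : nat) (A : 'M[int]_d).
Hypothesis detA : \det A != 0.
Local Notation leb := (lebesgue_cV R d).
Local Notation GA := (int_mx R A).
Local Notation D := (dual_cell R A).
Let mD : measurable D. Proof. exact: (fundom_dual_cell R detA).1.1. Qed.
Local Notation nuD := (mrestr leb mD).
Implicit Types (f g h : 'cV[R]_d -> R[i]) (t x q : 'cV[R]_d) (z : R[i]).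

(** The cross term in the energy of 1 + z e(- t q) on the dual cell. *)
Definition exp_integral q : R[i] := cintegral nuD (fun t => ekern t q).

Lemma cmeasurable_ekern_r q : cmeasurable (fun t => ekern t q).
Proof.
rewrite (_ : (fun t => _) = ekern q); first exact: cmeasurable_ekern.
by apply/funext => t; rewrite /ekern dotprodC.
Qed.

Lemma bm_ekern_r q : bm (fun t => ekern t q).
Proof.
split; first exact: cmeasurable_ekern_r.
by exists 1 => t; rewrite cmod_ekern.
Qed.

Let nuDoo : (nuD setT < +oo)%E.
Proof. by apply: mrestr_lty; exact: dual_cell_lty. Qed.

Lemma energy_unimodular f : cmeasurable f -> (forall t, cmod (f t) = 1) ->
  energy nuD f = leb D.
Proof.
move=> mf f1; rewrite /energy; under eq_integral do rewrite f1 expr1n.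
by apply: etrans (integral_cst _ measurableT 1%E) _; rewrite mul1e; congr (leb _); rewrite setTI.
Qed.

Lemma energy_two_exp z q : energy nuD (fun t => 1 + z * ekern t q) =
  (fine (leb D) * (1 + cmod z ^+ 2) + 2 * complex.Re (z * exp_integral q))%:E.
Proof.
have bz : bm (fun t => - (z * ekern t q)).
  rewrite (_ : (fun t => _) = (fun t => (- z) * ekern t q)); last by apply/funext => t; rewrite mulNr.
  by apply: bmZ; exact: bm_ekern_r.
have in2 f : bm f -> in_L2 nuD f.
  move=> bf; apply/in_L2_energy; split; first exact: bf.1.
  have [] := bm_in_L1 nuDoo (bmM bf bf) => _; apply: le_lt_trans.
  rewrite le_eqVlt; apply/orP; left; apply/eqP; apply: eq_integral => t _.
  by rewrite cmodM expr2.
have f1 : bm (fun _ : 'cV[R]_d => 1 : R[i]) by exact: bm_cst.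
rewrite (_ : (fun t => _) = (fun t => 1 - - (z * ekern t q))); last first.
  by apply/funext => t; rewrite opprK.
rewrite energyB_inner; [|exact: in2|exact: in2].
rewrite energy_unimodular; [|exact: f1.1|by move=> t; exact: cmod1].
rewrite energyN energyZ; last exact: cmeasurable_ekern_r.
rewrite energy_unimodular; [|exact: cmeasurable_ekern_r|by move=> t; rewrite cmod_ekern].
have iek := bm_in_L1 nuDoo (bm_ekern_r q).
rewrite (_ : cintegral _ _ = - conjc (z * exp_integral q)); last first.
  rewrite /exp_integral -cintegralZ// -cintegral_conj; last exact: in_L1Z.
  rewrite -cintegralN; last by apply: in_L1_conj; exact: in_L1Z.
  by congr cintegral; apply/funext => t; rewrite mul1r rmorphN.
have Rc (w : R[i]) : complex.Re (conjc w) = complex.Re w by case: w.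
rewrite Re_opp Rc mulrN opprK; congr (_ + _)%:E.
have -> : leb D = (fine (leb D))%:E by rewrite (measure_dual_cell R detA).
by rewrite -EFinM /=; ring.
Qed.

(** These integrals, for l in Z^d, are the Fourier coefficients on the dual
    cell of the unimodular function e(- t m); by Parseval's identity they do
    not all vanish. *)
Lemma exp_integral_neq0 (m : 'cV[int]_d) :
  exists l : 'cV[int]_d, exp_integral (lat 1%:M (m + A *m l)) <> 0.
Proof.
apply: contrapT => nl.
have w0 l : exp_integral (lat 1%:M (m + A *m l)) = 0.
  by apply: contrapT => h; apply: nl; exists l.
have bf := bm_ekern_r (lat 1%:M m).
have := parseval_bm (unit_dual R detA) (fundom_dual_cell R detA) mD (dual_cell_lty R detA)
  (dual_cell_gt0 R detA) bf.
rewrite (_ : csum _ = 0%E); last first.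
  apply: etrans (@csum0 R 'cV[int]_d); apply: eq_csum => l.
  rewrite (_ : fcoef _ _ _ _ = exp_integral (lat 1%:M (m + A *m l))); first by rewrite w0 cmod0 expr0n.
  rewrite /fcoef /exp_integral; congr cintegral; apply/funext => t.
  rewrite !lat1 int_mxD int_mxM ekern_add; congr (_ * _).
  by rewrite /chi dualK -expiN /ekern dotprodC.
rewrite energy_unimodular; [|exact: bf.1|by move=> t; rewrite cmod_ekern].
move=> /esym/eqP; rewrite mule_eq0 orbb => /eqP h.
by have := dual_cell_gt0 R detA; rewrite h ltxx.
Qed.

Context (U : set 'cV[R]_d).
Local Notation c := (`|(\det A)%:~R : R| / fine (leb U)).
Local Notation mu := (pair_measure U detA).
Local Notation Om := (periodization GA U).
Hypothesis iso : forall f, L1L2_on Om f -> energy mu (fourier f) = energy leb f.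

(** Test the isometry on 1_E + z 1_(E + p), where E is a small box in U. The
    left-hand side is computed by [energy_fourier_superposition], with a
    translate of the unit cube containing E as tile. *)
Lemma isometry_two_exp v e z p : 0 < e < 1 -> box v e `<=` U ->
  (z <> 0 -> p <> 0 /\ forall x, box v e x -> Om (x + lat 1%:M p)) ->
  c * (fine (leb D) * (1 + cmod z ^+ 2) + 2 * complex.Re (z * exp_integral (lat 1%:M p))) =
  1 + cmod z ^+ 2.
Proof.
move=> /andP[e0 e1] EU zp; set E := box v e in EU zp.
have mE : measurable E by exact: measurable_box.
pose T := [set x | cell (1%:M : 'M[R]_d) 0 (x - v)].
have u1 : (1%:M : 'M[R]_d) \in unitmx by exact: unitmx1.
have fT : fundom 1%:M T by apply: fundom_translate; exact: fundom_cell.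
have ET : E `<=` T by exact: box_cell.
have Too : (leb T < +oo)%E by rewrite fundom1_measure// ltry.
have T0 : (0 < leb T)%E by rewrite fundom1_measure// lte01.
pose one x : R[i] := ((\1_E x : R)%:C)%C.
pose h (q : R[i] * 'cV[int]_d) x : R[i] := q.1 * one x.
pose m (q : R[i] * 'cV[int]_d) := q.2.
pose s := [:: (1 : R[i], 0 : 'cV[int]_d); (z, p)].
have b1 : bm one by exact: bm_indic.
have bh (q : R[i] * 'cV[int]_d) : bm (h q) by apply: bmZ.
have one0 x : ~ E x -> one x = 0 by move=> nE; rewrite /one indicE memNset.
have hT (q : R[i] * 'cV[int]_d) x : ~ T x -> h q x = 0 by move=> nT; rewrite /h one0 ?mulr0// => /ET.
pose f := superposition 1%:M s h m.
have fE x : f x = one x + z * one (x - lat 1%:M p).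
  by rewrite /f /superposition !big_cons big_nil /h /m /= lat0 subr0 mul1r addr0.
have one2 x : (cmod (one x) ^+ 2)%:E = (\1_E x)%:E :> \bar R.
  by rewrite /one cmod_real indicE; case: (_ \in _); rewrite ?normr1 ?normr0 ?expr1n ?expr0n.
have disj x : z <> 0 -> E x -> E (x - lat 1%:M p) -> False.
  move=> /zp[p0 _] /ET Tx /ET Txp; apply: p0.
  by apply: (fT.1.2 x p 0); rewrite ?lat0 ?subr0.
have f2E x : (cmod (f x) ^+ 2)%:E = ((\1_E x)%:E + (cmod z ^+ 2)%:E * (\1_E (x - lat 1%:M p))%:E)%E :> \bar R.
  rewrite fE -!one2; have [->|/eqP z0] := eqVneq z 0.
    by rewrite !mul0r addr0 cmod0 expr0n/= mul0e adde0.
  have [Ex|nEx] := pselect (E x).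
    rewrite (@one0 (x - _)); last by move=> Exp; exact: (disj x).
    by rewrite mulr0 addr0 cmod0 expr0n/= mule0 adde0.
  by rewrite one0// add0r cmod0 expr0n/= add0e cmodM exprMn EFinM.
have fe : energy leb f = ((1 + cmod z ^+ 2)%:E * leb E)%E.
  rewrite /energy; under eq_integral do rewrite f2E.
  rewrite ge0_integralD//; last 3 first.
  - by apply/measurable_EFinP; exact: measurable_indic.
  - by move=> x _; rewrite mule_ge0 ?lee_fin ?sqr_ge0.
  - by apply: emeasurable_funM => //; exact: measurable_indic_translate.
  rewrite -measure_indic// ge0_integralZl//; last 2 first.
  - exact: measurable_indic_translate.
  - by rewrite lee_fin sqr_ge0.
  rewrite (_ : (\int[leb]_x _)%E = leb E); last first.
    rewrite (@lebesgue_cV_translate R d (- lat 1%:M p) (fun x => (\1_E x)%:E)).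
    - by rewrite -measure_indic.
    - by apply/measurable_EFinP; exact: measurable_indic.
    - by move=> x; rewrite lee_fin.
  by rewrite EFinD ge0_muleDl ?lee_fin ?sqr_ge0// mul1e.
have f1 : in_L1 leb f by exact: (in_L1_superposition 1%:M fT.1.1 Too s m bh hT).
have fL : L1L2_on Om f.
  split=> //.
    move=> x nO; rewrite fE one0 ?add0r; last first.
      by move=> Ex; apply: nO; exists 0; rewrite lat0 subr0; exact: EU.
    have [->|/eqP z0] := eqVneq z 0; first by rewrite mul0r.
    rewrite one0 ?mulr0// => Exp; apply: nO.
    by have [_ /(_ _ Exp)] := zp z0; rewrite subrK.
  apply/in_L2_energy; split; first exact: f1.1.
  by rewrite fe measure_box ?(ltW e0)// -EFinM ltry.
have mF : cmeasurable (fourier f) by apply: cmeasurable_fourier; exact: f1.1.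
have := iso fL; rewrite energy_pair_measure// energy_mrestr// /dual_cells.
have pD : exact_packing (dual 1%:M) D := exact_packing_dual_cell R detA.
have := energy_fourier_superposition u1 fT fT.1.1 Too T0 s m bh hT mD pD.
rewrite dual1 -/f => ->; rewrite (fundom1_measure fT) mul1e.
rewrite (_ : (\int[leb]_x _)%E = ((fine (leb D) * (1 + cmod z ^+ 2) +
    2 * complex.Re (z * exp_integral (lat 1%:M p)))%:E * leb E)%E); last first.
  rewrite -energy_two_exp [in RHS]measure_indic// -ge0_integralZl//; last 2 first.
  - by apply/measurable_EFinP; exact: measurable_indic.
  - exact: energy_ge0.
  apply: eq_integral => x _; rewrite muleC -one2 -energyZ; last first.
    apply: cmeasurableD; first exact: cmeasurable_cst.
    by apply: cmeasurableM; [exact: cmeasurable_cst|exact: cmeasurable_ekern_r].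
  congr energy; apply/funext => t; rewrite /modulated !big_cons big_nil /h /m /=.
  rewrite lat0 (_ : ekern t 0 = 1); last by rewrite /ekern dotprodC dotprod0l mulr0 oppr0 expi0.
  by ring.
rewrite fe measure_box ?(ltW e0)// -!EFinM => /eqP; rewrite eqe mulrA => /eqP.
by apply: mulIf; rewrite expf_neq0// gt_eqF.
Qed.

Hypothesis U_open : open U.
Hypothesis U0 : U !=set0.
Hypothesis U_packs : packs U (range (lat GA)).

Lemma density_eq : c * fine (leb D) = 1.
Proof.
have [v Uv] := U0; have [e [e01 EU]] := open_box U_open Uv.
have := @isometry_two_exp v e 0 0 e01 EU ltac:(by []).
by rewrite cmod0 mul0r expr0n/= !addr0 mulr1 mulr0 addr0.
Qed.

Lemma measure_isometric : leb U = 1%E.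
Proof.
have := density_eq; rewrite (measure_dual_cell R detA) /=.
have D0 : `|(\det A)%:~R| != 0 :> R by rewrite normr_eq0 intr_eq0.
rewrite mulrAC divff// mul1r => h.
have U1 : fine (leb U) = 1 by rewrite -[LHS]invrK h invr1.
have : leb U \is a fin_num.
  rewrite fin_numE; apply/andP; split; apply/eqP => Uoo; move: U1; rewrite Uoo /= => /esym/eqP;
  by rewrite oner_eq0.
by move=> fU; rewrite -(fineK fU) U1.
Qed.

(** If m is not in A Z^d, a small box E at x satisfies both E in U and
    E + m + A l in Om for all l. Then [isometry_two_exp] makes the cross term
    vanish for every p = m + A l, against [exp_integral_neq0]. *)
Lemma overlap_lattice (m : 'cV[int]_d) x : U x -> U (x + lat 1%:M m) ->
  exists l, m = A *m l.
Proof.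
move=> Ux Uxm; apply: contrapT => nl.
(* If m is not in A Z^d, a box E in this open set has E and E + m in U. *)
have oV : open (U `&` [set y | U (y + lat 1%:M m)]).
  by apply: openI => //; exact: open_translate.
have [e [e01 EV]] := open_box oV (conj Ux Uxm).
have EU : box x e `<=` U by move=> y /EV[].
have [l] := exp_integral_neq0 m; apply.
set p := m + A *m l.
have zp : p <> 0 /\ forall y, box x e y -> periodization GA U (y + lat 1%:M p).
  split.
    move=> p0; apply: nl; exists (- l); rewrite mulmxN; apply/eqP.
    by rewrite -addr_eq0; apply/eqP.
  move=> y /EV[_ /= Uy]; exists l.
  by rewrite !lat1 in Uy *; rewrite /p int_mxD int_mxM addrA addrK.
have c0 : c != 0.
  apply/eqP => c0; have := density_eq; rewrite c0 mul0r => /esym/eqP.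
  by rewrite oner_eq0.
have Rez z : complex.Re (z * exp_integral (lat 1%:M p)) = 0.
  have := isometry_two_exp e01 EU (fun=> zp) (z := z).
  rewrite mulrDr mulrA density_eq mul1r => /eqP; rewrite -subr_eq0 addrAC subrr add0r.
  by rewrite mulf_eq0 (negbTE c0)/= mulf_eq0 pnatr_eq0/= => /eqP.
apply: complex_ext; first by have := Rez 1; rewrite mul1r.
by have := Rez 'i%C; rewrite Re_mul /= mul0r mul1r sub0r => /eqP; rewrite oppr_eq0 => /eqP.
Qed.

(** By [overlap_lattice] the translates of U by Z^d overlap only within the
    cosets of A Z^d, where they are almost disjoint by hypothesis; as U has
    volume 1, the packing is a tiling. *)
Lemma isometric_tiles : tiles U Zlattice.
Proof.
have uA : GA \in unitmx by exact: int_mx_unit.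
have mU := U_packs.1; rewrite ZlatticeE.
have fQ := fundom_cell (unitmx1 R d) 0.
apply: (packs_tiles (unitmx1 _ _) _ fQ).
- apply: disjoint_packs => // k k0.
  have [[l kl]|nl] := pselect (exists l, k = A *m l).
    have l0 : l <> 0 by move=> l0; apply: k0; rewrite kl l0 mulmx0.
    by rewrite -(packs_disjoint uA U_packs l0) kl lat1 int_mxM.
  rewrite (_ : _ `&` _ = set0) ?measure0//; apply/seteqP; split => // x [/= Ux Uk]; apply: nl.
  by apply: (overlap_lattice Uk); rewrite subrK.
- by rewrite measure_isometric measure_cell1.
- by rewrite measure_cell1 ltry.
Qed.

End test_functions.

(** * The four equivalent properties *)

Section equivalences.
Context (R : realType) (d : nat) (A : 'M[int]_d).
Hypothesis detA : \det A != 0.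
Local Notation leb := (lebesgue_cV R d).
Local Notation GA := (int_mx R A).
Context (U : set 'cV[R]_d) (mU : measurable U).
Local Notation Om := (periodization GA U).
Local Notation mu := (pair_measure U detA).

Lemma pair_measure_radon : radon mu.
Proof.
move=> K cK; have [n Kn] := compact_window cK.
have mK : measurable K.
  rewrite -[K]setCK; apply: measurableC; apply: open_measurable_cV.
  by rewrite openC; apply: compact_closed cK; exact: norm_hausdorff.
have mS := @measurable_dual_support R d A detA.
rewrite /pair_measure /= /mscale /= /mrestr.
rewrite lte_mul_pinfty ?lee_fin ?density_ge0//; apply: le_lt_trans (window_lty R d n).
apply: le_measure; rewrite ?inE.
- exact: measurableI.
- exact: measurable_window.
- by apply: subset_trans Kn; exact: subIsetl.
Qed.

Lemma tiles_spectral : tiles U Zlattice -> spectral_with Om mu.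
Proof.
move=> tU; have U1 := tiles_measure1 tU; rewrite ZlatticeE in tU.
have [T [fT UT TU]] := tiles_fundom (unitmx1 R d) tU.
have mT := fT.1.1.
have mO := measurable_periodization GA mU; have mOT := measurable_periodization GA mT.
have dif V W : measurable V -> measurable W -> leb (V `\` W) = 0%E ->
    leb (periodization GA V `\` periodization GA W) = 0%E.
  move=> mV mW VW; apply: (null_sub _ _ (U := periodization GA (V `\` W))).
  - by apply: measurableD; exact: measurable_periodization.
  - by apply: measurable_periodization; exact: measurableD.
  - by move=> x [[k Vk] nW]; exists k; split=> // Wk; apply: nW; exists k.
  - by apply: null_periodization => //; exact: measurableD.
have OOT := dif _ _ mU mT UT; have OTO := dif _ _ mT mU TU.
have muE f : cmeasurable f -> energy mu f = (`|(\det A)%:~R : R|%:E *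
    energy (mrestr leb (@measurable_dual_cells R d A detA)) f)%E.
  by move=> mf; rewrite energy_pair_measure// U1 divr1.
have isoE f : L1L2_on Om f -> energy mu (fourier f) = energy leb f.
  by move=> [fO f1 f2]; exact: (fourier_isometry fT mO OOT muE f1 f2 fO).
split=> //.
- exact: pair_measure_radon.
- by move=> f fL; rewrite -/(energy mu (fourier f)) isoE//; case: fL => _ _ [].
- move=> f g fL gL; rewrite !L2normE; congr (_ `^ _)%E.
  rewrite -(isoE _ (L1L2_onB fL gL)); congr energy; apply/funext => t.
  by have [[_ f1 _] [_ g1 _]] := (fL, gL); rewrite fourierB.
- exact: (fourier_dense fT mO OOT OTO muE).
Qed.

Lemma L1L2_on0 : L1L2_on Om (fun=> 0).
Proof.
have m0 := cmeasurable_cst 'cV[R]_d (0 : R[i]).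
split=> //; first exact: in_L1_0.
apply/in_L2_energy; split=> //; rewrite /energy; under eq_integral do rewrite cmod0 expr0n.
by rewrite integral0.
Qed.

Lemma fourier0 (t : 'cV[R]_d) : fourier (fun=> 0) t = 0.
Proof.
rewrite fourierE (_ : (fun x => _) = (fun=> 0)) ?cintegral0//.
by apply/funext => x; rewrite mul0r.
Qed.

Lemma spectral_extends : spectral_with Om mu -> fourier_extends_isometrically Om mu.
Proof.
move=> [_ _ _ iso _]; apply: fourier_extends => f fL.
rewrite !energy_L2norm.
have -> : f = f \- (fun=> 0) by apply/funext => x; rewrite /= subr0.
rewrite -(iso f _ fL L1L2_on0); congr (_ `^ _)%E; congr L2norm.
apply/funext => t; rewrite /= fourier0 subr0.
by congr fourier; apply/funext => x; rewrite /= subr0.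
Qed.

(** On the integrable functions the extension agrees almost everywhere with
    the Fourier transform itself. *)
Lemma extends_isometric : fourier_extends_isometrically Om mu ->
  forall f, L1L2_on Om f -> energy mu (fourier f) = energy leb f.
Proof.
move=> [F [F2 _ isoF FE]] f fL.
have L2 g : L1L2_on Om g -> L2_on Om g by move=> [].
have L0 := L1L2_on0; have mFf := (F2 f (L2 _ fL)).1; have mF0 := (F2 _ (L2 _ L0)).1.
rewrite (_ : energy mu _ = energy mu (F f \- F (fun=> 0))%R).
  rewrite !energy_L2norm isoF; [|exact: L2|exact: L2].
  congr (L2norm _ _ `^ _)%E; apply/funext => x.
  by rewrite /= subr0.
have [_ f1 _] := fL.
apply: ae_eq_energy.
- by apply: cmeasurable_fourier; exact: f1.1.
- exact: cmeasurableB.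
- apply: filterS2 (FE _ fL) (FE _ L0) => t /= -> ->.
  by rewrite fourier0 subr0.
Qed.

End equivalences.

Theorem theorem1p7 (R : realType) (d : nat) (Omega0 : set 'cV[R]_d)
    (A : 'M[int]_d) (reps : set 'cV[int]_d)
    (Omega0_open : open Omega0) (Omega0_nonempty : Omega0 !=set0)
    (detA : \det A != 0)
    (reps_complete : complete_representatives A reps)
    (Omega0_packs : packs Omega0 (lattice R A)) :
  let Omega : set 'cV[R]_d := [set x + y | x in Omega0 & y in lattice R A] in
  let mu := pair_measure Omega0 detA in
  [<-> tiles Omega (@int_mx R d 1 @` reps);
       tiles Omega0 Zlattice;
       spectral_with Omega mu;
       fourier_extends_isometrically Omega mu]
  /\ (tiles Omega0 Zlattice -> lebesgue_cV R d Omega0 = 1%:E).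
Proof.
move=> Omega mu; have mU := Omega0_packs.1.
have pA : packs Omega0 (range (lat (int_mx R A))) by rewrite -latticeE.
have OmE : Omega = periodization (int_mx R A) Omega0 by rewrite periodizationE -latticeE.
split; last exact: tiles_measure1.
rewrite OmE /mu; tfae.
- exact: tiles_cosets_lattice.
- exact: tiles_spectral.
- exact: spectral_extends.
- move=> /extends_isometric iso; apply: tiles_lattice_cosets => //.
  exact: (isometric_tiles iso).
Qed.
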